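(* Let $J$ be an interval of length $1$ containing $0$ in its interior and let $\tilde h:J\to[0,1]$ be a concave $C^{2,\alpha}$-smooth function with $\tilde h(0)=1$, $\tilde h'(0)=0$, $\tilde h''(0)<0$. Then there exist constants $N_0$, $c>0$, $C>0$, $M>2$, depending only on $\tilde h$, such that for every $N\ge N_0$ and every normalised convex planar domain $\Omega$ whose height function is $h(x)=\tilde h(N^{-1}x)$ for $x\in[a,b]=NJ$, the following holds. There is a $\delta$ with $C^{-1}N^{-2}\le\delta\le CN^{-2}$ such that $\Omega$ has Property 1 with $M$ and $\delta$, and for every unit direction $n=(n_1,n_2)$, $n_1^2+n_2^2=1$, $$C^{-1}\max\{|n_2|^2,\delta\}\le-\partial_n^2v(x,y)\le C\max\{|n_2|^2,\delta\}\qquad\text{for all }(x,y)\in B_c(x^*,y^* ),$$ where $v$ is the torsion function of $\Omega$, attaining its maximum at $(x^*,y^* )$. In particular, $-\partial_x^2v(x,y)$ is bounded above and below by positive multiples (depending only on $\tilde h$) of $N^{-2}$ for all $(x,y)\in B_c(x^*,y^* )$.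
   Context: Normalised domain: $\Omega\subset\mathbb{R}^2$ is a convex planar domain, rotated so that its projection onto the $y$-axis is the shortest among its projections onto all directions, and translated and dilated so that $\Omega=\{(x,y)\in\mathbb{R}^2: x\in[a,b],\ f_1(x)\le y\le f_2(x)\}$ with $f_1$ convex, $f_2$ concave, $0\le f_1\le f_2\le 1$, and such that the (concave) height function $h(x)=f_2(x)-f_1(x)$ satisfies $\max_{[a,b]}h=1$. The torsion function $v$ solves $\Delta v=-1$ in $\Omega$, $v=0$ on $\partial\Omega$. $\bar x\in[a,b]$ is a point with $h(\bar x)=1$ (here $\bar x=0$). $\partial_n^2v$ is the second directional derivative in direction $n$, and $B_r(p)$ is the disc of radius $r$ centred at $p$. The smoothness of $\tilde h$ is understood in the interior of $J$ (so that, e.g., the ellipse $\tilde h(s)=\sqrt{1-4s^2}$ is included). The quantity Error: for $\tilde x\in[a,b]$ put $d(\tilde x)=\min\{\tilde x-a,b-\tilde x\}$ and $$\mathrm{Error}(\tilde x)=C_1e^{-c_1d(\tilde x)}+C_1\sup_{|x-\tilde x|\le\frac34d(\tilde x)}e^{-c_1|x-\tilde x|}|h(x)-h(\tilde x)|.$$ Here $c_1,C_1>0$ are fixed constants, independent of $\Omega$, for which the following holds with a fixed, sufficiently small absolute constant $c^*\in(0,\tfrac12)$: for every normalised convex domain and every $\tilde x$ with $h(\tilde x)\ge\tfrac12$, one has $|v(\tilde x,y)-v_1(\tilde x,y)|\le\mathrm{Error}(\tilde x)$ and $|\partial_xv(\tilde x,y)|\le\mathrm{Error}(\tilde x)$ for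 all $y\in[f_1(\tilde x)+c^*,f_2(\tilde x)-c^*]$, where $v_1(x,y)=\tfrac12(y-f_1(x))(f_2(x)-y)$. (Such constants exist.) Property 1 (for given $M>2$ and $\delta$): $[\bar x-M,\bar x+M]\subset[a,b]$, $0\le\delta\le\tfrac12\min\{1-h(\bar x+M),\,1-h(\bar x-M)\}$, and, with $x_-\in[\bar x-M,\bar x]$ and $x_+\in[\bar x,\bar x+M]$ points such that $h(x_\pm)=1-2\delta$, one has $\mathrm{Error}(\tilde x)\le\tfrac1{100}\delta$ for every $\tilde x\in[x_-,x_+]$. *)

(* Defs.v *)
From HB Require Import structures.
From mathcomp Require Import all_boot all_order all_algebra.
From mathcomp Require Import all_classical all_reals all_analysis.

Set Implicit Arguments.
Unset Strict Implicit.
Unset Printing Implicit Defensive.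

Import Order.TTheory GRing.Theory Num.Theory.
Import numFieldNormedType.Exports.

Local Open Scope ring_scope.
Local Open Scope classical_set_scope.

(* The plane is R * R.  Its library norm is the sup norm: this does not affect
   closures, interiors, continuity or directional derivatives, but discs and
   unit vectors have to be written with the Euclidean norm explicitly. *)

Definition concave_function (R : realType) (D : set R) (f : R -> R) : Prop :=
  convex_function D (fun x => - f x).

Definition disc (R : realType) (p : R * R) (r : R) : set (R * R) :=
  [set q | (q.1 - p.1) ^+ 2 + (q.2 - p.2) ^+ 2 < r ^+ 2].

Definition unit_direction (R : realType) (n : R * R) : Prop :=
  n.1 ^+ 2 + n.2 ^+ 2 = 1.

(* Length of the projection of Om onto the line spanned by the unit vector u. *)
Definition projection_length (R : realType) (Om : set (R * R)) (u : R * R) : R :=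
  sup [set q.1 * u.1 + q.2 * u.2 | q in Om] -
  inf [set q.1 * u.1 + q.2 * u.2 | q in Om].

Definition region (R : realType) (a b : R) (f1 f2 : R -> R) : set (R * R) :=
  [set q | a <= q.1 <= b /\ f1 q.1 <= q.2 <= f2 q.1].

Definition height (R : realType) (f1 f2 : R -> R) (x : R) : R := f2 x - f1 x.

Record normalised_domain (R : realType) (a b : R) (f1 f2 : R -> R) : Prop :=
  NormalisedDomain {
    normalised_lt : a < b;
    normalised_convex : convex_function `[a, b] f1;
    normalised_concave : concave_function `[a, b] f2;
    normalised_bounds :
      forall x, a <= x <= b -> [/\ 0 <= f1 x, f1 x <= f2 x & f2 x <= 1];
    normalised_height_le : forall x, a <= x <= b -> height f1 f2 x <= 1;
    normalised_height_max : exists2 x, a <= x <= b & height f1 f2 x = 1;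
    normalised_shortest : forall u : R * R, unit_direction u ->
      projection_length (region a b f1 f2) (0, 1)
        <= projection_length (region a b f1 f2) u
  }.

Definition derive2 (R : realType) (n : R * R) (v : R * R -> R) (p : R * R) : R :=
  'D_n ('D_n v) p.

(* Twice continuously differentiable on the open set U. *)
Definition C2_on (R : realType) (U : set (R * R)) (v : R * R -> R) : Prop :=
  forall m n p : R * R, U p ->
    [/\ derivable v p m, derivable ('D_m v) p n
      & {for p, continuous ('D_n ('D_m v))}].

(* The classical solution, in C^2(interior) and C(closure); the values of v
   outside the closure of Om are irrelevant. *)
Record torsion_function (R : realType) (Om : set (R * R)) (v : R * R -> R) :
    Prop := TorsionFunction {
  torsion_C2 : C2_on (interior Om) v;
  torsion_continuous : {within closure Om, continuous v};
  torsion_laplacian : forall p : R * R, interior Om p ->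
    derive2 (1, 0) v p + derive2 (0, 1) v p = - 1;
  torsion_boundary : forall p : R * R, (closure Om `\` interior Om) p -> v p = 0
}.

Definition Error (R : realType) (c1 C1 a b : R) (h : R -> R) (xt : R) : R :=
  let d := Num.min (xt - a) (b - xt) in
  C1 * expR (- (c1 * d)) +
  C1 * sup [set expR (- (c1 * `|x - xt|)) * `|h x - h xt|
           | x in [set x | `|x - xt| <= 3 / 4 * d]].

Definition v1 (R : realType) (f1 f2 : R -> R) (x y : R) : R :=
  2^-1 * (y - f1 x) * (f2 x - y).

(* When xt is a or b the points (xt, y) lie on the boundary, where the
   two-sided derivative in x is meaningless; the gradient bound is therefore
   only required for a < xt < b. *)
Definition error_admissible (R : realType) (cstar c1 C1 : R) : Prop :=
  forall (a b : R) (f1 f2 : R -> R) (v : R * R -> R),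
    normalised_domain a b f1 f2 ->
    torsion_function (region a b f1 f2) v ->
    forall xt, a <= xt <= b -> 2^-1 <= height f1 f2 xt ->
    forall y, f1 xt + cstar <= y <= f2 xt - cstar ->
      `|v (xt, y) - v1 f1 f2 xt y| <= Error c1 C1 a b (height f1 f2) xt /\
      (a < xt < b ->
       `|'D_(1, 0) v (xt, y)| <= Error c1 C1 a b (height f1 f2) xt).

Definition property1 (R : realType) (c1 C1 a b : R) (h : R -> R)
    (xbar M delta : R) : Prop :=
  [/\ a <= xbar - M /\ xbar + M <= b,
      0 <= delta <= 2^-1 * Num.min (1 - h (xbar + M)) (1 - h (xbar - M))
    & exists xm xp : R,
        [/\ xbar - M <= xm <= xbar, xbar <= xp <= xbar + M,
            h xm = 1 - 2 * delta, h xp = 1 - 2 * delta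
          & forall xt, xm <= xt <= xp -> Error c1 C1 a b h xt <= delta / 100]].

(* C^{2,alpha} in the open interval (j0, j1), with the Hoelder condition on the
   second derivative required locally, i.e. on compact subintervals. *)
Definition C2alpha_interior (R : realType) (j0 j1 alpha : R) (g : R -> R) :
    Prop :=
  (forall s, j0 < s < j1 -> derivable g s 1 /\ derivable (derive1 g) s 1) /\
  (forall s0 s1, j0 < s0 -> s1 < j1 ->
     exists K : R, forall s t, s0 <= s <= s1 -> s0 <= t <= s1 ->
       `|derive1n 2 g s - derive1n 2 g t| <= K * `|s - t| `^ alpha).

(* Main.v *)
Require Import Defs.
From HB Require Import structures.
From mathcomp Require Import all_boot all_order all_algebra.
From mathcomp Require Import all_classical all_reals all_analysis.
From mathcomp Require Import ring lra.
Import Order.TTheory GRing.Theory Num.Theory.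
Import numFieldNormedType.Exports.
Local Open Scope ring_scope.
Local Open Scope classical_set_scope.
Set Implicit Arguments.
Unset Strict Implicit.
Unset Printing Implicit Defensive.

(** Put e = N^-2, let t1 = f1 and t2 = 1 - f2 be the distances of the two
    boundary graphs from the sides of the unit strip, and ka = - ht''(0).  Since
    the height at 0 is 1, both t1 and t2 vanish at 0; they are convex and
    nonnegative, and t1 + t2 = 1 - ht(x / N) is ka e x^2 / 2 + o(e) on bounded
    windows.  Beyond convexity nothing is known about t1 and t2 separately.

    Write v = y (1 - y) / 2 + W, with W harmonic.  On a window around the origin
    of fixed size W is O(e), so all its derivatives are O(e) inside the window.
    This already gives the upper bounds, and |v_xy| = O(e), which is much
    smaller than sqrt(delta).  The one quantitative point is that - v_xx is
    bounded below by a multiple of e near the maximum.  Adding to v its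
    reflection in the line y = 1/2 replaces the unknown pair t1, t2 by the known
    sum: v(x, y) + v(x, 1 - y) is, up to o(e), equal to
    y (1 - y) - (ka e / 4) (x^2 + y (1 - y)), because the difference is
    harmonic and small on the boundary of the window.  Differentiating twice in
    x on the midline gives - 2 v_xx = ka e / 2 + o(e) there, and the maximum of
    v lies within O(1 / N) of the midline and at bounded distance from x = 0.

    Everything rests on the weak maximum principle (max_principle).  Interior
    derivative bounds come from comparing odd differences with a quadratic
    polynomial and then passing to difference quotients
    (harmonic_gradient_x, harmonic_second_derivative), so that harmonic
    functions are never assumed more than twice differentiable.  The size of v
    along a vertical line X is trapped between two quadratic barriers built on
    supporting lines of t1 and t2 at X: a wedge containing the domain from above
    (torsion_profile_le) and a harmonic polynomial from below
    (torsion_profile_ge).  They give the reflected expansion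
    (reflection_bound, center_second_derivative) and the location of the
    maximum (max_location).

    Property 1 is a statement about ht alone (property1_peaked): with
    delta = min(1 - h(M), 1 - h(-M)) / 2, which is of order M^2 / N^2, the
    error term is only O(M / N^2), and a large M wins. *)

(** * Directional derivatives *)

(** An epsilon-delta form of directional differentiability; every derivative
    rule for composed functions below is read off from it. *)
Lemma is_deriveP (R : realType) (V : normedModType R) (u : V -> R)
    (p e : V) (d : R) :
  is_derive p e u d <->
  forall eps, 0 < eps -> exists2 del, 0 < del & forall h : R, `|h| < del ->
    `|u (p + h *: e) - u p - h * d| <= eps * `|h|.
Proof.
have -> : is_derive p e u d <->
    ((fun h : R => h^-1 *: ((u \o shift p) (h *: e) - u p)) @ 0^' --> d).
  split=> [[dv <-]|cv]; first exact: dv.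
  by split; [apply/cvg_ex; exists d | apply/cvg_lim].
split=> [/cvgrPdist_le cv eps e0|H].
  have := cv _ e0; rewrite near_withinE => /nbhs_ballP[del/= d0 Hd].
  exists del => // h hd; have [->|h0] := eqVneq h 0.
    by rewrite scale0r addr0 subrr mul0r subr0 normr0 mulr0.
  have := Hd h; rewrite /ball /= sub0r normrN => /(_ hd h0).
  rewrite distrC (addrC _ p) => {}Hd.
  have -> : u (p + h *: e) - u p - h * d = h * (h^-1 * (u (p + h *: e) - u p) - d).
    by rewrite [in RHS]mulrBr mulrA divff// mul1r.
  by rewrite normrM mulrC ler_wpM2r.
apply/cvgrPdist_le => eps e0; have [del d0 Hd] := H _ e0.
rewrite near_withinE; apply/nbhs_ballP; exists del; first exact: d0.
move=> h; rewrite /ball /= sub0r normrN => /Hd {}Hd h0.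
have E : u (p + h *: e) - u p - h * d = h * (h^-1 * (u (h *: e + p) - u p) - d).
  by rewrite [in RHS]mulrBr mulrA divff// mul1r (addrC (h *: e)).
by rewrite distrC -(ler_pM2l (_ : 0 < `|h|)) ?normr_gt0// -normrM -E (mulrC _ eps).
Qed.

Lemma is_derive_line (R : realType) (V : normedModType R) (u : V -> R)
    (p e : V) (t d : R) :
  is_derive t 1 (fun s : R => u (p + s *: e)) d <-> is_derive (p + t *: e) e u d.
Proof.
rewrite !is_deriveP; split => H eps e0; have [del d0 Hd] := H _ e0;
  exists del => // h /Hd; by rewrite scalerDl addrA [h%:A]mulr1.
Qed.

Lemma is_derive_unique (R : realType) (V : normedModType R) (u : V -> R)
    (p e : V) (d d' : R) : is_derive p e u d -> is_derive p e u d' -> d = d'.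
Proof. by move=> [_ <-] [_ <-]. Qed.

(** The bound on s is symmetric in the sign of t, so that one statement serves
    increments in both directions. *)
Lemma MVT_line (R : realType) (V : normedModType R) (u du : V -> R)
    (p e : V) (t : R) :
  (forall s : R, `|s| <= `|t| -> is_derive (p + s *: e) e u (du (p + s *: e))) ->
  exists2 s : R, `|s| <= `|t| & u (p + t *: e) - u p = du (p + s *: e) * t.
Proof.
move=> H.
have cont (a b : R) : (forall s, a <= s <= b -> `|s| <= `|t|) ->
    {within `[a, b], continuous (fun s : R => u (p + s *: e))}.
  move=> ab; apply: derivable_within_continuous => s /=.
  rewrite in_itv/= => /ab/H/is_derive_line[dv _]; exact: dv.
have [t0|t0] := leP 0 t.
  have ab s : 0 <= s <= t -> `|s| <= `|t| by move=> /andP[s0 st]; rewrite !ger0_norm.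
  have [|s st] := @MVT_segment R (fun s : R => u (p + s *: e))
    (fun s : R => du (p + s *: e)) 0 t t0 _ (cont _ _ ab).
    by move=> s /itvP st; apply/is_derive_line/H/ab; rewrite !st.
  rewrite scale0r addr0 subr0 => ->; exists s => //; apply: ab.
  by move: st; rewrite in_itv.
have ab s : t <= s <= 0 -> `|s| <= `|t|.
  by move=> /andP[st s0]; rewrite (ltr0_norm t0) ler0_norm// lerN2.
have [|s st] := @MVT_segment R (fun s : R => u (p + s *: e))
    (fun s : R => du (p + s *: e)) t 0 (ltW t0) _ (cont _ _ ab).
  by move=> s /itvP st; apply/is_derive_line/H/ab; rewrite !st.
rewrite scale0r addr0 sub0r mulrN => Hs.
exists s; first by apply: ab; move: st; rewrite in_itv.
by rewrite -[du _ * t]opprK -Hs opprB.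
Qed.

(** If d were positive, du would be positive just to the right of the maximum,
    and u would increase there by the mean value theorem. *)
Lemma second_derivative_le0 (R : realType) (V : normedModType R) (u du : V -> R)
    (p e : V) (d r : R) : 0 < r ->
  (forall s : R, `|s| < r -> is_derive (p + s *: e) e u (du (p + s *: e))) ->
  (forall s : R, `|s| < r -> u (p + s *: e) <= u p) ->
  is_derive p e du d -> d <= 0.
Proof.
move=> r0 Hu umax Hd; rewrite leNgt; apply/negP => d0.
have du0 : du p = 0.
  have Hin (t : R) : t \in `]- r, r[%R -> `|t| < r.
    by rewrite in_itv/= ltr_norml.
  have H0 : is_derive (0 : R) 1 (fun s : R => u (p + s *: e)) 0.
    apply: (@derive1_at_max R (fun s : R => u (p + s *: e)) (- r) r 0).
    - lra.
    - by move=> t /Hin/Hu/is_derive_line[].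
    - by rewrite in_itv/= r0 oppr_lt0 r0.
    - by move=> t /Hin/umax; rewrite scale0r addr0.
  have H1 : is_derive (0 : R) 1 (fun s : R => u (p + s *: e)) (du p).
    apply/is_derive_line; have := Hu 0.
    by rewrite scale0r addr0 normr0; exact.
  exact: (is_derive_unique H1 H0).
have [del del0 Hdel] := (is_deriveP du p e d).1 Hd (d / 2) (divr_gt0 d0 (ltr0n _ 2)).
pose t := Num.min (r / 2) (del / 2).
have t0 : 0 < t by rewrite lt_min; apply/andP; split; lra.
have tr : t < r by rewrite gt_min; apply/orP; left; lra.
have td : t < del by rewrite gt_min; apply/orP; right; lra.
have [||s] := @MVT R (fun s : R => u (p + s *: e))
    (fun s : R => du (p + s *: e)) 0 t t0.
- move=> s /itvP st; apply/is_derive_line/Hu.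
  by rewrite ger0_norm ?st// (le_lt_trans _ tr)// st.
- apply: derivable_within_continuous => s /itvP st.
  have [] : is_derive s 1 (fun s : R => u (p + s *: e)) (du (p + s *: e)).
    apply/is_derive_line/Hu.
    by rewrite ger0_norm ?st// (le_lt_trans _ tr)// st.
  by move=> dv _; exact: dv.
move=> /itvP st; rewrite scale0r addr0 => E.
have s0 : 0 < s by rewrite st.
have slt : s < t by rewrite st.
have := umax t; rewrite (ger0_norm (ltW t0)) => /(_ tr) Ut.
have := Hdel s; rewrite (ger0_norm (ltW s0)) du0 subr0 => /(_ (lt_trans slt td)).
rewrite ler_norml => /andP[Hl _].
have : 0 < du (p + s *: e) by nra.
by move=> /mulr_gt0/(_ t0); rewrite subr0 in E; lra.
Qed.

(** * The Laplacian and the weak maximum principle *)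

Lemma open_line (R : realType) (V : normedModType R) (U : set V) (p e : V) :
  open U -> U p -> exists2 r : R, 0 < r & forall s : R, `|s| < r -> U (p + s *: e).
Proof.
move=> oU Up.
have : nbhs (0 : R) [set s : R | U (p + s *: e)].
  have /(_ 0) : continuous (fun s : R => p + s *: e).
    move=> s; apply: cvgD; first exact: cvg_cst.
    by apply: cvgZr_tmp; exact: cvg_id.
  apply; rewrite scale0r addr0; exact: open_nbhs_nbhs.
move=> /nbhs_ballP[r r0 Hr]; exists r => // s sr; apply: Hr.
by rewrite /ball/= sub0r normrN.
Qed.

(** An exact second-order expansion along e; it differentiates every polynomial
    barrier without unfolding it. *)
Lemma is_derive_quadratic (R : realType) (V : normedModType R) (u : V -> R)
    (p e : V) (d c : R) :
  (forall h : R, u (p + h *: e) = u p + h * d + h ^+ 2 * c) -> is_derive p e u d.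
Proof.
move=> H; apply/is_deriveP => eps eps0.
have c0 : 0 < `|c| + 1 by have := normr_ge0 c; lra.
exists (eps / (`|c| + 1)); first exact: divr_gt0.
move=> h; rewrite ltr_pdivlMr// => hc.
rewrite H [X in `|X|](_ : _ = h * (h * c)); last by ring.
rewrite normrM mulrC ler_wpM2r// normrM.
by have := normr_ge0 h; lra.
Qed.

(** The derivatives are existentially quantified functions rather than iterated
    derivative operators: sums, affine changes of variables and barriers then
    combine pointwise, with no argument about equality near a point. *)
Definition has_laplacian (R : realType) (D : set (R * R)) (u l : R * R -> R) :=
  exists ux uy uxx uyy : R * R -> R, forall p, D p ->
    [/\ is_derive p (1, 0) u (ux p), is_derive p (0, 1) u (uy p),
        is_derive p (1, 0) ux (uxx p), is_derive p (0, 1) uy (uyy p)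
      & uxx p + uyy p = l p].

Lemma has_laplacian_sub (R : realType) (D E : set (R * R)) (u l : R * R -> R) :
  E `<=` D -> has_laplacian D u l -> has_laplacian E u l.
Proof.
move=> ED [ux [uy [uxx [uyy H]]]]; exists ux, uy, uxx, uyy => p /ED; exact: H.
Qed.

Lemma has_laplacian_eq (R : realType) (D : set (R * R)) (u l l' : R * R -> R) :
  (forall p, D p -> l p = l' p) -> has_laplacian D u l -> has_laplacian D u l'.
Proof.
move=> ll' [ux [uy [uxx [uyy H]]]]; exists ux, uy, uxx, uyy => p Dp.
by rewrite -ll'//; exact: H.
Qed.

Lemma has_laplacianD (R : realType) (D : set (R * R)) (u l v m : R * R -> R) :
  has_laplacian D u l -> has_laplacian D v m ->
  has_laplacian D (fun p => u p + v p) (fun p => l p + m p).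
Proof.
move=> [ux [uy [uxx [uyy H]]]] [vx [vy [vxx [vyy G]]]].
exists (fun p => ux p + vx p), (fun p => uy p + vy p),
  (fun p => uxx p + vxx p), (fun p => uyy p + vyy p) => p Dp.
have [H1 H2 H3 H4 <-] := H _ Dp; have [G1 G2 G3 G4 <-] := G _ Dp.
by split; [exact: is_deriveD..|rewrite addrACA].
Qed.

Lemma has_laplacianZ (R : realType) (D : set (R * R)) (u l : R * R -> R) (k : R) :
  has_laplacian D u l -> has_laplacian D (fun p => k * u p) (fun p => k * l p).
Proof.
move=> [ux [uy [uxx [uyy H]]]].
exists (fun p => k * ux p), (fun p => k * uy p),
  (fun p => k * uxx p), (fun p => k * uyy p) => p Dp.
have [H1 H2 H3 H4 <-] := H _ Dp.
by split; [exact: (@is_deriveZ)..|rewrite mulrDr].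
Qed.

Lemma has_laplacianB (R : realType) (D : set (R * R)) (u l v m : R * R -> R) :
  has_laplacian D u l -> has_laplacian D v m ->
  has_laplacian D (fun p => u p - v p) (fun p => l p - m p).
Proof.
move=> H /(has_laplacianZ (-1)) G; have := has_laplacianD H G.
have E (f g : R * R -> R) : (fun p => f p + -1 * g p) = (fun p => f p - g p).
  by apply/funext => p; rewrite mulN1r.
by rewrite !E.
Qed.

(** Only reflections and translations are needed, so each variable is scaled by
    a sign and the Laplacian is unchanged. *)
Lemma has_laplacian_affine (R : realType) (D : set (R * R)) (u l : R * R -> R)
    (c d s t : R) : s ^+ 2 = 1 -> t ^+ 2 = 1 ->
  has_laplacian D u l ->
  has_laplacian [set p | D (c + s * p.1, d + t * p.2)]
    (fun p => u (c + s * p.1, d + t * p.2)) (fun p => l (c + s * p.1, d + t * p.2)).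
Proof.
move=> s1 t1 [ux [uy [uxx [uyy H]]]].
set A := fun p : R * R => (c + s * p.1, d + t * p.2).
have Dx (f : R * R -> R) p f' : is_derive (A p) (1, 0) f f' ->
    is_derive p (1, 0) (fun p => f (A p)) (s * f').
  move=> /is_deriveP Hf; apply/is_deriveP => e e0; have [r r0 Hr] := Hf _ e0.
  have ns : `|s| = 1.
    by apply/eqP; rewrite -sqrp_eq1 ?normr_ge0// real_normK ?num_real// s1.
  exists r => // h hr; have := Hr (s * h); rewrite normrM ns mul1r => /(_ hr).
  have -> : A p + (s * h) *: ((1, 0) : R * R) = A (p + h *: (1, 0)).
    rewrite /A; congr (_, _) => /=;
      rewrite ?[_ *: 1]mulr1 ?[_ *: 0]mulr0; ring.
  by rewrite mulrAC mulrC mulrA (mulrC h).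
have Dy (f : R * R -> R) p f' : is_derive (A p) (0, 1) f f' ->
    is_derive p (0, 1) (fun p => f (A p)) (t * f').
  move=> /is_deriveP Hf; apply/is_deriveP => e e0; have [r r0 Hr] := Hf _ e0.
  have ns : `|t| = 1.
    by apply/eqP; rewrite -sqrp_eq1 ?normr_ge0// real_normK ?num_real// t1.
  exists r => // h hr; have := Hr (t * h); rewrite normrM ns mul1r => /(_ hr).
  have -> : A p + (t * h) *: ((0, 1) : R * R) = A (p + h *: (0, 1)).
    rewrite /A; congr (_, _) => /=;
      rewrite ?[_ *: 1]mulr1 ?[_ *: 0]mulr0; ring.
  by rewrite mulrAC mulrC mulrA (mulrC h).
exists (fun p => s * ux (A p)), (fun p => t * uy (A p)),
  (fun p => uxx (A p)), (fun p => uyy (A p)) => p /H[H1 H2 H3 H4 E].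
split => //; [exact: Dx|exact: Dy| |].
- have -> : uxx (A p) = s * (s * uxx (A p)) by rewrite mulrA -expr2 s1 mul1r.
  by apply: (@is_deriveZ); exact: Dx.
- have -> : uyy (A p) = t * (t * uyy (A p)) by rewrite mulrA -expr2 t1 mul1r.
  by apply: (@is_deriveZ); exact: Dy.
Qed.

Lemma has_laplacian_swap (R : realType) (D : set (R * R)) (u l : R * R -> R) :
  has_laplacian D u l ->
  has_laplacian [set p | D (p.2, p.1)] (fun p => u (p.2, p.1)) (fun p => l (p.2, p.1)).
Proof.
move=> [ux [uy [uxx [uyy H]]]].
set A := fun p : R * R => (p.2, p.1).
have Ds (f : R * R -> R) (p e : R * R) f' : is_derive (A p) (e.2, e.1) f f' ->
    is_derive p e (fun p => f (A p)) f'.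
  by move=> /is_deriveP Hf; apply/is_deriveP.
exists (uy \o A), (ux \o A), (uyy \o A), (uxx \o A) => p /H[H1 H2 H3 H4 E].
by split; [exact: Ds..|rewrite addrC].
Qed.

Lemma has_laplacian_quadratic (R : realType) (D : set (R * R))
    (a0 a1 a2 a3 a4 a5 : R) :
  has_laplacian D (fun p => a0 + a1 * p.1 + a2 * p.2 + a3 * p.1 ^+ 2
    + a4 * (p.1 * p.2) + a5 * p.2 ^+ 2) (fun=> 2 * a3 + 2 * a5).
Proof.
exists (fun p => a1 + 2 * a3 * p.1 + a4 * p.2),
  (fun p => a2 + a4 * p.1 + 2 * a5 * p.2), (fun=> 2 * a3), (fun=> 2 * a5) => p _.
split => //; [apply: (is_derive_quadratic (c := a3))
  |apply: (is_derive_quadratic (c := a5))|apply: (is_derive_quadratic (c := 0))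
  |apply: (is_derive_quadratic (c := 0))] => h /=;
  rewrite [_%:A]mulr1 [_ *: 0]mulr0 addr0; ring.
Qed.

Lemma continuous_quadratic (R : realType) (a0 a1 a2 a3 a4 a5 : R) :
  continuous (fun p : R * R => a0 + a1 * p.1 + a2 * p.2 + a3 * p.1 ^+ 2
    + a4 * (p.1 * p.2) + a5 * p.2 ^+ 2).
Proof.
have c1 (p : R * R) : {for p, continuous (fun p : R * R => p.1)} by exact: cvg_fst.
have c2 (p : R * R) : {for p, continuous (fun p : R * R => p.2)} by exact: cvg_snd.
move=> p; repeat first [apply: cvg_cst | exact: c1 | exact: c2 | apply: cvgM
  | apply: cvgD ].
Qed.

(** Adding a small multiple of p.1 ^+ 2 makes the Laplacian strictly positive, so
    that the maximum over K cannot be attained in U; compactness of K makes the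
    perturbation harmless.  The set U is any open part of K, which avoids
    identifying U with the interior of K. *)
Lemma max_principle (R : realType) (K U : set (R * R)) (u l : R * R -> R) (M : R) :
  compact K -> open U -> U `<=` K -> {within K, continuous u} ->
  has_laplacian U u l -> (forall p, U p -> 0 <= l p) ->
  (forall p, K p -> ~ U p -> u p <= M) -> forall p, K p -> u p <= M.
Proof.
move=> cK oU UK cu Lu l0 uM p0 Kp0; rewrite leNgt; apply/negP => Mp0.
have K0 : K !=set0 by exists p0.
have E eps : (fun p : R * R => 0 + 0 * p.1 + 0 * p.2 + eps * p.1 ^+ 2 +
    0 * (p.1 * p.2) + 0 * p.2 ^+ 2) = (fun p => eps * p.1 ^+ 2).
  by apply/funext => p; ring.
have cx eps : continuous (fun p : R * R => eps * p.1 ^+ 2).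
  by rewrite -E; exact: continuous_quadratic.
have [m Km mmax] := compact_EVT_max K0 cK (continuous_subspaceT (cx 1)).
set B := 1 * m.1 ^+ 2 in mmax.
have HB p : K p -> 0 <= p.1 ^+ 2 <= B.
  move=> Kp; rewrite sqr_ge0/=; have := mmax p; rewrite inE => /(_ Kp).
  by rewrite mul1r.
have B0 : 0 <= B by have /andP[? ?] := HB _ Kp0; lra.
(* Small enough that eps * x^2 < u p0 - M on K, so the perturbation does not
   bring the boundary values up to u p0. *)
pose eps := (u p0 - M) / (2 * (B + 1)).
have eps0 : 0 < eps by rewrite divr_gt0//; lra.
have epsB : eps * B < u p0 - M.
  have -> : u p0 - M = eps * (2 * (B + 1)) by rewrite /eps; field; lra.
  by rewrite ltr_pM2l//; lra.
pose w p := u p + eps * p.1 ^+ 2.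
have cw : {within K, continuous w}.
  by move=> p; apply: cvgD; [exact: cu|exact: (continuous_subspaceT (cx eps))].
have [q /set_mem Kq qmax] := compact_EVT_max K0 cK cw.
have wmax p : K p -> w p <= w q by move=> Kp; apply: qmax; rewrite inE.
have [Uq|nUq] := pselect (U q); last first.
  have := wmax _ Kp0; have := uM _ Kq nUq; rewrite /w.
  have /andP[? ?] := HB _ Kq; have /andP[? ?] := HB _ Kp0; nra.
have := has_laplacian_quadratic U 0 0 0 eps 0 0; rewrite E.
move=> /(has_laplacianD Lu)[wx [wy [wxx [wyy H]]]].
have [H1 H2 H3 H4 H5] := H _ Uq.
have [r1 r10 Hr1] := open_line ((1, 0) : R * R) oU Uq.
have [r2 r20 Hr2] := open_line ((0, 1) : R * R) oU Uq.
have : wxx q <= 0.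
  apply: (second_derivative_le0 (u := w) r10 _ _ H3) => s /Hr1.
    by move=> /H[].
  by move=> /UK/wmax.
have : wyy q <= 0.
  apply: (second_derivative_le0 (u := w) r20 _ _ H4) => s /Hr2.
    by move=> /H[].
  by move=> /UK/wmax.
by have := l0 _ Uq; lra.
Qed.

Definition closed_rectangle (R : realType) (a b c d : R) : set (R * R) :=
  [set p | a <= p.1 <= b /\ c <= p.2 <= d].

Definition open_rectangle (R : realType) (a b c d : R) : set (R * R) :=
  [set p | a < p.1 < b /\ c < p.2 < d].

Lemma compact_rectangle (R : realType) (a b c d : R) :
  compact (closed_rectangle a b c d).
Proof.
have -> : closed_rectangle a b c d = `[a, b] `*` `[c, d].
  by apply/seteqP; split=> p /=; rewrite !in_itv.
by apply: compact_setX; exact: segment_compact.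
Qed.

Lemma open_rectangle_open (R : realType) (a b c d : R) :
  open (open_rectangle a b c d).
Proof.
have -> : open_rectangle a b c d = (fst @^-1` `]a, b[) `&` (snd @^-1` `]c, d[).
  by apply/seteqP; split=> p /=; rewrite !in_itv.
apply: openI; apply: open_comp; try exact: itv_open.
- by move=> p _; exact: cvg_fst.
- by move=> p _; exact: cvg_snd.
Qed.

Lemma max_principle_rectangle (R : realType) (a b c d : R) (u l : R * R -> R) (M : R) :
  (forall p, closed_rectangle a b c d p -> {for p, continuous u}) ->
  has_laplacian (open_rectangle a b c d) u l ->
  (forall p, open_rectangle a b c d p -> 0 <= l p) ->
  (forall p, closed_rectangle a b c d p ->
    p.1 = a \/ p.1 = b \/ p.2 = c \/ p.2 = d -> u p <= M) ->
  forall p, closed_rectangle a b c d p -> u p <= M.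
Proof.
move=> cu Lu l0 uM; apply: (max_principle (U := open_rectangle a b c d)
  (@compact_rectangle _ _ _ _ _) (@open_rectangle_open _ _ _ _ _) _ _ Lu l0).
- by move=> p [/andP[? ?] /andP[? ?]]; split; apply/andP; split; exact: ltW.
- by apply: continuous_in_subspaceT => p /set_mem; exact: cu.
- move=> p Kp nUp; apply: uM => //; apply: contrapT => H; apply: nUp.
  have [/andP[h1 h2] /andP[h3 h4]] := Kp.
  by split; apply/andP; split; rewrite lt_neqAle ?h1 ?h2 ?h3 ?h4 andbT;
    apply/eqP => E; apply: H; rewrite E; tauto.
Qed.

(** * Interior gradient bounds for harmonic functions *)

(** Two partial derivatives of each order do not imply continuity, hence the
    second clause. *)
Definition harmonic (R : realType) (D : set (R * R)) (u : R * R -> R) :=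
  has_laplacian D u (fun=> 0) /\ forall p, D p -> {for p, continuous u}.

Lemma harmonic_sub (R : realType) (D E : set (R * R)) (u : R * R -> R) :
  E `<=` D -> harmonic D u -> harmonic E u.
Proof. by move=> ED [Lu cu]; split; [exact: has_laplacian_sub Lu|move=> p /ED/cu]. Qed.

Lemma harmonicB (R : realType) (D : set (R * R)) (u v : R * R -> R) :
  harmonic D u -> harmonic D v -> harmonic D (fun p => u p - v p).
Proof.
move=> [Lu cu] [Lv cv]; split; last first.
  by move=> p Dp; apply: cvgB; [exact: cu|exact: cv].
by apply: has_laplacian_eq (has_laplacianB Lu Lv) => p _; rewrite subr0.
Qed.

Lemma harmonicZ (R : realType) (D : set (R * R)) (u : R * R -> R) (k : R) :
  harmonic D u -> harmonic D (fun p => k * u p).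
Proof.
move=> [Lu cu]; split; last first.
  by move=> p Dp; apply: cvgM; [exact: cvg_cst|exact: cu].
by apply: has_laplacian_eq (has_laplacianZ k Lu) => p _; rewrite mulr0.
Qed.

Lemma continuous_affine_pair (R : realType) (c d s t : R) :
  continuous (fun p : R * R => (c + s * p.1, d + t * p.2)).
Proof.
move=> p.
have h1 : c + s * q.1 @[q --> p] --> c + s * p.1.
  by apply: cvgD; [exact: cvg_cst|apply: cvgM; [exact: cvg_cst|exact: cvg_fst]].
have h2 : d + t * q.2 @[q --> p] --> d + t * p.2.
  by apply: cvgD; [exact: cvg_cst|apply: cvgM; [exact: cvg_cst|exact: cvg_snd]].
exact: (cvg_pair h1 h2).
Qed.

Lemma harmonic_affine (R : realType) (D : set (R * R)) (u : R * R -> R)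
    (c d s t : R) : s ^+ 2 = 1 -> t ^+ 2 = 1 -> harmonic D u ->
  harmonic [set p | D (c + s * p.1, d + t * p.2)]
    (fun p => u (c + s * p.1, d + t * p.2)).
Proof.
move=> s1 t1 [Lu cu]; split; first exact: (has_laplacian_affine c d s1 t1 Lu).
move=> p /= /cu H; exact: (continuous_comp (@continuous_affine_pair R c d s t p) H).
Qed.

Lemma continuous_swap_pair (R : realType) :
  continuous (fun p : R * R => (p.2, p.1)).
Proof.
move=> p; have h1 : q.2 @[q --> p] --> p.2 by exact: cvg_snd.
have h2 : q.1 @[q --> p] --> p.1 by exact: cvg_fst.
exact: (cvg_pair h1 h2).
Qed.

Lemma harmonic_swap (R : realType) (D : set (R * R)) (u : R * R -> R) :
  harmonic D u -> harmonic [set p | D (p.2, p.1)] (fun p => u (p.2, p.1)).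
Proof.
move=> [Lu cu]; split; first exact: (has_laplacian_swap Lu).
move=> p /= /cu H; exact: (continuous_comp (@continuous_swap_pair R p) H).
Qed.

Definition square (R : realType) (p : R * R) (r : R) : set (R * R) :=
  [set q | `|q.1 - p.1| <= r /\ `|q.2 - p.2| <= r].

(** The odd difference of u in x vanishes on the axis of the half square
    p.1 <= x <= p.1 + r and is at most 2 A on it.  Twice the harmonic polynomial
    (A / r^2) ((y - p.2)^2 + (x - p.1) (2 r - (x - p.1))) is nonnegative on the
    axis and at least 2 A on the three other sides, so it dominates the odd
    difference. *)
Lemma harmonic_odd_bound (R : realType) (D : set (R * R)) (u : R * R -> R)
    (p : R * R) (r A t : R) : 0 < r -> square p r `<=` D -> harmonic D u ->
  (forall q, square p r q -> `|u q| <= A) -> 0 <= t <= r ->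
  u (p.1 + t, p.2) - u (p.1 - t, p.2) <= 4 * A * t / r.
Proof.
move=> r0 QD hu uA /andP[t0 tr].
have A0 : 0 <= A.
  by apply: le_trans (uA p _) => //; split; rewrite subrr normr0 ltW.
pose K := closed_rectangle p.1 (p.1 + r) (p.2 - r) (p.2 + r).
have Kin q : K q -> square p r q /\ square p r (2 * p.1 - q.1, q.2).
  move=> [/andP[? ?] /andP[? ?]]; split; split => /=;
  rewrite ler_norml; apply/andP; split; lra.
pose v q := u (2 * p.1 + -1 * q.1, 0 + 1 * q.2).
have vE q : v q = u (2 * p.1 - q.1, q.2) by rewrite /v mulN1r add0r mul1r.
have hv : harmonic K v.
  have := harmonic_affine (2 * p.1) 0 (_ : (-1 : R) ^+ 2 = 1) (_ : (1 : R) ^+ 2 = 1) hu.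
  rewrite sqrrN expr1n => /(_ erefl erefl); apply: harmonic_sub => q /Kin[_ H] /=.
  by rewrite mulN1r add0r mul1r; exact: QD.
have huK : harmonic K u by apply: harmonic_sub hu => q /Kin[+ _]; exact: QD.
pose k := A / r ^+ 2.
pose psi (q : R * R) := 2 * (k * ((q.2 - p.2) ^+ 2 + (q.1 - p.1) * (2 * r - (q.1 - p.1)))).
have psiE : psi = (fun q => 2 * k * (p.2 ^+ 2 - p.1 * (2 * r + p.1))
   + (2 * k * (2 * r + 2 * p.1)) * q.1 + (2 * k * - (2 * p.2)) * q.2
   + (- (2 * k)) * q.1 ^+ 2 + 0 * (q.1 * q.2) + (2 * k) * q.2 ^+ 2).
  by apply/funext => q; rewrite /psi; ring.
have hpsi : harmonic K psi.
  split; last by move=> q _; rewrite psiE; exact: continuous_quadratic.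
  rewrite psiE; apply: has_laplacian_eq (has_laplacian_quadratic _ _ _ _ _ _ _).
  by move=> q _; ring.
have [Lw cw] := harmonicB (harmonicB huK hv) hpsi.
have k0 : 0 <= k by rewrite divr_ge0// sqr_ge0.
have kr : k * r ^+ 2 = A by rewrite /k divfK// sqrf_eq0 gt_eqF.
have := max_principle_rectangle (M := 0) cw (has_laplacian_sub _ Lw) (fun _ _ => lexx 0) _.
have OK : open_rectangle p.1 (p.1 + r) (p.2 - r) (p.2 + r) `<=` K.
  by move=> q [/andP[? ?] /andP[? ?]]; split; apply/andP; split; exact: ltW.
move=> /(_ OK _ (p.1 + t, p.2)) /=; rewrite vE /= => H.
have : u (p.1 + t, p.2) - u (2 * p.1 - (p.1 + t), p.2) - psi (p.1 + t, p.2) <= 0.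
  apply: H; last by split => /=; apply/andP; split; lra.
  move=> q Kq side.
  have [q1 q2] := Kin _ Kq.
  have := uA _ q1; rewrite ler_norml => /andP[_ a1].
  have := uA _ q2; rewrite ler_norml => /andP[a2 _].
  have [/andP[x1 x2] /andP[y1 y2]] := Kq.
  rewrite vE; case: side => [E|[E|side]].
  - have -> : 2 * p.1 - q.1 = q.1 by rewrite E; ring.
    rewrite -surjective_pairing subrr sub0r oppr_le0 /psi E subrr mul0r addr0.
    by rewrite mulr_ge0// mulr_ge0// sqr_ge0.
  - have : 2 * A <= psi q.
      rewrite /psi E -kr; have := sqr_ge0 (q.2 - p.2); nra.
    by lra.
  - have E : (q.2 - p.2) ^+ 2 = r ^+ 2 by case: side => ->; ring.
    have : 2 * A <= psi q.
      rewrite /psi E -kr; have : 0 <= (q.1 - p.1) * (2 * r - (q.1 - p.1)).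
        by apply: mulr_ge0; lra.
      nra.
    by lra.
have -> : 2 * p.1 - (p.1 + t) = p.1 - t by ring.
have : psi (p.1 + t, p.2) <= 4 * A * t / r.
  rewrite /psi /= subrr (_ : p.1 + t - p.1 = t); last by ring.
  have -> : 4 * A * t / r = 2 * (k * (t * (2 * r))).
    by rewrite -kr; field; rewrite gt_eqF.
  rewrite ler_wpM2l// ler_wpM2l// expr0n add0r ler_wpM2l//; lra.
lra.
Qed.

(** Divide the bound on the odd difference by 2 t and let t tend to 0. *)
Lemma harmonic_gradient_x (R : realType) (D : set (R * R)) (u : R * R -> R)
    (p : R * R) (r A d : R) : 0 < r -> square p r `<=` D -> harmonic D u ->
  (forall q, square p r q -> `|u q| <= A) -> is_derive p (1, 0) u d ->
  `|d| <= 2 * A / r.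
Proof.
wlog : u d / 0 <= d.
  move=> wl r0 QD hu uA du; have [d0|d0] := leP 0 d; first exact: (wl u).
  rewrite -normrN; apply: (wl (fun p => - u p)) => //.
  - by rewrite oppr_ge0 ltW.
  - have := harmonicZ (-1) hu; congr (harmonic _ _); apply/funext => q.
    by rewrite mulN1r.
  - by move=> q /uA; rewrite normrN.
move=> d0 r0 QD hu uA /is_deriveP du; rewrite ger0_norm//.
apply/ler_addgt0Pr => e e0; have [del del0 H] := du _ e0.
pose t := Num.min (del / 2) r.
have t0 : 0 < t by rewrite lt_min r0 andbT; lra.
have td : t < del by rewrite gt_min; apply/orP; left; lra.
have tr : t <= r by rewrite ge_min lexx orbT.
have Ep (h : R) : p + h *: ((1, 0) : R * R) = (p.1 + h, p.2).
  by rewrite /GRing.add/= /GRing.scale/=; congr (_, _) => /=;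
    rewrite ?[_ *: 1]mulr1 ?[_ *: 0]mulr0 ?addr0.
have := H t; rewrite Ep ger0_norm ?(ltW t0)// => /(_ td).
have := H (- t); rewrite Ep normrN ger0_norm ?(ltW t0)// => /(_ td).
have := harmonic_odd_bound r0 QD hu uA (_ : 0 <= t <= r).
rewrite tr ltW// => /(_ erefl) h1; rewrite !ler_norml => /andP[h2 h2'] /andP[h3 h3'].
rewrite -(ler_pM2l (_ : 0 < 2 * t)); last lra.
have : 4 * A * t / r = 2 * t * (2 * A / r) by field; rewrite gt_eqF.
lra.
Qed.

Lemma harmonic_gradient (R : realType) (D : set (R * R)) (u : R * R -> R)
    (p e : R * R) (r A d : R) : e = (1, 0) \/ e = (0, 1) ->
  0 < r -> square p r `<=` D -> harmonic D u ->
  (forall q, square p r q -> `|u q| <= A) -> is_derive p e u d ->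
  `|d| <= 2 * A / r.
Proof.
move=> [->|->]; first exact: harmonic_gradient_x.
move=> r0 QD hu uA /is_deriveP du.
apply: (harmonic_gradient_x (p := (p.2, p.1)) r0 _ (harmonic_swap hu)).
- by move=> q [q1 q2]; apply: QD.
- by move=> q [q1 q2]; apply: uA.
- apply/is_deriveP => eps /du[del del0 H]; exists del => // h /H.
  by rewrite -surjective_pairing.
Qed.

(** * Interior estimates for second derivatives *)

Lemma add_scale_ex (R : realType) (q : R * R) (t : R) :
  q + t *: ((1, 0) : R * R) = (q.1 + t, q.2).
Proof. by congr (_, _) => /=; rewrite ?[_ *: 1]mulr1 ?[_ *: 0]mulr0 ?addr0. Qed.

Lemma add_scale_ey (R : realType) (q : R * R) (t : R) :
  q + t *: ((0, 1) : R * R) = (q.1, q.2 + t).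
Proof. by congr (_, _) => /=; rewrite ?[_ *: 1]mulr1 ?[_ *: 0]mulr0 ?addr0. Qed.

Lemma harmonic_translate (R : realType) (D : set (R * R)) (u : R * R -> R)
    (h : R * R) : harmonic D u ->
  harmonic [set q | D (q + h)] (fun q => u (q + h)).
Proof.
move=> hu; have E q : (h.1 + 1 * q.1, h.2 + 1 * q.2) = q + h.
  by rewrite !mul1r (addrC h.1) (addrC h.2).
have := harmonic_affine h.1 h.2 (expr1n _ 2) (expr1n _ 2) hu.
have -> : [set p | D (h.1 + 1 * p.1, h.2 + 1 * p.2)] = [set q | D (q + h)].
  by apply/funext => q /=; rewrite E.
have -> // : (fun p => u (h.1 + 1 * p.1, h.2 + 1 * p.2)) = (fun q => u (q + h)).
by apply/funext => q /=; rewrite E.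
Qed.

Lemma is_derive_translate (R : realType) (u : R * R -> R) (p e h : R * R) (d : R) :
  is_derive (p + h) e u d -> is_derive p e (fun q => u (q + h)) d.
Proof.
move=> /is_deriveP H; apply/is_deriveP => eps /H[del del0 Hd].
by exists del => // t /Hd; rewrite (addrAC p).
Qed.

Lemma harmonic_ex_derive (R : realType) (D : set (R * R)) (u : R * R -> R)
    (e : R * R) : e = (1, 0) \/ e = (0, 1) -> harmonic D u ->
  exists ue : R * R -> R, forall q, D q -> is_derive q e u (ue q).
Proof.
by move=> [->|->] [[ux [uy [uxx [uyy H]]]] _]; [exists ux|exists uy] => q /H[? ? ? ? ?].
Qed.

Lemma square_translate (R : realType) (p q e : R * R) (r r' t : R) :
  e = (1, 0) \/ e = (0, 1) -> square p r q -> `|t| <= r' ->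
  square p (r + r') (q + t *: e).
Proof.
move=> He [q1 q2] tr; have r0 : 0 <= r' by apply: le_trans tr.
have key (x y : R) : `|x| <= r -> `|y| <= r' -> `|x + y| <= r + r'.
  by move=> ? ?; apply: le_trans (ler_normD _ _) _; exact: lerD.
case: He => ->; rewrite ?add_scale_ex ?add_scale_ey; split => /=;
  rewrite ?(addrAC _ t); try exact: key; by first [apply: (le_trans q1)|apply: (le_trans q2)]; rewrite lerDl.
Qed.

Lemma square_sub (R : realType) (p q : R * R) (r r' : R) :
  square p r q -> square q r' `<=` square p (r + r').
Proof.
have key (x y z : R) : `|x - y| <= r -> `|z - x| <= r' -> `|z - y| <= r + r'.
  move=> h1 h2; rewrite (_ : z - y = (x - y) + (z - x)); last by ring.
  by apply: le_trans (ler_normD _ _) _; exact: lerD.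
by move=> [q1 q2] s [s1 s2]; split; [exact: key s1|exact: key s2].
Qed.

Lemma square_le (R : realType) (p : R * R) (r r' : R) :
  r <= r' -> square p r `<=` square p r'.
Proof. by move=> rr q [q1 q2]; split; exact: le_trans rr. Qed.

(** Mean value theorem, with the gradient bound applied on squares of half-side
    r / 2 around the intermediate points. *)
Lemma harmonic_lipschitz (R : realType) (D : set (R * R)) (u : R * R -> R)
    (p q e : R * R) (r A t : R) : e = (1, 0) \/ e = (0, 1) ->
  0 < r -> square p r `<=` D -> harmonic D u ->
  (forall q, square p r q -> `|u q| <= A) ->
  square p (r / 4) q -> `|t| <= r / 4 ->
  `|u (q + t *: e) - u q| <= 4 * A / r * `|t|.
Proof.
move=> He r0 QD hu uA Qq tr.
have [ue Hue] := harmonic_ex_derive He hu.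
have Hs s : `|s| <= `|t| -> square p (r / 2) (q + s *: e).
  move=> st; apply: square_le (square_translate He Qq (le_trans st tr)); lra.
have sub s : `|s| <= `|t| -> square (q + s *: e) (r / 2) `<=` square p r.
  by move=> /Hs Hq; apply: subset_trans (square_sub Hq) _; apply: square_le; lra.
have [|s st ->] := @MVT_line _ _ u ue q e t.
  by move=> s st; apply/Hue/QD; apply: square_le (Hs _ st); lra.
rewrite normrM ler_wpM2r//.
have -> : 4 * A / r = 2 * A / (r / 2) by field; rewrite gt_eqF.
apply: (harmonic_gradient He _ _ hu); first by rewrite divr_gt0.
- by move=> z /(sub s st)/QD.
- by move=> z /(sub s st)/uA.
- by apply/Hue/QD; apply: square_le (Hs _ st); lra.
Qed.

(** A second derivative is the limit of first derivatives of difference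
    quotients.  These quotients are harmonic and bounded by the Lipschitz
    constant, so the gradient bound applies to them uniformly.  No differentiability
    of the second derivatives enters. *)
Lemma harmonic_second_derivative (R : realType) (D : set (R * R))
    (u ue : R * R -> R) (p e e' : R * R) (r A d : R) :
  e = (1, 0) \/ e = (0, 1) -> e' = (1, 0) \/ e' = (0, 1) ->
  0 < r -> square p r `<=` D -> harmonic D u ->
  (forall q, square p r q -> `|u q| <= A) ->
  (forall q, square p r q -> is_derive q e u (ue q)) ->
  is_derive p e' ue d -> `|d| <= 32 * A / r ^+ 2.
Proof.
move=> He He' r0 QD hu uA Hue /is_deriveP Hd.
apply/ler_addgt0Pr => eps eps0; have [del del0 {}Hd] := Hd _ eps0.
pose t := Num.min (del / 2) (r / 4).
have t0 : 0 < t by rewrite lt_min; apply/andP; split; lra.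
have td : t < del by rewrite gt_min; apply/orP; left; lra.
have tr : t <= r / 4 by rewrite ge_min lexx orbT.
have nt : `|t| = t by rewrite gtr0_norm.
have sq0 : square p 0 p by split; rewrite subrr normr0.
have sub : square p (r / 4) `<=` [set q | D (q + t *: e')].
  move=> q Qq; apply: QD; have := square_translate He' Qq (t := t) (r' := r / 4).
  by rewrite nt => /(_ tr); apply: square_le; lra.
have r4 : r / 4 <= r by lra.
have hu4 := harmonic_sub (subset_trans (@square_le _ p _ _ r4) QD) hu.
have hw := harmonicB (harmonic_sub sub (harmonic_translate (t *: e') hu)) hu4.
have := harmonic_gradient He (_ : 0 < r / 4) (_ : square p (r / 4) `<=` _) hw
  (A := 4 * A / r * t) _ (d := ue (p + t *: e') - ue p).
rewrite divr_gt0// => /(_ isT (@subset_refl _ _)) H.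
have : `|ue (p + t *: e') - ue p| <= 2 * (4 * A / r * t) / (r / 4).
  apply: H.
    move=> q Qq; have := harmonic_lipschitz He' r0 QD hu uA Qq (t := t).
    by rewrite nt; exact.
  have -> : (fun p => u (p + t *: e') - u p) = (fun p => u (p + t *: e')) - u by [].
  apply: is_deriveB; last by apply: Hue; apply: square_le sq0; lra.
  apply: is_derive_translate; apply: Hue.
  have := square_translate He' sq0 (t := t) (r' := r / 4).
  by rewrite nt => /(_ tr); apply: square_le; lra.
have -> : 2 * (4 * A / r * t) / (r / 4) = t * (32 * A / r ^+ 2).
  by field; rewrite gt_eqF.
have := Hd t; rewrite nt => /(_ td).
move=> h1 h2; rewrite -(ler_pM2l t0).
have -> : t * `|d| = `|t * d| by rewrite normrM nt.
rewrite -[t * d](subKr (ue (p + t *: e') - ue p)).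
apply: le_trans (ler_normB _ _) _; rewrite mulrDr (mulrC t eps); exact: lerD.
Qed.

(** The previous bound for the harmonic function u (q + t e'') - u q, which is
    O(|t|); it replaces a bound on third derivatives, which need not be known
    to exist. *)
Lemma harmonic_second_derivative_lipschitz (R : realType) (D : set (R * R))
    (u ue : R * R -> R) (p e e' e'' : R * R) (r A t d0 d1 : R) :
  e = (1, 0) \/ e = (0, 1) -> e' = (1, 0) \/ e' = (0, 1) ->
  e'' = (1, 0) \/ e'' = (0, 1) ->
  0 < r -> square p r `<=` D -> harmonic D u ->
  (forall q, square p r q -> `|u q| <= A) ->
  (forall q, square p r q -> is_derive q e u (ue q)) -> `|t| <= r / 4 ->
  is_derive p e' ue d0 -> is_derive (p + t *: e'') e' ue d1 ->
  `|d1 - d0| <= 2048 * A / r ^+ 3 * `|t|.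
Proof.
move=> He He' He'' r0 QD hu uA Hue tr H0 H1.
have shift : square p (r / 4) `<=` [set q | square p r (q + t *: e'')].
  move=> q Qq; have := square_translate He'' Qq tr; apply: square_le; lra.
have sub : square p (r / 4) `<=` [set q | D (q + t *: e'')].
  by move=> q /shift; exact: QD.
have r4 : r / 4 <= r by lra.
have hu4 := harmonic_sub (subset_trans (@square_le _ p _ _ r4) QD) hu.
have hw := harmonicB (harmonic_sub sub (harmonic_translate (t *: e'') hu)) hu4.
have -> : 2048 * A / r ^+ 3 * `|t| = 32 * (4 * A / r * `|t|) / (r / 4) ^+ 2.
  by field; rewrite gt_eqF.
apply: (harmonic_second_derivative (ue := fun q => ue (q + t *: e'') - ue q)
  He He' _ (@subset_refl _ (square p (r / 4))) hw); first by rewrite divr_gt0.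
- by move=> q Qq; exact: (harmonic_lipschitz He'' r0 QD hu uA Qq tr).
- move=> q Qq.
  have -> : (fun p => u (p + t *: e'') - u p) = (fun p => u (p + t *: e'')) - u by [].
  apply: is_deriveB; first by apply: is_derive_translate; exact: Hue (shift _ Qq).
  by apply: Hue; apply: square_le Qq; lra.
- have -> : (fun p => ue (p + t *: e'') - ue p) = (fun p => ue (p + t *: e'')) - ue by [].
  by apply: is_deriveB => //; exact: is_derive_translate.
Qed.

(** * The second derivative as a quadratic form in the direction *)

Lemma nbhs_square (R : realType) (p : R * R) (A : set (R * R)) : nbhs p A ->
  exists2 r : R, 0 < r &
    forall q : R * R, `|q.1 - p.1| < r -> `|q.2 - p.2| < r -> A q.
Proof.
move=> /nbhs_ballP[r /= r0 rA]; exists r => // q q1 q2; apply: rA.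
by split; rewrite /ball/= distrC.
Qed.

(** Continuous partial derivatives imply differentiability: go from p to p + h
    along two sides of a rectangle and apply the mean value theorem on each. *)
Lemma increment_bound (R : realType) (U : set (R * R)) (g gx gy : R * R -> R)
    (p : R * R) : open U -> U p ->
  (forall q, U q -> is_derive q (1, 0) g (gx q)) ->
  (forall q, U q -> is_derive q (0, 1) g (gy q)) ->
  {for p, continuous gx} -> {for p, continuous gy} ->
  forall eps : R, 0 < eps -> exists2 del, 0 < del & forall h : R * R,
    `|h.1| < del -> `|h.2| < del ->
    `|g (p + h) - g p - (h.1 * gx p + h.2 * gy p)| <= eps * (`|h.1| + `|h.2|).
Proof.
move=> oU Up Hx Hy /cvgrPdist_le cx /cvgrPdist_le cy eps eps0.
have [r1 r10 H1] := nbhs_square (open_nbhs_nbhs (conj oU Up)).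
have [r2 r20 H2] := nbhs_square (cx _ eps0).
have [r3 r30 H3] := nbhs_square (cy _ eps0).
exists (Num.min r1 (Num.min r2 r3)); first by rewrite !lt_min r10 r20.
move=> h; rewrite !lt_min => /and3P[a1 a2 a3] /and3P[b1 b2 b3].
have [|s sh Es] := @MVT_line _ _ g gx p (1, 0) h.1.
  move=> s sh; apply/Hx; rewrite add_scale_ex; apply: H1 => /=.
    by rewrite addrC addKr (le_lt_trans sh).
  by rewrite subrr normr0.
have [|t th Et] := @MVT_line _ _ g gy (p.1 + h.1, p.2) (0, 1) h.2.
  move=> t th; apply/Hy; rewrite add_scale_ey; apply: H1 => /=.
    by rewrite addrC addKr.
  by rewrite addrC addKr (le_lt_trans th).
move: Es Et; rewrite !add_scale_ex !add_scale_ey /= => Es Et.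
have := H2 (p.1 + s, p.2); rewrite /= subrr normr0 addrC addKr.
move=> /(_ (le_lt_trans sh a2) r20) Gx.
have := H3 (p.1 + h.1, p.2 + t); rewrite /= (addrC p.1) addrK (addrC p.2) addrK.
move=> /(_ a3 (le_lt_trans th b3)) Gy.
have -> : g (p + h) - g p - (h.1 * gx p + h.2 * gy p) =
  (gx (p.1 + s, p.2) - gx p) * h.1 + (gy (p.1 + h.1, p.2 + t) - gy p) * h.2.
  rewrite !mulrBl -Es -Et (_ : p + h = (p.1 + h.1, p.2 + h.2)) //. ring.
apply: le_trans (ler_normD _ _) _; rewrite mulrDr !normrM.
rewrite (addrC h.1) (addrC t) in Gy.
by apply: lerD; rewrite ler_wpM2r// distrC.
Qed.

Lemma is_derive_linear (R : realType) (U : set (R * R)) (g gx gy : R * R -> R)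
    (p n : R * R) : open U -> U p ->
  (forall q, U q -> is_derive q (1, 0) g (gx q)) ->
  (forall q, U q -> is_derive q (0, 1) g (gy q)) ->
  {for p, continuous gx} -> {for p, continuous gy} ->
  is_derive p n g (n.1 * gx p + n.2 * gy p).
Proof.
move=> oU Up Hx Hy cx cy; apply/is_deriveP => eps eps0.
pose k := `|n.1| + `|n.2| + 1.
have k0 : 0 < k by have := normr_ge0 n.1; have := normr_ge0 n.2; rewrite /k; lra.
have [del del0 H] := increment_bound oU Up Hx Hy cx cy (divr_gt0 eps0 k0).
exists (del / k); first exact: divr_gt0.
move=> h; rewrite ltr_pdivlMr// => hk.
have small x : `|x| <= k -> `|h * x| < del.
  by move=> xk; rewrite normrM; apply: le_lt_trans hk; exact: ler_wpM2l.
have := H (h *: n); rewrite [(h *: n).1]/(h * n.1) [(h *: n).2]/(h * n.2).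
have := normr_ge0 n.1; have := normr_ge0 n.2 => n2 n1.
rewrite !small ?/k; [|lra..] => /(_ isT isT); rewrite (mulrDr h) !(mulrA h) => {}H.
apply: le_trans H _; rewrite !normrM -mulrDr -mulrA ler_wpM2l ?(ltW eps0)//.
rewrite mulrCA ler_piMr// mulrC ler_pdivrMr//; rewrite /k; lra.
Qed.

Lemma continuous_of_partials (R : realType) (U : set (R * R)) (g gx gy : R * R -> R)
    (p : R * R) : open U -> U p ->
  (forall q, U q -> is_derive q (1, 0) g (gx q)) ->
  (forall q, U q -> is_derive q (0, 1) g (gy q)) ->
  {for p, continuous gx} -> {for p, continuous gy} -> {for p, continuous g}.
Proof.
move=> oU Up Hx Hy cx cy; apply/cvgrPdist_le => eps eps0.
have [del del0 H] := increment_bound oU Up Hx Hy cx cy (ltr01).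
pose k := `|gx p| + `|gy p| + 2.
have k0 : 0 < k by have := normr_ge0 (gx p); have := normr_ge0 (gy p); rewrite /k; lra.
pose r := Num.min del (eps / k).
have r0 : 0 < r by rewrite lt_min del0 divr_gt0.
apply: (@filterS _ (nbhs p) _ (ball p r)); last exact: nbhsx_ballx.
move=> q [q1 q2].
have : `|q.1 - p.1| < r by rewrite distrC.
have : `|q.2 - p.2| < r by rewrite distrC.
rewrite !lt_min => /andP[{}q2 q2'] /andP[{}q1 q1'].
have := H (q.1 - p.1, q.2 - p.2) q1 q2.
have -> : p + (q.1 - p.1, q.2 - p.2) = q.
  by rewrite [RHS]surjective_pairing; congr (_, _); rewrite /= addrC subrK.
rewrite mul1r /=.
move=> {}H; rewrite distrC -[g q - g p](subrK ((q.1 - p.1) * gx p + (q.2 - p.2) * gy p)).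
apply: le_trans (ler_normD _ _) _; apply: le_trans (lerD H (ler_normD _ _)) _.
rewrite !normrM; set a := `|q.1 - p.1|; set b := `|q.2 - p.2|.
have a0 : 0 <= a by exact: normr_ge0.
have b0 : 0 <= b by exact: normr_ge0.
rewrite ltr_pdivlMr// in q1'; rewrite ltr_pdivlMr// in q2'.
have g1 := normr_ge0 (gx p); have g2 := normr_ge0 (gy p).
rewrite -/a in q1'; rewrite -/b in q2'; rewrite /k in q1' q2'.
nra.
Qed.

Section C2.
Context (R : realType) (U : set (R * R)) (v : R * R -> R).
Hypotheses (oU : open U) (cv : C2_on U v).

Let deriv m q : U q -> is_derive q m v ('D_m v q).
Proof. by move=> /(cv m m)[dv _ _]; exact: derivableP. Qed.

Let deriv2 m n q : U q -> is_derive q n ('D_m v) ('D_n ('D_m v) q).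
Proof. by move=> /(cv m n)[_ dv _]; exact: derivableP. Qed.

Lemma C2_derive_continuous m p : U p -> {for p, continuous ('D_m v)}.
Proof.
move=> Up; apply: (@continuous_of_partials _ U ('D_m v) ('D_(1, 0) ('D_m v))
  ('D_(0, 1) ('D_m v)) p oU Up (@deriv2 m (1, 0)) (@deriv2 m (0, 1))).
  by have [] := cv m (1, 0) Up.
by have [] := cv m (0, 1) Up.
Qed.

Lemma C2_continuous p : U p -> {for p, continuous v}.
Proof.
move=> Up; apply: (@continuous_of_partials _ U v ('D_(1, 0) v) ('D_(0, 1) v) p oU Up
  (@deriv (1, 0)) (@deriv (0, 1))); exact: C2_derive_continuous.
Qed.

(** Symmetry of the mixed derivatives is not established: their sum is all that
    occurs. *)
Lemma derive2_quadratic_form n p : U p ->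
  derive2 n v p = n.1 ^+ 2 * derive2 (1, 0) v p
    + n.1 * n.2 * ('D_(0, 1) ('D_(1, 0) v) p + 'D_(1, 0) ('D_(0, 1) v) p)
    + n.2 ^+ 2 * derive2 (0, 1) v p.
Proof.
move=> Up.
have Dn q : U q -> 'D_n v q = n.1 * 'D_(1, 0) v q + n.2 * 'D_(0, 1) v q.
  move=> Uq; apply: derive_val.
  by apply: (@is_derive_linear _ U v ('D_(1, 0) v) ('D_(0, 1) v) q n oU Uq
    (@deriv (1, 0)) (@deriv (0, 1))); exact: C2_derive_continuous.
have D2 m : 'D_n ('D_m v) p = n.1 * 'D_(1, 0) ('D_m v) p + n.2 * 'D_(0, 1) ('D_m v) p.
  apply: derive_val; apply: (@is_derive_linear _ U ('D_m v) ('D_(1, 0) ('D_m v))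
    ('D_(0, 1) ('D_m v)) p n oU Up (@deriv2 m (1, 0)) (@deriv2 m (0, 1))).
    by have [] := cv m (1, 0) Up.
  by have [] := cv m (0, 1) Up.
rewrite /derive2 (@near_eq_derive _ _ _ _ (fun q => n.1 * 'D_(1, 0) v q + n.2 * 'D_(0, 1) v q)).
  have -> : 'D_n (fun q => n.1 * 'D_(1, 0) v q + n.2 * 'D_(0, 1) v q) p
      = n.1 * 'D_n ('D_(1, 0) v) p + n.2 * 'D_n ('D_(0, 1) v) p.
    apply: derive_val; apply: is_deriveD; apply: is_deriveZ; exact: deriv2.
  rewrite !D2; move: ('D_(1, 0) ('D_(1, 0) v) p) ('D_(0, 1) ('D_(1, 0) v) p)
    ('D_(1, 0) ('D_(0, 1) v) p) ('D_(0, 1) ('D_(0, 1) v) p) => a b c d; ring.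
have := open_nbhs_nbhs (conj oU Up); apply: filterS => q; exact: Dn.
Qed.

Lemma C2_has_laplacian (l : R * R -> R) :
  (forall p, U p -> derive2 (1, 0) v p + derive2 (0, 1) v p = l p) ->
  has_laplacian U v l.
Proof.
move=> H; exists ('D_(1, 0) v), ('D_(0, 1) v), (derive2 (1, 0) v), (derive2 (0, 1) v).
by move=> p Up; split; [exact: deriv|exact: deriv|exact: deriv2|exact: deriv2|exact: H].
Qed.

End C2.

(** * Convex functions and thin domains *)

(** Convexity as a three-point inequality free of divisions. *)
Definition convex_on (R : realType) (a b : R) (f : R -> R) :=
  forall x y z, a <= x -> x <= y -> y <= z -> z <= b ->
    (z - x) * f y <= (z - y) * f x + (y - x) * f z.

Lemma convex_functionP (R : realType) (a b : R) (f : R -> R) :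
  convex_function `[a, b] f -> convex_on a b f.
Proof.
move=> cf x y z ax xy yz zb.
have [xz|xz] := eqVneq x z.
  have -> : y = x by apply/eqP; rewrite eq_le {1}xz yz xy.
  by rewrite -xz subrr !mul0r addr0.
have xz0 : 0 < z - x by rewrite subr_gt0 lt_neqAle xz (le_trans xy yz).
pose t := (z - y) / (z - x).
have t0 : 0 <= t by rewrite divr_ge0 ?subr_ge0// (le_trans xy yz).
have t1 : t <= 1 by rewrite ler_pdivrMr// mul1r lerB.
have H : f (t * x + (1 - t) * z) <= t * f x + (1 - t) * f z.
  apply: (cf (Itv01 t0 t1) x z); rewrite inE /= in_itv /=.
    by rewrite ax (le_trans xy (le_trans yz zb)).
  by rewrite zb (le_trans ax (le_trans xy yz)).
move: H; have -> : t * x + (1 - t) * z = y by rewrite /t; field; rewrite subr_eq0 eq_sym.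
move=> /(ler_wpM2l (ltW xz0)); congr (_ <= _).
by rewrite /t; field; rewrite subr_eq0 eq_sym.
Qed.

(** The slope is the supremum of the slopes of chords ending at X. *)
Lemma convex_on_support (R : realType) (a b X : R) (f : R -> R) :
  convex_on a b f -> a < X < b ->
  exists s, forall x, a <= x <= b -> f X + s * (x - X) <= f x.
Proof.
move=> cf /andP[aX Xb].
pose S := [set (f X - f x) / (X - x) | x in [set x | a <= x < X]].
have slope x y : a <= x < X -> X < y <= b ->
    (f X - f x) / (X - x) <= (f y - f X) / (y - X).
  move=> /andP[ax xX] /andP[Xy yb].
  rewrite ler_pdivrMr ?subr_gt0// mulrAC ler_pdivlMr ?subr_gt0//.
  have := cf x X y ax (ltW xX) (ltW Xy) yb; nra.
have hS : has_sup S.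
  split; first by exists ((f X - f a) / (X - a)), a => //=; rewrite lexx.
  exists ((f b - f X) / (b - X)) => _ [x /= xX <-]; apply: slope => //.
  by rewrite Xb lexx.
exists (sup S) => x /andP[ax xb]; have [xX|Xx|->] := ltgtP x X.
- have : (f X - f x) / (X - x) <= sup S.
    by apply: sup_upper_bound => //; exists x => //=; rewrite ax.
  rewrite ler_pdivrMr ?subr_gt0//; lra.
- have : sup S <= (f x - f X) / (x - X).
    apply: ge_sup; first by case: hS.
    by move=> _ [y /= yX <-]; apply: slope => //; rewrite Xx.
  rewrite ler_pdivlMr ?subr_gt0//; lra.
- by rewrite subrr mulr0 addr0.
Qed.

(** Convex functions with values in the unit interval are upper semicontinuous
    at interior points, with a modulus; this is what makes the region between
    the graphs a neighbourhood of each of its inner points. *)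
Lemma convex_on_upper (R : realType) (a b X x : R) (f : R -> R) :
  convex_on a b f -> (forall x, a <= x <= b -> 0 <= f x <= 1) ->
  a < X < b -> a <= x <= b ->
  f x <= f X + `|x - X| / Num.min (X - a) (b - X).
Proof.
move=> cf f01 /andP[aX Xb] /andP[ax xb].
set m := Num.min _ _.
have m0 : 0 < m by rewrite lt_min !subr_gt0 aX Xb.
have /andP[fX _] : 0 <= f X <= 1 by apply: f01; rewrite !ltW.
rewrite -lerBlDl ler_pdivlMr//.
have [|fle] := leP (f x - f X) 0; first by have := normr_ge0 (x - X); nra.
have [Xx|xX] := leP X x.
  have mb : m <= b - X by rewrite ge_min lexx orbT.
  have := cf X x b (ltW aX) Xx xb (lexx _).
  have /andP[_ fb] : 0 <= f b <= 1 by apply: f01; rewrite lexx andbT; lra.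
  by rewrite ger0_norm ?subr_ge0//; nra.
have ma : m <= X - a by rewrite ge_min lexx.
have := cf a x X (lexx _) ax (ltW xX) (ltW Xb).
have /andP[_ fb] : 0 <= f a <= 1 by apply: f01; rewrite lexx /=; lra.
by rewrite ltr0_norm ?subr_lt0// opprB; nra.
Qed.

(** A domain of height at most 1 in the unit strip, described by the distances
    t1 and t2 of its two graphs from the lines y = 0 and y = 1.  The parameter e
    is the square of the inverse length, and profile_enda, profile_endb express
    that the length is at least of order 1 / sqrt e. *)
Record profile (R : realType) (a b e A : R) (t1 t2 : R -> R) : Prop := Profile {
  profile_a : a < 0;
  profile_b : 0 < b;
  profile_e : 0 < e;
  profile_A : 0 < A;
  profile_convex1 : convex_on a b t1;
  profile_convex2 : convex_on a b t2;
  profile_ge01 : forall x, a <= x <= b -> 0 <= t1 x;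
  profile_ge02 : forall x, a <= x <= b -> 0 <= t2 x;
  profile_le1 : forall x, a <= x <= b -> t1 x + t2 x <= 1;
  profile_le : forall x, a <= x <= b -> t1 x + t2 x <= A * e * x ^+ 2;
  profile_enda : 1 <= A * e * a ^+ 2;
  profile_endb : 1 <= A * e * b ^+ 2
}.

Local Notation strip_region a b t1 t2 := (region a b t1 (fun x => 1 - t2 x)).

Lemma region_interior (R : realType) (a b e A : R) (t1 t2 : R -> R) (p : R * R) :
  profile a b e A t1 t2 -> a < p.1 < b -> t1 p.1 < p.2 < 1 - t2 p.1 ->
  interior (strip_region a b t1 t2) p.
Proof.
move=> P ab /andP[h1 h2].
have t1b x : a <= x <= b -> 0 <= t1 x <= 1.
  move=> xab; have := profile_ge01 P xab; have := profile_ge02 P xab.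
  have := profile_le1 P xab; lra.
have t2b x : a <= x <= b -> 0 <= t2 x <= 1.
  move=> xab; have := profile_ge01 P xab; have := profile_ge02 P xab.
  have := profile_le1 P xab; lra.
have /andP[pa pb] := ab.
set m := Num.min (p.1 - a) (b - p.1).
have m0 : 0 < m by rewrite lt_min !subr_gt0 pa pb.
pose d := Num.min (p.2 - t1 p.1) (1 - t2 p.1 - p.2) / 2.
have d0 : 0 < d by rewrite divr_gt0// lt_min; apply/andP; split; lra.
pose r := Num.min m (Num.min d (d * m)).
have r0 : 0 < r by rewrite lt_min m0 /= lt_min d0 mulr_gt0.
apply: (@filterS _ (nbhs p) _ (ball p r)); last exact: nbhsx_ballx.
move=> q [q1 q2].
have : `|q.1 - p.1| < r by rewrite distrC.
have : `|q.2 - p.2| < r by rewrite distrC.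
rewrite lt_min => /andP[_]; rewrite lt_min => /andP[q2d _].
rewrite lt_min => /andP[q1m]; rewrite lt_min => /andP[_ q1d].
have qab : a <= q.1 <= b.
  move: q1m; rewrite lt_min => /andP[]; rewrite !ltr_norml => /andP[? ?] /andP[? ?].
  by apply/andP; split; lra.
have qd : `|q.1 - p.1| / m <= d by rewrite ler_pdivrMr// ltW.
have u1 := convex_on_upper (profile_convex1 P) t1b ab qab.
have u2 := convex_on_upper (profile_convex2 P) t2b ab qab.
have dd1 : 2 * d <= p.2 - t1 p.1 by rewrite /d mulrCA divff ?mulr1// ge_min lexx.
have dd2 : 2 * d <= 1 - t2 p.1 - p.2.
  by rewrite /d mulrCA divff ?mulr1// ge_min lexx orbT.
move: q2d; rewrite ltr_norml => /andP[? ?].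
by split => //; apply/andP; split; lra.
Qed.

Lemma closure_ge0 (R : realType) (T : topologicalType) (S : set T) (f : T -> R) :
  continuous f -> (forall p, S p -> 0 <= f p) -> forall p, closure S p -> 0 <= f p.
Proof.
move=> cf Sf; have cl : closed (f @^-1` [set x | 0 <= x]).
  by apply: (continuous_closedP f).1 => //; exact: closed_ge.
move=> p /(closure_subset Sf); by rewrite -((closure_id _).1 cl).
Qed.

Lemma region_closure (R : realType) (a b e A : R) (t1 t2 : R -> R) :
  profile a b e A t1 t2 ->
  closure (strip_region a b t1 t2) `<=` closed_rectangle a b 0 1.
Proof.
move=> P p cp.
have H a0 a1 a2 : (forall q, strip_region a b t1 t2 q -> 0 <= a0 + a1 * q.1 + a2 * q.2) ->
    0 <= a0 + a1 * p.1 + a2 * p.2.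
  move=> Hq; have := closure_ge0 (@continuous_quadratic R a0 a1 a2 0 0 0) _ cp.
  rewrite !mul0r !addr0; apply => q /Hq.
  by rewrite !mul0r !addr0.
have := H (- a) 1 0; have := H b (-1) 0; have := H 0 0 1; have := H 1 0 (-1) => h1 h2 h3 h4.
have key q : strip_region a b t1 t2 q -> closed_rectangle a b 0 1 q.
  move=> [qab /andP[q1 q2]]; split => //.
  have := profile_ge01 P qab; have := profile_ge02 P qab => ? ?.
  by apply/andP; split; lra.
split; apply/andP; split.
- have : 0 <= - a + 1 * p.1 + 0 * p.2; [apply: h4 => q /key[/andP[? ?] _]; lra|lra].
- have : 0 <= b + -1 * p.1 + 0 * p.2; [apply: h3 => q /key[/andP[? ?] _]; lra|lra].
- have : 0 <= 0 + 0 * p.1 + 1 * p.2; [apply: h2 => q /key[_ /andP[? ?]]; lra|lra].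
- have : 0 <= 1 + 0 * p.1 + -1 * p.2; [apply: h1 => q /key[_ /andP[? ?]]; lra|lra].
Qed.

Section comparison.
Context (R : realType) (a b e A : R) (t1 t2 : R -> R) (v : R * R -> R).
Hypotheses (P : profile a b e A t1 t2)
  (tv : torsion_function (strip_region a b t1 t2) v).
Let Om := strip_region a b t1 t2.

Lemma compact_closure_region : compact (closure Om).
Proof.
apply: subclosed_compact (@region_closure _ _ _ _ _ _ _ P);
  [exact: closed_closure|exact: compact_rectangle].
Qed.

Lemma torsion_has_laplacian : has_laplacian (interior Om) v (fun=> -1).
Proof.
by apply: (C2_has_laplacian (torsion_C2 tv)); exact: torsion_laplacian tv.
Qed.

Let lap0 B : has_laplacian setT B (fun=> -1) ->
  has_laplacian (interior Om) (fun p => v p - B p) (fun=> 0).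
Proof.
move=> LB; have := has_laplacianB torsion_has_laplacian
  (has_laplacian_sub (@subsetT _ _) LB).
by apply: has_laplacian_eq => p _; rewrite subrr.
Qed.

Let within_continuous_diff B : continuous B ->
  {within closure Om, continuous (fun p => v p - B p)}.
Proof.
move=> cB p; apply: cvgB; first exact: (torsion_continuous tv).
exact: (continuous_subspaceT cB).
Qed.

Lemma torsion_le B : continuous B -> has_laplacian setT B (fun=> -1) ->
  (forall p, Om p -> 0 <= B p) -> forall p, closure Om p -> v p <= B p.
Proof.
move=> cB LB B0 p cp; rewrite -subr_le0; move: p cp.
apply: (max_principle compact_closure_region (@open_interior _ Om) _
  (within_continuous_diff cB) (lap0 LB)) => //.
  by apply: subset_trans (@subset_closure _ _); exact: interior_subset.
move=> p cp np; rewrite (torsion_boundary tv)// sub0r oppr_le0.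
exact: (closure_ge0 cB B0).
Qed.

(** By upper semicontinuity of t1 and t2, a point of the closure that is not
    interior has to satisfy one of the four alternatives.  The graphs may jump
    at the end points a and b, so nothing is claimed about the ordinate there. *)
Lemma torsion_ge B : continuous B -> has_laplacian setT B (fun=> -1) ->
  (forall p, closed_rectangle a b 0 1 p ->
    [\/ p.1 = a, p.1 = b, p.2 <= t1 p.1 | 1 - t2 p.1 <= p.2] -> B p <= 0) ->
  forall p, closure Om p -> B p <= v p.
Proof.
move=> cB LB B0 p cp; rewrite -subr_le0; move: p cp.
have E : (fun p => B p - v p) = (fun p => -1 * (v p - B p)).
  by apply/funext => p; rewrite mulN1r opprB.
have cBv : {within closure Om, continuous (fun p => B p - v p)}.
  move=> p; apply: cvgB; first exact: (continuous_subspaceT cB).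
  exact: (torsion_continuous tv).
have LBv : has_laplacian (interior Om) (fun p => B p - v p) (fun=> 0).
  by rewrite E; have := has_laplacianZ (-1) (lap0 LB);
    apply: has_laplacian_eq => p _; rewrite mulr0.
apply: (max_principle compact_closure_region (@open_interior _ Om) _ cBv LBv) => //.
  by apply: subset_trans (@subset_closure _ _); exact: interior_subset.
move=> p cp np; rewrite (torsion_boundary tv)// subr0.
have rp := region_closure P cp; apply: B0 => //.
apply: contrapT => H; apply: np; have [/andP[pa pb] _] := rp.
apply: (region_interior P); apply/andP; split.
- by rewrite lt_neqAle pa andbT; apply/eqP => /esym E'; apply: H; constructor 1.
- by rewrite lt_neqAle pb andbT; apply/eqP => E'; apply: H; constructor 2.
- by rewrite ltNge; apply/negP => E'; apply: H; constructor 3.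
- by rewrite ltNge; apply/negP => E'; apply: H; constructor 4.
Qed.

(** The two lines bound a wedge containing the domain.  The product of the
    distances to them has Laplacian - 2 (1 - be1 be2), so after this
    normalisation it is a supersolution that is nonnegative on the domain. *)
Lemma torsion_wedge_le (al1 be1 al2 be2 : R) : be1 * be2 < 1 ->
  (forall x, a <= x <= b -> al1 + be1 * x <= t1 x) ->
  (forall x, a <= x <= b -> al2 + be2 * x <= t2 x) ->
  forall p, closure Om p ->
  v p <= (p.2 - (al1 + be1 * p.1)) * (1 - (al2 + be2 * p.1) - p.2)
         / (2 * (1 - be1 * be2)).
Proof.
move=> bb H1 H2; set k := (2 * (1 - be1 * be2))^-1.
have k0 : 0 < k by rewrite invr_gt0; lra.
have BE : (fun p : R * R => (p.2 - (al1 + be1 * p.1)) * (1 - (al2 + be2 * p.1) - p.2) * k)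
  = (fun p => k * (- (al1 * (1 - al2))) + (k * (al1 * be2 - be1 * (1 - al2))) * p.1
     + (k * (1 - al2 + al1)) * p.2 + (k * (be1 * be2)) * p.1 ^+ 2
     + (k * (be1 - be2)) * (p.1 * p.2) + (- k) * p.2 ^+ 2).
  by apply/funext => p; ring.
apply: torsion_le.
- by rewrite BE; exact: continuous_quadratic.
- rewrite BE; apply: has_laplacian_eq (has_laplacian_quadratic _ _ _ _ _ _ _) => p _.
  by rewrite /k; field; lra.
- move=> p [pab /andP[p1 p2]]; have := H1 _ pab; have := H2 _ pab => ? ?.
  by apply: mulr_ge0; [apply: mulr_ge0; lra|exact: ltW].
Qed.

(** The wedge whose sides are the two sides of the strip. *)
Lemma torsion_parabola_le p : closure Om p -> v p <= p.2 * (1 - p.2) / 2.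
Proof.
have := @torsion_wedge_le 0 0 0 0; rewrite !mul0r => /(_ ltr01) H cp.
apply: le_trans (H _ _ p cp) _.
- by move=> x xab; rewrite mul0r addr0; exact: (profile_ge01 P xab).
- by move=> x xab; rewrite mul0r addr0; exact: (profile_ge02 P xab).
- by rewrite !mul0r !addr0 !subr0 mulr1.
Qed.

(** The polynomial subtracted from y (1 - y) / 2 is harmonic: x y and
    (x - X)^2 + y (1 - y) are. *)
Lemma torsion_barrier_ge (l10 l11 l20 l21 X c k : R) :
  (forall x y, a <= x <= b -> 0 <= y <= 1 ->
    [\/ x = a, x = b, y <= t1 x | 1 - t2 x <= y] ->
    y * (1 - y) <= (1 - y) * (l10 + l11 * x) + y * (l20 + l21 * x) + c
      + k * ((x - X) ^+ 2 + y * (1 - y))) ->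
  forall p, closure Om p ->
  p.2 * (1 - p.2) / 2 - ((1 - p.2) * (l10 + l11 * p.1) + p.2 * (l20 + l21 * p.1) + c
      + k * ((p.1 - X) ^+ 2 + p.2 * (1 - p.2))) / 2 <= v p.
Proof.
move=> H.
set B := fun p : R * R => p.2 * (1 - p.2) / 2 - ((1 - p.2) * (l10 + l11 * p.1)
  + p.2 * (l20 + l21 * p.1) + c + k * ((p.1 - X) ^+ 2 + p.2 * (1 - p.2))) / 2.
have BE : B = (fun p => 2^-1 * (- l10 - c - k * X ^+ 2) + (2^-1 * (2 * k * X - l11)) * p.1
  + (2^-1 * (1 + l10 - l20 - k)) * p.2 + (2^-1 * - k) * p.1 ^+ 2
  + (2^-1 * (l11 - l21)) * (p.1 * p.2) + (2^-1 * (k - 1)) * p.2 ^+ 2).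
  by apply/funext => p; rewrite /B; field.
apply: torsion_ge.
- by rewrite -/B BE; exact: continuous_quadratic.
- rewrite -/B BE; apply: has_laplacian_eq (has_laplacian_quadratic _ _ _ _ _ _ _).
  by move=> p _; field.
- by move=> p [pab p01] bd; have := H _ _ pab p01 bd; lra.
Qed.

End comparison.

(** * The torsion function along a vertical line *)

Section profile_estimates.
Context (R : realType) (a b e A : R) (t1 t2 : R -> R) (v : R * R -> R).
Hypotheses (P : profile a b e A t1 t2)
  (tv : torsion_function (strip_region a b t1 t2) v).
Let Om := strip_region a b t1 t2.

(** The conditions at the end points force the domain to be long when e is
    small, so that fixed windows fit inside it. *)
Lemma profile_range r : 0 <= r -> A * e * r ^+ 2 < 1 -> a < - r /\ r < b.
Proof.
move=> r0 Ar; have Ae : 0 < A * e by rewrite mulr_gt0 ?(profile_A P) ?(profile_e P).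
have := profile_enda P; have := profile_endb P; have := profile_a P.
have := profile_b P; split; rewrite ltNge; apply/negP => h.
  have : a ^+ 2 <= r ^+ 2 by nra.
  by move=> /(ler_wpM2l (ltW Ae)); lra.
have : b ^+ 2 <= r ^+ 2 by nra.
by move=> /(ler_wpM2l (ltW Ae)); lra.
Qed.

Lemma profile_t1_le x : a <= x <= b -> 0 <= t1 x <= A * e * x ^+ 2.
Proof.
move=> xab; have := profile_le P xab; have := profile_ge02 P xab.
by rewrite (profile_ge01 P xab) /=; lra.
Qed.

Lemma profile_t2_le x : a <= x <= b -> 0 <= t2 x <= A * e * x ^+ 2.
Proof.
move=> xab; have := profile_le P xab; have := profile_ge01 P xab.
by rewrite (profile_ge02 P xab) /=; lra.
Qed.

(** Both bounds come from evaluating the supporting line at X + 1 and X - 1,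
    where t is of size e. *)
Lemma support_slope (t : R -> R) (L X : R) : convex_on a b t ->
  (forall x, a <= x <= b -> 0 <= t x <= A * e * x ^+ 2) ->
  `|X| <= L -> A * e * (L + 1) ^+ 2 < 1 ->
  exists2 s, `|s| <= A * e * (L + 1) ^+ 2 &
    forall x, a <= x <= b -> t X + s * (x - X) <= t x.
Proof.
move=> ct tb XL AL; have L0 : 0 <= L by apply: le_trans XL.
have [aL Lb] := profile_range (addr_ge0 L0 ler01) AL.
have Ae : 0 <= A * e by rewrite mulr_ge0 ?(ltW (profile_A P)) ?(ltW (profile_e P)).
move: XL; rewrite ler_norml => /andP[X1 X2].
have [|s Hs] := @convex_on_support _ a b X t ct; first by apply/andP; split; lra.
exists s => //.
have tX : 0 <= t X by have /andP[] : 0 <= t X <= A * e * X ^+ 2 by apply: tb; lra.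
have sq x : - (L + 1) <= x <= L + 1 -> A * e * x ^+ 2 <= A * e * (L + 1) ^+ 2.
  by move=> /andP[? ?]; rewrite ler_wpM2l//; nra.
have h1 : t X + s * (X + 1 - X) <= t (X + 1) by apply: Hs; lra.
have /andP[_ h2] : 0 <= t (X + 1) <= A * e * (X + 1) ^+ 2 by apply: tb; lra.
have h3 : t X + s * (X - 1 - X) <= t (X - 1) by apply: Hs; lra.
have /andP[_ h4] : 0 <= t (X - 1) <= A * e * (X - 1) ^+ 2 by apply: tb; lra.
have h5 : A * e * (X + 1) ^+ 2 <= A * e * (L + 1) ^+ 2 by apply: sq; lra.
have h6 : A * e * (X - 1) ^+ 2 <= A * e * (L + 1) ^+ 2 by apply: sq; lra.
by rewrite ler_norml; apply/andP; split; lra.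
Qed.

(** The wedge of the two supporting lines at X, evaluated on the line x = X.
    The slopes are O(e), so the correction to the one-dimensional profile is
    O(e^2). *)
Lemma torsion_profile_le (L X y : R) : `|X| <= L ->
  A * e * (L + 1) ^+ 2 <= 2^-1 -> closure Om (X, y) ->
  v (X, y) <= y * (1 - y) / 2 - ((1 - y) * t1 X + y * t2 X) / 2
    + 2 * (A * e * (L + 1) ^+ 2) ^+ 2.
Proof.
move=> XL AL cp; set S := A * e * (L + 1) ^+ 2 in AL *.
have [xab yab] : closed_rectangle a b 0 1 (X, y) := region_closure P cp.
have AL1 : S < 1 by lra.
have [s1 s1S H1] := support_slope (profile_convex1 P) profile_t1_le XL AL1.
have [s2 s2S H2] := support_slope (profile_convex2 P) profile_t2_le XL AL1.
have S0 : 0 <= S by apply: le_trans s1S.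
have sS : `|s1 * s2| <= S ^+ 2 by rewrite normrM expr2; apply: ler_pM.
have SS : S ^+ 2 <= 2^-1 by nra.
move: (sS); rewrite ler_norml => /andP[sl su].
have := @torsion_wedge_le _ a b e A t1 t2 v P tv (t1 X - s1 * X) s1 (t2 X - s2 * X) s2.
move=> /(_ _ _ _ (X, y) cp) /=.
rewrite !subrK => H.
have {}H : v (X, y) <= (y - t1 X) * (1 - t2 X - y) / (2 * (1 - s1 * s2)).
  apply: H; first lra.
  - by move=> x /H1; lra.
  - by move=> x /H2; lra.
apply: le_trans H _; rewrite ler_pdivrMr; last lra.
have /andP[a1 b1] := profile_t1_le xab; have /andP[a2 b2] := profile_t2_le xab.
have t12 := profile_le1 P xab; move: yab => /andP[/= y0 y1].
have Ae : 0 <= A * e by rewrite mulr_ge0 ?(ltW (profile_A P)) ?(ltW (profile_e P)).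
have gS : A * e * X ^+ 2 <= S.
  rewrite ler_wpM2l//; move: XL; rewrite ler_norml => /andP[? ?]; nra.
have tt : 0 <= t1 X * t2 X <= S ^+ 2.
  by rewrite mulr_ge0//= expr2; apply: ler_pM => //; [exact: le_trans b1 gS|exact: le_trans b2 gS].
set s := s1 * s2 in sS sl su *.
set Q := y * (1 - y) - ((1 - y) * t1 X + y * t2 X).
have -> : (y - t1 X) * (1 - t2 X - y) = Q + t1 X * t2 X by rewrite /Q; ring.
have -> : (y * (1 - y) / 2 - ((1 - y) * t1 X + y * t2 X) / 2 + 2 * S ^+ 2) * (2 * (1 - s))
  = Q - Q * s + 4 * S ^+ 2 * (1 - s) by rewrite /Q; field.
have Q1 : -1 <= Q <= 1.
  have : 0 <= y * (1 - y) by apply: mulr_ge0; lra.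
  have : 0 <= (1 - y) * t1 X by apply: mulr_ge0; lra.
  have : 0 <= y * t2 X by apply: mulr_ge0.
  have : 0 <= (1 - y) * (1 - t1 X) by apply: mulr_ge0; lra.
  have : 0 <= y * (1 - t2 X) by apply: mulr_ge0; lra.
  by have := sqr_ge0 y; rewrite /Q; lra.
have : Q * s <= S ^+ 2 by nra.
have : 4 * S ^+ 2 * (1 - s) >= 2 * S ^+ 2 by nra.
lra.
Qed.

Section lower.
Variables (ka rho L : R).
Hypotheses (ka0 : 0 <= ka <= A) (L0 : 0 <= L) (AL : A * e * (2 * L) ^+ 2 <= 1)
  (Hrho : forall x, a <= x <= b -> `|x| <= 2 * L ->
    `|t1 x + t2 x - ka * e * x ^+ 2 / 2| <= rho * e).

Let e0 := profile_e P.
Let A0 := profile_A P.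
Let Ae : 0 < A * e. Proof. exact: mulr_gt0. Qed.

(** On the window this is the hypothesis; outside it both terms are at most
    A e x^2, which is at most 4 A e (x - X)^2 there. *)
Lemma profile_deviation X x : `|X| <= L -> a <= x <= b -> 0 <= rho ->
  `|t1 x + t2 x - ka * e * x ^+ 2 / 2| <= rho * e + 4 * A * e * (x - X) ^+ 2.
Proof.
move=> XL xab rho0.
have [xL|xL] := leP `|x| (2 * L).
  apply: le_trans (Hrho xab xL) _; rewrite lerDl.
  by apply: mulr_ge0; [rewrite -mulrA mulr_ge0// ltW|exact: sqr_ge0].
have g1 := profile_le P xab.
have g0 : 0 <= t1 x + t2 x by rewrite addr_ge0 ?(profile_ge01 P)// (profile_ge02 P).
have xX : x ^+ 2 <= 4 * (x - X) ^+ 2.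
  have : `|x| <= 2 * `|x - X|.
    have := ler_normD (x - X) X; rewrite subrK; lra.
  move=> h; rewrite -(real_normK (num_real x)) -(real_normK (num_real (x - X))).
  by have := normr_ge0 x; nra.
have k1 : 0 <= ka * e * x ^+ 2 / 2 <= A * e * x ^+ 2.
  have := sqr_ge0 x; have /andP[? ?] := ka0; move=> x2.
  have : 0 <= e * x ^+ 2 by rewrite mulr_ge0// ltW.
  rewrite -!mulrA => ex; apply/andP; split; nra.
have : A * e * x ^+ 2 <= 4 * A * e * (x - X) ^+ 2.
  by have := ler_wpM2l (ltW Ae) xX; lra.
have : 0 <= rho * e by rewrite mulr_ge0// ltW.
rewrite ler_norml => ? ?; apply/andP; split; lra.
Qed.

(** A lower barrier needs upper bounds for t1 and t2, while convexity gives lower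
    ones.  As the sum t1 + t2 is known up to a small error, subtracting the
    supporting line of t2 from it bounds t1 from above by an affine function
    plus O(e) (x - X)^2, and symmetrically.  The affine functions are
    interpolated linearly in y, and the quadratic error is made harmonic by
    adding y (1 - y). *)
Lemma torsion_profile_ge X y : `|X| <= L -> 0 <= rho ->
  A * e * (L + 1) ^+ 2 < 1 -> closure Om (X, y) ->
  y * (1 - y) / 2 - ((1 - y) * (ka * e * X ^+ 2 / 2 - t2 X)
    + y * (ka * e * X ^+ 2 / 2 - t1 X)
    + 2 * rho * e + 10 * A * e * (y * (1 - y))) / 2 <= v (X, y).
Proof.
move=> XL rho0 AL1 cp.
have [s1 _ H1] := support_slope (profile_convex1 P) profile_t1_le XL AL1.
have [s2 _ H2] := support_slope (profile_convex2 P) profile_t2_le XL AL1.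
pose G := ka * e * X ^+ 2 / 2; pose m := ka * e * X.
have := @torsion_barrier_ge _ a b e A t1 t2 v P tv
  (G - t2 X - (m - s2) * X) (m - s2) (G - t1 X - (m - s1) * X) (m - s1) X
  (2 * rho * e) (10 * A * e).
move=> /(_ _ (X, y) cp) /=; rewrite !subrK subrr expr0n add0r; apply.
move=> x z xab /andP[z0 z1] bd.
pose D := (x - X) ^+ 2.
have D0 : 0 <= D by exact: sqr_ge0.
have dev := profile_deviation XL xab rho0.
rewrite -/D in dev *.
have h1 := H1 _ xab; have h2 := H2 _ xab.
have GE : ka * e * x ^+ 2 / 2 = G + m * (x - X) + ka * e * D / 2.
  by rewrite /G /m /D; field.
rewrite GE in dev.
have kD : ka * e * D <= A * e * D.
  by rewrite ler_wpM2r// ler_wpM2r ?(ltW e0)//; case/andP: ka0.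
have kD0 : 0 <= ka * e * D.
  by rewrite mulr_ge0// mulr_ge0// ?(ltW e0)//; case/andP: ka0.
have AD0 : 0 <= A * e * D by rewrite mulr_ge0// ltW.
have re0 : 0 <= rho * e by rewrite mulr_ge0// ltW.
have t10 := profile_ge01 P xab; have t20 := profile_ge02 P xab.
move: dev; rewrite ler_norml => /andP[dev1 dev2].
set l1 := G - t2 X - (m - s2) * X + (m - s2) * x.
set l2 := G - t1 X - (m - s1) * X + (m - s1) * x.
set d := rho * e + 5 * (A * e * D).
(* l1 + d and l2 + d bound t1 and t2 from above; in particular they are
   nonnegative, which controls the interpolant where l1 or l2 is negative. *)
have E1 : t1 x <= l1 + d by rewrite /l1 /d; lra.
have E2 : t2 x <= l2 + d by rewrite /l2 /d; lra.
have zz : 0 <= z * (1 - z) by apply: mulr_ge0; lra.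
have AA : 0 <= A * e * (z * (1 - z)) by rewrite mulr_ge0// ltW.
suff : z * (1 - z) <= (1 - z) * l1 + z * l2 + 2 * d by rewrite /d; lra.
have [A1 A2] : 0 <= l1 + d /\ 0 <= l2 + d by split; lra.
(* At the end points y is arbitrary; there the quadratic error alone exceeds
   y (1 - y) <= 1 / 4. *)
have far w : 1 <= A * e * w ^+ 2 -> x = w -> z * (1 - z) <= (1 - z) * l1 + z * l2 + 2 * d.
  move=> + xw; rewrite -xw => x1; have : 1 <= 4 * (A * e * D).
    apply: (le_trans x1).
    have -> : 4 * (A * e * D) = A * e * (4 * D) by ring.
    rewrite ler_wpM2l ?(ltW Ae)// /D.
    suff : `|x| <= 2 * `|x - X|.
      move=> h; rewrite -(real_normK (num_real x)) -(real_normK (num_real (x - X))).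
      by have := normr_ge0 x; nra.
    have : 2 * L <= `|x|.
      rewrite leNgt; apply/negP => xL.
      have : x ^+ 2 < (2 * L) ^+ 2.
        by rewrite -(real_normK (num_real x)); have := normr_ge0 x; nra.
      by rewrite -(ltr_pM2l Ae) => /lt_le_trans/(_ AL); rewrite ltNge x1.
    have := ler_normD (x - X) X; rewrite subrK; lra.
  move=> AD; have : z * (1 - z) <= 4^-1 by have := sqr_ge0 (z - 2^-1); lra.
  have : 0 <= (1 - z) * (l1 + d) by apply: mulr_ge0; lra.
  have : 0 <= z * (l2 + d) by apply: mulr_ge0; lra.
  rewrite /d; lra.
case: bd => [xa|xb|zt|zt].
- by apply: (far a) => //; exact: profile_enda P.
- by apply: (far b) => //; exact: profile_endb P.
- have : 0 <= (1 - z) * (l1 + d - z) by apply: mulr_ge0; lra.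
  have : 0 <= z * (l2 + d) by apply: mulr_ge0; lra.
  have : 0 <= (1 - z) * 0 by lra.
  have : 0 <= d by rewrite /d; lra.
  lra.
- have : 0 <= (1 - z) * (l1 + d) by apply: mulr_ge0; lra.
  have : 0 <= z * (l2 + d - (1 - z)) by apply: mulr_ge0; lra.
  have : 0 <= d by rewrite /d; lra.
  lra.
Qed.

End lower.
End profile_estimates.

(** * Reflection in the midline *)

Lemma is_derive_reflect (R : realType) (f : R * R -> R) (q : R * R) (d : R) :
  is_derive (q.1, 1 - q.2) (1, 0) f d ->
  is_derive q (1, 0) (fun p => f (p.1, 1 - p.2)) d.
Proof.
move=> /is_deriveP H; apply/is_deriveP => eps /H[del del0 Hd].
by exists del => // t /Hd; rewrite !add_scale_ex.
Qed.

Section reflection.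
Context (R : realType) (a b e A : R) (t1 t2 : R -> R) (v : R * R -> R)
  (ka rho L eps : R).
Hypotheses (P : profile a b e A t1 t2)
  (tv : torsion_function (strip_region a b t1 t2) v)
  (ka0 : 0 <= ka <= A) (L1 : 1 <= L) (rho0 : 0 <= rho)
  (AL2 : A * e * (2 * L) ^+ 2 <= 1) (AL1 : A * e * (L + 1) ^+ 2 <= 2^-1)
  (eps0 : 0 < eps) (eps8 : eps <= 8^-1) (ALe : A * e * L ^+ 2 < eps)
  (Hrho : forall x, a <= x <= b -> `|x| <= 2 * L ->
    `|t1 x + t2 x - ka * e * x ^+ 2 / 2| <= rho * e).
Let Om := strip_region a b t1 t2.
Let S := A * e * (L + 1) ^+ 2.
Let Q := closed_rectangle (- L) L eps (1 - eps).
Let e0 : 0 < e := profile_e P.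
Let A0 : 0 < A := profile_A P.
Let Ae : 0 < A * e. Proof. exact: mulr_gt0. Qed.
Let L0 : 0 <= L. Proof. by apply: le_trans L1. Qed.

(* The side conditions, split into the scalar inequalities used below. *)
Let params : [/\ 1 <= L, eps <= 8^-1, A * e * L ^+ 2 < eps, 0 <= ka & ka <= A].
Proof. by split => //; case/andP: ka0. Qed.
Let params' : [/\ 0 < eps, 0 <= L & A * e * (L + 1) ^+ 2 <= 2^-1].
Proof. by []. Qed.

(** The graphs stay within eps of the sides of the strip over the window. *)
Lemma window_interior p : Q p -> interior Om p.
Proof.
have [p1 p2 p3 p4 p5] := params; have [p6 p7 p8] := params'.
move=> [/andP[x1 x2] /andP[y1 y2]].
have [aL Lb] : a < - L /\ L < b.
  by apply: (profile_range P) => //; lra.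
have pab : a <= p.1 <= b by apply/andP; split; lra.
have sq : A * e * p.1 ^+ 2 <= A * e * L ^+ 2 by rewrite ler_wpM2l ?(ltW Ae)//; nra.
have := profile_t1_le P pab; have := profile_t2_le P pab => h1 h2.
by apply: (region_interior P); apply/andP; split; lra.
Qed.

Lemma window_closure p : Q p -> closure Om p.
Proof. by move=> /window_interior/interior_subset; exact: subset_closure. Qed.

Lemma window_reflect p : Q p -> Q (p.1, 1 - p.2).
Proof.
have [p1 p2 p3 p4 p5] := params; have [p6 p7 p8] := params'.
by move=> [h /andP[h1 h2]]; split => //=; apply/andP; split; lra. Qed.

Let oOm : open (interior Om) := open_interior Om.

Let W p := v p - p.2 * (1 - p.2) / 2.

Lemma harmonic_correction : harmonic (interior Om) W.
Proof.
have E : (fun p : R * R => p.2 * (1 - p.2) / 2) = (fun p => 0 + 0 * p.1 + 2^-1 * p.2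
    + 0 * p.1 ^+ 2 + 0 * (p.1 * p.2) + (- 2^-1) * p.2 ^+ 2).
  by apply/funext => p; field.
split.
  have := has_laplacian_quadratic (interior Om) 0 0 2^-1 0 0 (- 2^-1); rewrite -E.
  move=> /(has_laplacianB (torsion_has_laplacian tv)).
  by apply: has_laplacian_eq => p _; field.
move=> p ip; apply: cvgB; first exact: (C2_continuous oOm (torsion_C2 tv)).
by have := @continuous_quadratic R 0 0 2^-1 0 0 (- 2^-1) p; rewrite -E.
Qed.

Lemma correction_bound p : Q p -> `|W p| <= (A * L ^+ 2 + rho + 2 * A) * e.
Proof.
have [p1 p2 p3 p4 p5] := params; have [p6 p7 p8] := params'.
move=> Qp; have cp := window_closure Qp.
have := torsion_parabola_le P tv cp => h1.
have [/andP[x1 x2] /andP[y1 y2]] := Qp.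
have pL : `|p.1| <= L by rewrite ler_norml x1.
have AL1' : A * e * (L + 1) ^+ 2 < 1 by lra.
have := torsion_profile_ge P tv ka0 AL2 Hrho pL rho0 AL1' (y := p.2).
rewrite -surjective_pairing => /(_ cp) h2.
have [pab _] := region_closure P cp.
have t10 := profile_ge01 P pab; have t20 := profile_ge02 P pab.
have G : ka * e * p.1 ^+ 2 / 2 <= A * e * L ^+ 2 / 2.
  rewrite ler_pM2r//; apply: ler_pM; rewrite ?sqr_ge0//.
  - by apply: mulr_ge0; [lra|exact: ltW].
  - by rewrite ler_wpM2r ?(ltW e0)//; lra.
  - nra.
have h3 : 0 <= (1 - p.2) * t2 p.1 by apply: mulr_ge0 => //; lra.
have h4 : 0 <= p.2 * t1 p.1 by apply: mulr_ge0 => //; lra.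
have h5 : p.2 * (1 - p.2) <= 4^-1 by have := sqr_ge0 (p.2 - 2^-1); lra.
have h6 := ler_wpM2l (ltW Ae) h5.
have h7 : 0 <= A * e * L ^+ 2 by rewrite mulr_ge0 ?sqr_ge0// ltW.
have h8 : 0 <= rho * e by rewrite mulr_ge0// ltW.
have h9 := ltW Ae.
by rewrite /W ler_norml; apply/andP; split; lra.
Qed.

Let Z p := v p + v (p.1, 1 - p.2) - p.2 * (1 - p.2)
  + ka * e / 4 * (p.1 ^+ 2 + p.2 * (1 - p.2)).

Lemma harmonic_reflection : harmonic Q Z.
Proof.
pose r p := W (0 + 1 * p.1, 1 + -1 * p.2).
have hr : harmonic Q r.
  have := harmonic_affine 0 1 (_ : (1 : R) ^+ 2 = 1) (_ : (-1 : R) ^+ 2 = 1)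
    harmonic_correction.
  rewrite sqrrN expr1n => /(_ erefl erefl); apply: harmonic_sub => p Qp /=.
  by rewrite add0r mul1r mulN1r; exact/window_interior/window_reflect.
pose k := ka * e / 4.
pose q (p : R * R) := 0 + 0 * p.1 + (- k) * p.2 + (- k) * p.1 ^+ 2 + 0 * (p.1 * p.2)
  + k * p.2 ^+ 2.
have hq : harmonic Q q.
  split; last by move=> p _; exact: continuous_quadratic.
  by apply: has_laplacian_eq (has_laplacian_quadratic _ _ _ _ _ _ _) => p _; ring.
(* The constant terms cancel: W(x, y) + W(x, 1 - y) is
   v(x, y) + v(x, 1 - y) - y (1 - y). *)
have hWr := harmonicB (harmonic_sub window_interior harmonic_correction)
  (harmonicZ (-1) hr).
have -> : Z = (fun p => W p - -1 * r p - q p).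
  by apply/funext => p; rewrite /Z /r /q /W /k !mulN1r !add0r !mul1r /=; field.
exact: harmonicB hWr hq.
Qed.

(** The terms (1 - y) t1 + y t2 of the two profile estimates, at y and at 1 - y,
    add up to t1 + t2. *)
Lemma reflection_profile p : Q p ->
  `|Z p| <= 3 * rho * e + 4 * S ^+ 2 + 10 * A * e * (p.2 * (1 - p.2)).
Proof.
have [p1 p2 p3 p4 p5] := params; have [p6 p7 p8] := params'.
move=> Qp; have Qr := window_reflect Qp.
have cp := window_closure Qp; have cr := window_closure Qr.
have [/andP[x1 x2] /andP[y1 y2]] := Qp.
have pL : `|p.1| <= L by rewrite ler_norml x1.
have AL1' : A * e * (L + 1) ^+ 2 < 1 by lra.
have := torsion_profile_ge P tv ka0 AL2 Hrho pL rho0 AL1' cr.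
have := torsion_profile_ge P tv ka0 AL2 Hrho pL rho0 AL1' (y := p.2).
rewrite -surjective_pairing => /(_ cp).
have := torsion_profile_le P tv pL AL1 cr.
have := torsion_profile_le P tv pL AL1 (y := p.2).
rewrite -surjective_pairing => /(_ cp).
have [pab _] := region_closure P cp.
have pL2 : `|p.1| <= 2 * L by lra.
have := Hrho pab pL2; rewrite ler_norml => /andP[].
rewrite -/S /Z; set s := S ^+ 2; set y := p.2; set V := v p; set V' := v (p.1, _).
set T1 := t1 p.1; set T2 := t2 p.1; set x := p.1 ^+ 2.
have yy : 0 <= y * (1 - y) by apply: mulr_ge0; rewrite /y; lra.
have h1 : 0 <= ka * e * (y * (1 - y)) <= A * e * (y * (1 - y)).
  rewrite mulr_ge0//=; last by apply: mulr_ge0; [lra|exact: ltW].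
  by rewrite ler_wpM2r// ler_wpM2r ?(ltW e0)//; lra.
have h2 : 0 <= rho * e by rewrite mulr_ge0// ltW.
have h3 : 0 <= s by exact: sqr_ge0.
move=> g1 g2 u1 u2 l1 l2; rewrite ler_norml; apply/andP; split; lra.
Qed.

Let tol x := 3 * rho * e + 4 * S ^+ 2 + 10 * A * e * eps
  + 10 * A * e / L ^+ 2 * (x ^+ 2 + 1).

(** On the top and bottom of the window y (1 - y) <= eps, and on its lateral
    sides x^2 = L^2, so the harmonic polynomial with x^2 + y (1 - y) dominates;
    the gain is the factor 1 / L^2 for bounded x. *)
Lemma reflection_bound p : Q p -> `|Z p| <= tol p.1.
Proof.
have [p1 p2 p3 p4 p5] := params; have [p6 p7 p8] := params'.
move=> Qp; pose k := 10 * A * e / L ^+ 2.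
have Lp : 0 < L by lra.
have k0 : 0 < k by rewrite divr_gt0 ?exprn_gt0// -mulrA mulr_gt0.
have kL : k * L ^+ 2 = 10 * A * e by rewrite /k divfK// sqrf_eq0 gt_eqF.
pose c := 3 * rho * e + 4 * S ^+ 2 + 10 * A * e * eps.
have c0 : 0 <= c.
  rewrite /c !addr_ge0//; first by rewrite -mulrA mulr_ge0// mulr_ge0// ltW.
    by rewrite mulr_ge0// sqr_ge0.
  by rewrite mulr_ge0 ?(ltW eps0)// -mulrA mulr_ge0// ltW.
pose B (q : R * R) := c + 0 * q.1 + k * q.2 + k * q.1 ^+ 2 + 0 * (q.1 * q.2) + (- k) * q.2 ^+ 2.
have BE q : B q = c + k * (q.1 ^+ 2 + q.2 * (1 - q.2)) by rewrite /B; ring.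
have hB : harmonic Q B.
  split; last by move=> q _; exact: continuous_quadratic.
  by apply: has_laplacian_eq (has_laplacian_quadratic _ _ _ _ _ _ _) => q _; ring.
have side q : Q q -> [\/ q.1 = - L, q.1 = L, q.2 = eps | q.2 = 1 - eps] -> `|Z q| <= B q.
  move=> Qq sq; apply: le_trans (reflection_profile Qq) _; rewrite BE /c.
  have [/andP[x1 x2] /andP[y1 y2]] := Qq.
  have yy : 0 <= q.2 * (1 - q.2) by apply: mulr_ge0; lra.
  have y4 : q.2 * (1 - q.2) <= 1 by have := sqr_ge0 q.2; lra.
  have kx : 0 <= k * q.1 ^+ 2 by rewrite mulr_ge0 ?sqr_ge0// ltW.
  have ky : 0 <= k * (q.2 * (1 - q.2)) by rewrite mulr_ge0// ltW.
  have Aeps : 0 <= 10 * A * e * eps by rewrite mulr_ge0 ?(ltW eps0)// -mulrA mulr_ge0// ltW.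
  have Ae10 : 0 <= 10 * A * e by rewrite -mulrA mulr_ge0// ltW.
  have lat : q.1 ^+ 2 = L ^+ 2 -> 10 * A * e * (q.2 * (1 - q.2)) <= k * q.1 ^+ 2.
    by move=> ->; rewrite kL; have := ler_wpM2l Ae10 y4; rewrite mulr1.
  have tb : q.2 * (1 - q.2) <= eps -> 10 * A * e * (q.2 * (1 - q.2)) <= 10 * A * e * eps.
    by move=> h; exact: ler_wpM2l.
  case: sq => [E|E|E|E].
  - by have := lat _; rewrite E sqrrN => /(_ erefl); rewrite E sqrrN in kx; lra.
  - by have := lat _; rewrite E => /(_ erefl); lra.
  - have : q.2 * (1 - q.2) <= eps by rewrite E; nra.
    by move=> /tb; lra.
  - have : q.2 * (1 - q.2) <= eps by rewrite E; nra.
    by move=> /tb; lra.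
have OQ : open_rectangle (- L) L eps (1 - eps) `<=` Q.
  by move=> q [/andP[? ?] /andP[? ?]]; split; apply/andP; split; exact: ltW.
have [Lm cm] := harmonicB (harmonicZ (-1) harmonic_reflection) hB.
have [Lp' cp'] := harmonicB harmonic_reflection hB.
have up := max_principle_rectangle cp' (has_laplacian_sub OQ Lp') (fun _ _ => lexx 0)
  (M := 0) _ Qp.
have lo := max_principle_rectangle cm (has_laplacian_sub OQ Lm) (fun _ _ => lexx 0)
  (M := 0) _ Qp.
have : `|Z p| <= B p.
  rewrite ler_norml; apply/andP; split.
    rewrite -subr_ge0 -oppr_le0; have -> : - (Z p - - B p) = -1 * Z p - B p by ring.
    apply: lo => q Qq sq; have : `|Z q| <= B q.
      by apply: side => //; case: sq => [?|[?|[?|?]]]; [constructor 1|constructor 2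
        |constructor 3|constructor 4].
    by rewrite ler_norml => /andP[? ?]; lra.
  rewrite -subr_le0; apply: up => q Qq sq; have : `|Z q| <= B q.
    by apply: side => //; case: sq => [?|[?|[?|?]]]; [constructor 1|constructor 2
      |constructor 3|constructor 4].
  by rewrite ler_norml => /andP[? ?]; lra.
move=> /le_trans; apply; rewrite BE /tol -/k -/c lerD2l ler_wpM2l ?(ltW k0)// lerD2l.
by have := sqr_ge0 (p.2 - 2^-1); lra.
Qed.

Lemma square_window x r y : `|x| <= L - 1 -> 3 / 8 <= y <= 5 / 8 -> r <= 4^-1 ->
  square (x, y) r `<=` Q.
Proof.
have [p1 p2 p3 p4 p5] := params; have [p6 p7 p8] := params'.
rewrite ler_norml => /andP[x1 x2] /andP[y1 y2] r4 q [].
rewrite !ler_norml /= => /andP[q1 q2] /andP[q3 q4].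
by split; apply/andP; split; lra.
Qed.

Let deriv q m : Q q -> is_derive q m v ('D_m v q).
Proof. by move=> /window_interior/(torsion_C2 tv m m)[dv _ _]; exact: derivableP. Qed.

Let deriv2 q m n : Q q -> is_derive q n ('D_m v) ('D_n ('D_m v) q).
Proof. by move=> /window_interior/(torsion_C2 tv m n)[_ dv _]; exact: derivableP. Qed.

(** On the midline the reflected function has second derivative 2 v_xx + ka e / 2
    in x. *)
Lemma center_second_derivative x : `|x| <= L - 1 ->
  `|2 * derive2 (1, 0) v (x, 2^-1) + ka * e / 2| <= 512 * tol (`|x| + 1).
Proof.
have [p1 p2 p3 p4 p5] := params; have [p6 p7 p8] := params'.
move=> xL; have sQ : square (x, 2^-1) 4^-1 `<=` Q by apply: square_window; lra.
have Qx : Q (x, 2^-1) by apply: sQ; split; rewrite subrr normr0.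
have e1 : (1 : R, 0 : R) = (1, 0) \/ (1 : R, 0 : R) = (0, 1) by left.
pose ue q := 'D_(1, 0) v q + 'D_(1, 0) v (q.1, 1 - q.2) + ka * e / 2 * q.1.
have -> : 512 * tol (`|x| + 1) = 32 * tol (`|x| + 1) / 4^-1 ^+ 2 by field.
apply: (harmonic_second_derivative (u := Z) (ue := ue) (p := (x, 2^-1)) e1 e1 _ sQ
  harmonic_reflection).
- by lra.
- move=> q [q1 q2]; have /= := reflection_bound (sQ _ (conj q1 q2)).
  move=> /le_trans; apply; rewrite /tol lerD2l ler_wpM2l//.
    by rewrite divr_ge0 ?sqr_ge0// -mulrA mulr_ge0// ltW.
  rewrite lerD2r -(real_normK (num_real q.1)).
  have : `|q.1| <= `|x| + 1.
    have := ler_normD (q.1 - x) x; rewrite subrK; move: q1 => /= q1; lra.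
  by have := normr_ge0 q.1; nra.
- move=> q /sQ Qq.
  have -> : Z = (v + (fun p => v (p.1, 1 - p.2)))
     + (fun p => - (p.2 * (1 - p.2)) + ka * e / 4 * (p.1 ^+ 2 + p.2 * (1 - p.2))).
    by apply/funext => p; rewrite /Z -addrA.
  rewrite /ue; apply: is_deriveD.
    apply: is_deriveD; first exact: deriv.
    by apply: (is_derive_reflect (f := v)); apply: deriv; exact: window_reflect.
  apply: (is_derive_quadratic (c := ka * e / 4)) => h.
  by rewrite add_scale_ex /=; field.
- have -> : 2 * derive2 (1, 0) v (x, 2^-1) + ka * e / 2 =
    derive2 (1, 0) v (x, 2^-1) + derive2 (1, 0) v (x, 1 - 2^-1) + ka * e / 2.
    have -> : 1 - 2^-1 = 2^-1 :> R by field.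
    by ring.
  have -> : ue = ('D_(1, 0) v + (fun p => 'D_(1, 0) v (p.1, 1 - p.2)))
     + (fun p => ka * e / 2 * p.1) by [].
  apply: is_deriveD.
    apply: is_deriveD; first exact: deriv2.
    apply: (is_derive_reflect (f := 'D_(1, 0) v) (q := (x, 2^-1))).
    apply: deriv2; exact: (window_reflect Qx).
  apply: (is_derive_quadratic (c := 0)) => h.
  by rewrite add_scale_ex /=; ring.
Qed.

Let CW := (A * L ^+ 2 + rho + 2 * A) * e.

Let correction_dx q : Q q -> is_derive q (1, 0) W ('D_(1, 0) v q).
Proof.
move=> Qq; rewrite -['D_(1, 0) v q]subr0.
have -> : W = v - (fun p => p.2 * (1 - p.2) / 2) by [].
apply: is_deriveB; first exact: deriv.
by apply: (is_derive_quadratic (c := 0)) => h; rewrite add_scale_ex /=; ring.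
Qed.

Let correction_dy q : Q q ->
  is_derive q (0, 1) W ('D_(0, 1) v q - (2^-1 - q.2)).
Proof.
move=> Qq; have -> : W = v - (fun p => p.2 * (1 - p.2) / 2) by [].
apply: is_deriveB; first exact: deriv.
by apply: (is_derive_quadratic (c := - 2^-1)) => h; rewrite add_scale_ey /=; field.
Qed.

Lemma window_second_derivatives x y : `|x| <= L - 1 -> 3 / 8 <= y <= 5 / 8 ->
  [/\ `|derive2 (1, 0) v (x, y)| <= 512 * CW,
      `|'D_(0, 1) ('D_(1, 0) v) (x, y)| <= 512 * CW
    & `|'D_(1, 0) ('D_(0, 1) v) (x, y)| <= 512 * CW].
Proof.
have [p1 p2 p3 p4 p5] := params; have [p6 p7 p8] := params'.
move=> xL y8; have sQ : square (x, y) 4^-1 `<=` Q by apply: square_window.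
have Qx : Q (x, y) by apply: sQ; split; rewrite subrr normr0 invr_ge0.
have ex : (1 : R, 0 : R) = (1, 0) \/ (1 : R, 0 : R) = (0, 1) by left.
have ey : (0 : R, 1 : R) = (1, 0) \/ (0 : R, 1 : R) = (0, 1) by right.
have -> : 512 * CW = 32 * CW / 4^-1 ^+ 2 by field.
have hW : harmonic Q W := harmonic_sub window_interior harmonic_correction.
have r0 : 0 < 4^-1 :> R by rewrite invr_gt0.
have bW q : square (x, y) 4^-1 q -> `|W q| <= CW by move=> /sQ/correction_bound.
split.
- apply: (harmonic_second_derivative (ue := 'D_(1, 0) v) ex ex r0 sQ hW bW).
    by move=> q /sQ/correction_dx.
  exact: deriv2.
- apply: (harmonic_second_derivative (ue := 'D_(1, 0) v) ex ey r0 sQ hW bW).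
    by move=> q /sQ/correction_dx.
  exact: deriv2.
- apply: (harmonic_second_derivative
    (ue := 'D_(0, 1) v - (fun q => 2^-1 - q.2)) ey ex r0 sQ hW bW).
    by move=> q /sQ/correction_dy.
  rewrite -['D_(1, 0) ('D_(0, 1) v) (x, y)]subr0.
  apply: is_deriveB; first exact: deriv2.
  by apply: (is_derive_quadratic (c := 0)) => h; rewrite add_scale_ex /=; ring.
Qed.

Lemma second_derivative_near_center x y : `|x| <= L - 1 -> `|y - 2^-1| <= 16^-1 ->
  `|derive2 (1, 0) v (x, y) - derive2 (1, 0) v (x, 2^-1)|
    <= 2048 * 64 * CW * `|y - 2^-1|.
Proof.
have [p1 p2 p3 p4 p5] := params; have [p6 p7 p8] := params'.
move=> xL y16.
have sQ : square (x, 2^-1) 4^-1 `<=` Q by apply: square_window; lra.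
have Qx : Q (x, 2^-1) by apply: sQ; split; rewrite subrr normr0 invr_ge0.
have Qy : Q (x, y).
  apply: sQ; split; rewrite ?subrr ?normr0 ?invr_ge0 //=.
  by apply: le_trans y16 _; lra.
have ex : (1 : R, 0 : R) = (1, 0) \/ (1 : R, 0 : R) = (0, 1) by left.
have ey : (0 : R, 1 : R) = (1, 0) \/ (0 : R, 1 : R) = (0, 1) by right.
have hW : harmonic Q W := harmonic_sub window_interior harmonic_correction.
have r0 : 0 < 4^-1 :> R by rewrite invr_gt0.
have bW q : square (x, 2^-1) 4^-1 q -> `|W q| <= CW by move=> /sQ/correction_bound.
have t16 : `|y - 2^-1| <= 4^-1 / 4 by apply: le_trans y16 _; lra.
have := @harmonic_second_derivative_lipschitz R Q W ('D_(1, 0) v) (x, 2^-1) (1, 0)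
  (1, 0) (0, 1) 4^-1 CW (y - 2^-1) (derive2 (1, 0) v (x, 2^-1))
  (derive2 (1, 0) v (x, y)) ex ex ey r0 sQ hW bW.
rewrite add_scale_ey /= (addrC 2^-1) subrK => H.
apply: le_trans (H _ t16 (deriv2 _ _ Qx) (deriv2 _ _ Qy)) _.
  by move=> q /sQ/correction_dx.
by rewrite ler_wpM2r// le_eqVlt; apply/orP; left; apply/eqP; field.
Qed.

End reflection.

(** * Concave profiles with a nondegenerate maximum *)

(** The height profile at unit length, with its curvature ka at the top. *)
Record peaked (R : realType) (j0 j1 : R) (ht : R -> R) (ka : R) : Prop := Peaked {
  peaked_j0 : j0 < 0;
  peaked_j1 : 0 < j1;
  peaked_length : j1 - j0 = 1;
  peaked_range : forall s, j0 <= s <= j1 -> 0 <= ht s <= 1;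
  peaked_convex : convex_on j0 j1 (fun s => 1 - ht s);
  peaked_top : ht 0 = 1;
  peaked_derive : forall s, j0 < s < j1 -> is_derive s 1 ht (derive1 ht s);
  peaked_derive0 : derive1 ht 0 = 0;
  peaked_derive2 : is_derive (0 : R) 1 (derive1 ht) (- ka);
  peaked_ka : 0 < ka
}.

Section peaked_bounds.
Context (R : realType) (j0 j1 : R) (ht : R -> R) (ka : R).
Hypothesis H : peaked j0 j1 ht ka.

Lemma peaked_derive_bound (om : R) : 0 < om -> exists2 eta, 0 < eta &
  [/\ eta < - j0, eta < j1 & forall s : R, `|s| < eta ->
    is_derive s 1 ht (derive1 ht s) /\ `|derive1 ht s + ka * s| <= om * `|s|].
Proof.
move=> om0; have [del del0 Hd] := (is_deriveP _ _ _ _).1 (peaked_derive2 H) _ om0.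
have h0 := peaked_j0 H; have h1 := peaked_j1 H.
pose m := Num.min del (Num.min (- j0) j1).
have m0 : 0 < m by rewrite !lt_min del0 h1 oppr_gt0 h0.
have md : m <= del by rewrite ge_min lexx.
have mj0 : m <= - j0 by rewrite !ge_min lexx orbT.
have mj1 : m <= j1 by rewrite !ge_min lexx !orbT.
exists (m / 2); [lra|split; [lra|lra|]] => s sm.
split.
  by apply: (peaked_derive H); move: sm; rewrite ltr_norml => /andP[? ?]; apply/andP; split; lra.
have := Hd s; rewrite add0r (peaked_derive0 H) subr0 mulrN opprK [s%:A]mulr1 (mulrC ka).
by apply; lra.
Qed.

(** Mean value theorem for ht + ka s^2 / 2, whose derivative is o(s) at 0. *)
Lemma peaked_peano (om : R) : 0 < om -> exists2 eta, 0 < eta &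
  [/\ eta < - j0, eta < j1 & forall s : R, `|s| < eta ->
    `|1 - ht s - ka * s ^+ 2 / 2| <= om * s ^+ 2].
Proof.
move=> om0; have [eta eta0 [e0 e1 He]] := peaked_derive_bound om0.
exists eta => //; split => // s se.
pose F (s : R) := ht s + ka * s ^+ 2 / 2.
have [|r rs] := @MVT_line _ R F (fun s => derive1 ht s + ka * s) 0 1 s.
  move=> r rs; rewrite add0r [r%:A]mulr1.
  have [d _] := He r (le_lt_trans rs se).
  have -> : F = ht + (fun s => ka * s ^+ 2 / 2) by [].
  apply: is_deriveD; apply: (is_derive_quadratic (c := ka / 2)) => h.
  by rewrite [h%:A]mulr1; field.
rewrite !add0r [s%:A]mulr1 [r%:A]mulr1 /F (peaked_top H) expr0n mulr0 mul0r addr0 => E.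
have -> : 1 - ht s - ka * s ^+ 2 / 2 = - ((derive1 ht r + ka * r) * s) by rewrite -E; ring.
rewrite normrN normrM; have [_ hr] := He r (le_lt_trans rs se).
rewrite -(real_normK (num_real s)) expr2 mulrA ler_wpM2r//.
by apply: le_trans hr _; rewrite ler_wpM2l// ltW.
Qed.

(** Quadratic near 0 by the expansion; away from 0 the left side is at most 1
    and a large constant suffices, also at the end points. *)
Lemma peaked_upper : exists A, [/\ ka <= A, 1 <= A * j0 ^+ 2, 1 <= A * j1 ^+ 2
  & forall s, j0 <= s <= j1 -> 1 - ht s <= A * s ^+ 2].
Proof.
have k0 := peaked_ka H.
have [eta eta0 [e0 e1 He]] := peaked_peano (divr_gt0 k0 (ltr0n _ 2)).
have far s : eta <= `|s| -> 1 <= (ka + (eta ^+ 2)^-1) * s ^+ 2.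
  move=> es; have : eta ^+ 2 <= s ^+ 2.
    by rewrite -(real_normK (num_real s)); nra.
  move=> h; have h2 : 1 <= (eta ^+ 2)^-1 * s ^+ 2.
    by rewrite mulrC ler_pdivlMr ?exprn_gt0// mul1r.
  have h3 : 0 <= ka * s ^+ 2 by rewrite mulr_ge0 ?sqr_ge0// ltW.
  by rewrite mulrDl; lra.
exists (ka + (eta ^+ 2)^-1); split.
- by rewrite lerDl invr_ge0 sqr_ge0.
- by apply: far; rewrite ler0_norm ?(ltW e0)// ltW// (peaked_j0 H).
- by apply: far; rewrite ger0_norm ?(ltW e1)// ltW// (peaked_j1 H).
- move=> s sj; have [es|es] := ltP `|s| eta; last first.
    by have := far _ es; have /andP[? ?] := peaked_range H sj; lra.
  have := He _ es; rewrite ler_norml => /andP[_ ?].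
  have : 0 <= (eta ^+ 2)^-1 * s ^+ 2 by rewrite mulr_ge0 ?invr_ge0 ?sqr_ge0.
  by rewrite mulrDl; lra.
Qed.

(** Quadratic near 0 by the expansion; away from 0, 1 - ht is at least its value
    at the nearer of two small points on either side of 0, by convexity. *)
Lemma peaked_lower : exists2 c0, 0 < c0 &
  forall s, j0 <= s <= j1 -> c0 * s ^+ 2 <= 1 - ht s.
Proof.
have k0 := peaked_ka H; have h0 := peaked_j0 H; have h1 := peaked_j1 H.
have hl := peaked_length H.
have [eta eta0 [e0 e1 He]] := peaked_peano (divr_gt0 k0 (ltr0n _ 4)).
have near s : `|s| < eta -> ka / 4 * s ^+ 2 <= 1 - ht s.
  by move=> /He; rewrite ler_norml => /andP[? _]; lra.
pose k1 := ka / 16 * eta ^+ 2.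
have k10 : 0 < k1 by rewrite mulr_gt0 ?exprn_gt0// divr_gt0.
have half s : `|s| = eta / 2 -> k1 <= 1 - ht s.
  move=> sE; have : `|s| < eta by rewrite sE; lra.
  by move=> /near; rewrite -(real_normK (num_real s)) sE /k1; lra.
exists (Num.min (ka / 4) k1); first by rewrite lt_min k10 divr_gt0.
move=> s /andP[s0 s1].
have m1 : Num.min (ka / 4) k1 <= ka / 4 by rewrite ge_min lexx.
have m2 : Num.min (ka / 4) k1 <= k1 by rewrite ge_min lexx orbT.
have s2 := sqr_ge0 s.
have [es|es] := ltP `|s| eta; first by have := near _ es; nra.
have ss : s ^+ 2 <= 1 by nra.
suff : k1 <= 1 - ht s by nra.
have top := peaked_top H.
have [sp|sn] := leP 0 s.
  rewrite ger0_norm// in es.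
  have hk : k1 <= 1 - ht (eta / 2) by apply: half; rewrite ger0_norm//; lra.
  have : (s - 0) * (1 - ht (eta / 2)) <= (s - eta / 2) * (1 - ht 0) + (eta / 2 - 0) * (1 - ht s).
    by apply: (peaked_convex H); lra.
  by rewrite top; nra.
rewrite ltr0_norm// in es.
have hk : k1 <= 1 - ht (- (eta / 2)) by apply: half; rewrite normrN ger0_norm//; lra.
have : (0 - s) * (1 - ht (- (eta / 2))) <= (0 - - (eta / 2)) * (1 - ht s)
    + (- (eta / 2) - s) * (1 - ht 0).
  by apply: (peaked_convex H); lra.
by rewrite top; nra.
Qed.

(** The derivative of ht is O(|s|) near 0.  Where s is far from 0 the difference is
    at most 1, while |s - r| is bounded below; the derivative may blow up at the
    end points of the interval. *)
Lemma peaked_lipschitz : exists B, 0 < B /\ exists2 eta, 0 < eta &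
  [/\ eta < - j0, eta < j1 & forall s r, j0 <= s <= j1 -> `|r| <= eta ->
    `|ht s - ht r| <= B * (`|r| + `|s - r|) * `|s - r|].
Proof.
have k0 := peaked_ka H.
have [eta eta0 [e0 e1 He]] := peaked_derive_bound ltr01.
exists (3 * (ka + 1) + (eta / 6) ^- 2); split.
  by rewrite addr_gt0// ?invr_gt0 ?exprn_gt0//; lra.
exists (eta / 6); first lra.
split; [lra|lra|] => s r sj re; set t := `|s - r|.
have t0 : 0 <= t by exact: normr_ge0.
have r0 := normr_ge0 r.
have [te|te] := leP t (eta / 6).
  have near q : `|q| <= t -> `|r + q| < eta.
    by move=> qt; apply: le_lt_trans (ler_normD _ _) _; lra.
  have [|q qt] := @MVT_line _ R ht (derive1 ht) r 1 (s - r).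
    move=> q qt; rewrite [q%:A]mulr1; by have [] := He _ (near _ qt).
  rewrite [(s - r)%:A]mulr1 [q%:A]mulr1 (addrC r (s - r)) subrK => ->.
  rewrite normrM -/t ler_wpM2r//.
  have [_ hd] := He _ (near _ qt).
  have rq : `|r + q| <= `|r| + t by apply: le_trans (ler_normD _ _) _; rewrite lerD2l.
  have hk : `|derive1 ht (r + q)| <= (ka + 1) * (`|r| + t).
    rewrite -[derive1 ht (r + q)](addrK (ka * (r + q))).
    apply: le_trans (ler_normB _ _) _; rewrite normrM (gtr0_norm k0); nra.
  apply: le_trans hk _; rewrite ler_wpM2r ?addr_ge0//.
  have : 0 <= (eta / 6) ^- 2 by rewrite invr_ge0 sqr_ge0.
  lra.
have rj : j0 <= r <= j1 by move: re; rewrite ler_norml => /andP[? ?]; apply/andP; split; lra.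
have /andP[s0 s1] := peaked_range H sj; have /andP[u0 u1] := peaked_range H rj.
have h1 : `|ht s - ht r| <= 1 by rewrite ler_norml; apply/andP; split; lra.
apply: le_trans h1 _.
have : 1 <= (eta / 6) ^- 2 * t * t.
  rewrite -mulrA mulrC ler_pdivlMr ?exprn_gt0 ?divr_gt0// mul1r expr2.
  by apply: ler_pM => //; lra.
have : 0 <= 3 * (ka + 1) * t * t by rewrite !mulr_ge0//; lra.
have : 0 <= (3 * (ka + 1) + (eta / 6) ^- 2) * `|r| * t.
  by rewrite !mulr_ge0// addr_ge0 ?invr_ge0 ?sqr_ge0//; lra.
set i := (eta / 6) ^- 2; lra.
Qed.

End peaked_bounds.

Lemma expR_decay1 (R : realType) (c t : R) : 0 < c -> 0 <= t ->
  t * expR (- (c * t)) <= c^-1.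
Proof.
move=> c0 t0; rewrite expRN ler_pdivrMr ?expR_gt0// mulrC ler_pdivlMr// mulrC.
by apply: le_trans (expR_ge1Dx _); lra.
Qed.

Lemma expR_decay2 (R : realType) (c t : R) : 0 < c -> 0 <= t ->
  t ^+ 2 * expR (- (c * t)) <= 4 * c ^- 2.
Proof.
move=> c0 t0; have c2 : 0 < c / 2 by rewrite divr_gt0.
have h := expR_decay1 c2 t0.
have -> : - (c * t) = - (c / 2 * t) + - (c / 2 * t) by field.
rewrite expRD; set E := expR _ in h *.
have E0 : 0 <= t * E by rewrite mulr_ge0// expR_ge0.
have -> : t ^+ 2 * (E * E) = (t * E) * (t * E) by ring.
have -> : 4 * c ^- 2 = (c / 2)^-1 * (c / 2)^-1 by field; rewrite gt_eqF.
exact: ler_pM.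
Qed.

(** * The error term and Property 1 *)

(** The exponential weight absorbs the quadratic growth of h away from xt
    (expR_decay1, expR_decay2), which leaves a bound linear in M. *)
Lemma Error_bound (R : realType) (j0 j1 : R) (ht : R -> R) (ka c1 C1 : R) :
  peaked j0 j1 ht ka -> 0 < c1 -> 0 < C1 ->
  exists2 E0, 0 < E0 & exists eta, [/\ 0 < eta, eta < - j0, eta < j1 &
    forall M N h xt, 1 <= M -> 0 < N -> 2 * M <= N * eta ->
      (forall x, N * j0 <= x <= N * j1 -> h x = ht (N^-1 * x)) -> `|xt| <= M ->
      Error c1 C1 (N * j0) (N * j1) h xt <= E0 * M * N ^- 2].
Proof.
move=> H c0 C0; have [B [B0 [eta eta0 [e0 e1 Lip]]]] := peaked_lipschitz H.
have cc : 0 < c1 ^- 2 by rewrite invr_gt0 exprn_gt0.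
have ci : 0 < c1^-1 by rewrite invr_gt0.
(* D1 bounds the boundary term exp(- c1 d), with d at least N eta / 2, and D2
   the supremum. *)
pose D1 := 16 * c1 ^- 2 * eta ^- 2; pose D2 := B * (c1^-1 + 4 * c1 ^- 2).
have D10 : 0 < D1 by rewrite !mulr_gt0// invr_gt0 exprn_gt0.
have D20 : 0 < D2 by rewrite mulr_gt0// addr_gt0// mulr_gt0.
exists (C1 * (D1 + D2)); first by rewrite mulr_gt0// addr_gt0.
exists eta; split => // M N h xt M1 N0 MN hE xM.
have Ni : 0 < N^-1 by rewrite invr_gt0.
have N2 : 0 < N ^- 2 by rewrite invr_gt0 exprn_gt0.
have M0 : 0 < M by lra.
rewrite /Error /=; set d := Num.min _ _.
have x12 : - M <= xt <= M by rewrite -ler_norml.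
have Nj0 : N * j0 <= - (N * eta) by rewrite -mulrN ler_wpM2l ?ltW//; lra.
have Nj1 : N * eta <= N * j1 by rewrite ler_wpM2l ?ltW.
pose t0 := N * eta / 2.
have t00 : 0 < t0 by rewrite divr_gt0// mulr_gt0.
have dt : t0 <= d by rewrite le_min /t0; apply/andP; split; lra.
have dle : d <= xt - N * j0 /\ d <= N * j1 - xt by rewrite !ge_min !lexx orbT.
have h1 : expR (- (c1 * d)) <= D1 * N ^- 2.
  have h2 := expR_decay2 c0 (ltW t00).
  have h3 : expR (- (c1 * d)) <= expR (- (c1 * t0)).
    by rewrite ler_expR lerN2 ler_pM2l.
  apply: le_trans h3 _; rewrite -(ler_pM2l (exprn_gt0 2 t00)).
  apply: le_trans h2 _; rewrite le_eqVlt; apply/orP; left; apply/eqP.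
  by rewrite /t0 /D1; field; rewrite !gt_eqF.
have sup_le : sup [set expR (- (c1 * `|x - xt|)) * `|h x - h xt|
     | x in [set x | `|x - xt| <= 3 / 4 * d]] <= D2 * M * N ^- 2.
  apply: ge_sup.
    exists (expR (- (c1 * `|xt - xt|)) * `|h xt - h xt|), xt => //=.
    by rewrite subrr normr0; lra.
  move=> _ [x /= xd <-]; set t := `|x - xt|.
  have xx : N * j0 <= x <= N * j1.
    move: xd; rewrite ler_norml => /andP[? ?]; have [? ?] := dle.
    by apply/andP; split; lra.
  have xtt : N * j0 <= xt <= N * j1 by have [? ?] := dle; apply/andP; split; lra.
  rewrite (hE _ xx) (hE _ xtt).
  have sj : j0 <= N^-1 * x <= j1.
    by rewrite ler_pdivlMl// ler_pdivrMl.
  have rE : `|N^-1 * xt| = N^-1 * `|xt| by rewrite normrM gtr0_norm.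
  have re : `|N^-1 * xt| <= eta by rewrite rE ler_pdivrMl//; lra.
  have tE : `|N^-1 * x - N^-1 * xt| = N^-1 * t.
    by rewrite -mulrBr normrM gtr0_norm.
  have := Lip _ _ sj re; rewrite rE tE => L.
  have tge : 0 <= t by exact: normr_ge0.
  have E0 := expR_ge0 (- (c1 * t)).
  apply: le_trans (ler_wpM2l E0 L) _; set E := expR _ in E0 *.
  have -> : E * (B * (N^-1 * `|xt| + N^-1 * t) * (N^-1 * t)) =
    B * N ^- 2 * (`|xt| * (t * E) + t ^+ 2 * E) by field; rewrite gt_eqF.
  have -> : D2 * M * N ^- 2 = B * N ^- 2 * (M * c1^-1 + M * (4 * c1 ^- 2)).
    by rewrite /D2; ring.
  rewrite ler_wpM2l//; first by rewrite mulr_ge0// ltW.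
  have e1' := expR_decay1 c0 tge; have e2' := expR_decay2 c0 tge.
  apply: lerD.
    by apply: ler_pM => //; rewrite mulr_ge0.
  apply: le_trans e2' _; by rewrite -[leLHS]mul1r ler_wpM2r// mulr_ge0// (ltW cc).
have h4 : D1 * N ^- 2 <= D1 * M * N ^- 2.
  by rewrite ler_pM2r// -[leLHS]mulr1 ler_pM2l.
have -> : C1 * (D1 + D2) * M * N ^- 2 = C1 * (D1 * M * N ^- 2) + C1 * (D2 * M * N ^- 2).
  by ring.
by apply: lerD; rewrite ler_pM2l//; exact: le_trans h1 h4.
Qed.

Lemma peaked_continuous (R : realType) (j0 j1 : R) (ht : R -> R) (ka u w : R) :
  peaked j0 j1 ht ka -> j0 < u -> w < j1 -> {within `[u, w], continuous ht}.
Proof.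
move=> H ju wj; apply: derivable_within_continuous => s /=.
rewrite in_itv /= => /andP[us sw].
have [] // := peaked_derive H (s := s).
by rewrite (lt_le_trans ju us) (le_lt_trans sw wj).
Qed.

Lemma peaked_level_right (R : realType) (j0 j1 : R) (ht : R -> R) (ka u m : R) :
  peaked j0 j1 ht ka -> 0 <= u < j1 -> 0 <= m <= 1 - ht u ->
  exists2 s, 0 <= s <= u & ht s = 1 - m.
Proof.
move=> H /andP[u0 uj] /andP[m0 mu].
have [|s] := IVT u0 (peaked_continuous H (peaked_j0 H) uj) (v := 1 - m).
  by rewrite (peaked_top H) ge_min le_max; apply/andP; split; apply/orP; [right|left]; lra.
by rewrite in_itv; exists s.
Qed.

Lemma peaked_level_left (R : realType) (j0 j1 : R) (ht : R -> R) (ka u m : R) :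
  peaked j0 j1 ht ka -> j0 < u <= 0 -> 0 <= m <= 1 - ht u ->
  exists2 s, u <= s <= 0 & ht s = 1 - m.
Proof.
move=> H /andP[ju u0] /andP[m0 mu].
have [|s] := IVT u0 (peaked_continuous H ju (peaked_j1 H)) (v := 1 - m).
  by rewrite (peaked_top H) ge_min le_max; apply/andP; split; apply/orP; [left|right]; lra.
by rewrite in_itv; exists s.
Qed.

(** The error term is at most E0 M / N^2 while delta is at least c M^2 / (2 N^2),
    so M is chosen with 200 E0 <= c M.  The points where the height equals
    1 - 2 delta come from peaked_level_left and peaked_level_right. *)
Lemma property1_peaked (R : realType) (j0 j1 : R) (ht : R -> R) (ka c1 C1 : R) :
  peaked j0 j1 ht ka -> 0 < c1 -> 0 < C1 ->
  exists M C N1, [/\ 2 < M, 0 < C, 0 < N1 & forall N h, N1 <= N ->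
    (forall x, N * j0 <= x <= N * j1 -> h x = ht (N^-1 * x)) ->
    exists2 delta, C^-1 * N ^- 2 <= delta <= C * N ^- 2 &
      property1 c1 C1 (N * j0) (N * j1) h 0 M delta].
Proof.
move=> H c0 C0; have [E0 E00 [eta [eta0 e0 e1 HE]]] := Error_bound H c0 C0.
have [k [kk A0 A1 A2]] := peaked_upper H; have [c cc0 Hc] := peaked_lower H.
have k0 : 0 < k by apply: lt_le_trans kk; exact: (peaked_ka H).
(* 200 E0 <= c M turns E0 M / N^2 into at most delta / 100, with delta at least
   c M^2 / (2 N^2); the summand 3 gives 2 < M. *)
pose M := 3 + 200 * E0 / c.
have M3 : 3 <= M.
  by rewrite lerDl; apply: divr_ge0 (ltW cc0); apply: mulr_ge0 (ltW E00); exact: ler0n.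
have M0 : 0 < M by lra.
have ME : 200 * E0 <= c * M.
  by rewrite /M mulrDr mulrCA mulfV ?gt_eqF// mulr1; lra.
have cM : 0 < c * M ^+ 2 by rewrite mulr_gt0// exprn_gt0.
have kM : 0 < k * M ^+ 2 by rewrite mulr_gt0// exprn_gt0.
pose C := k * M ^+ 2 + 2 / (c * M ^+ 2).
have Ci : 0 < 2 / (c * M ^+ 2) by rewrite divr_gt0.
have C00 : 0 < C by rewrite addr_gt0.
exists M, C, (2 * M / eta); split; [lra|by []|by rewrite divr_gt0// mulr_gt0|].
move=> N h N1 hE.
have N0 : 0 < N by apply: lt_le_trans N1; rewrite divr_gt0// mulr_gt0.
have MN : 2 * M <= N * eta by rewrite -ler_pdivrMr.
have Ni : 0 < N^-1 by rewrite invr_gt0.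
have N2 : 0 < N ^- 2 by rewrite invr_gt0 exprn_gt0.
have Nj0 : N * j0 <= - (N * eta) by rewrite -mulrN ler_wpM2l ?ltW//; lra.
have Nj1 : N * eta <= N * j1 by rewrite ler_wpM2l ?ltW.
pose g x := 1 - h x.
have gE x : - M <= x <= M -> g x = 1 - ht (N^-1 * x).
  by move=> /andP[? ?]; rewrite /g hE//; apply/andP; split; lra.
have sj x : - M <= x <= M -> j0 <= N^-1 * x <= j1.
  by move=> /andP[? ?]; rewrite ler_pdivlMl// ler_pdivrMl//; apply/andP; split; lra.
have gb x : `|x| = M -> c * M ^+ 2 * N ^- 2 <= g x <= k * M ^+ 2 * N ^- 2.
  move=> xM; have xx : - M <= x <= M by rewrite -ler_norml xM.
  rewrite gE//; have := Hc _ (sj _ xx); have := A2 _ (sj _ xx).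
  have -> : (N^-1 * x) ^+ 2 = M ^+ 2 * N ^- 2.
    by rewrite -xM (real_normK (num_real x)); field; rewrite gt_eqF.
  by rewrite !mulrA => ? ?; apply/andP.
have g1 : c * M ^+ 2 * N ^- 2 <= g M <= k * M ^+ 2 * N ^- 2 by apply: gb; rewrite gtr0_norm.
have g2 : c * M ^+ 2 * N ^- 2 <= g (- M) <= k * M ^+ 2 * N ^- 2.
  by apply: gb; rewrite normrN gtr0_norm.
pose m := Num.min (g M) (g (- M)).
have m1 : m <= g M by rewrite ge_min lexx.
have m2 : m <= g (- M) by rewrite ge_min lexx orbT.
have ml : c * M ^+ 2 * N ^- 2 <= m by rewrite le_min; apply/andP; split; lra.
have m0 : 0 <= m by apply: le_trans ml; rewrite mulr_ge0// ltW.
exists (m / 2).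
  apply/andP; split.
    have : C^-1 <= c * M ^+ 2 / 2.
      rewrite -[X in _ <= X]invrK lef_pV2 ?posrE ?invr_gt0 ?divr_gt0//.
      by rewrite invf_div /C lerDr ltW.
    by move=> /(ler_wpM2r (ltW N2)); lra.
  have h1 : k * M ^+ 2 * N ^- 2 <= C * N ^- 2 by rewrite ler_pM2r// lerDl ltW.
  have : 0 < k * M ^+ 2 * N ^- 2 by rewrite mulr_gt0.
  lra.
have [jM Mj] : N * j0 < - M /\ M < N * j1.
  by move: Nj0 Nj1 MN M0; clear => *; split; lra.
have hM : h M = ht (N^-1 * M).
  by apply: hE; rewrite (ltW Mj) andbT (le_trans (ltW jM))// -subr_ge0 opprK addr_ge0// ltW.
have hNM : h (- M) = ht (N^-1 * - M).
  by apply: hE; rewrite (ltW jM) (le_trans _ (ltW Mj))// -subr_ge0 opprK addr_ge0// ltW.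
have [sp /andP[sp0 sp1] hsp] : exists2 s, 0 <= s <= N^-1 * M & ht s = 1 - m.
  apply: (peaked_level_right H).
    by rewrite ltr_pdivrMl// Mj andbT mulr_ge0// ltW.
  by rewrite m0 -hM.
have [sm /andP[sm0 sm1] hsm] : exists2 s, N^-1 * - M <= s <= 0 & ht s = 1 - m.
  apply: (peaked_level_left H).
    by rewrite ltr_pdivlMl// jM mulrN oppr_le0 mulr_ge0// ltW.
  by rewrite m0 -hNM.
have [Nsp0 Nsp1] : 0 <= N * sp /\ N * sp <= M.
  by rewrite mulr_ge0 ?(ltW N0)// -ler_pdivlMl.
have [Nsm0 Nsm1] : - M <= N * sm /\ N * sm <= 0.
  by rewrite -ler_pdivrMl// pmulr_rle0.
have hN s : N^-1 * (N * s) = s by rewrite mulrA mulVf ?mul1r// gt_eqF.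
have mm : 1 - m = 1 - 2 * (m / 2) by rewrite mulrC divfK.
have final : E0 * M * N ^- 2 <= m / 2 / 100.
  have : E0 * M <= c * M ^+ 2 / 200.
    by have := ler_wpM2r (ltW M0) ME; clear => *; lra.
  by move=> /(ler_wpM2r (ltW N2)); move: ml; clear => *; lra.
have mhalf : 0 <= m / 2 <= 2^-1 * Num.min (1 - h M) (1 - h (- M)).
  by rewrite divr_ge0//= mulrC.
have M1 : 1 <= M by apply: le_trans M3; rewrite ler1n.
split; rewrite ?sub0r ?add0r//.
  by split; exact: ltW.
exists (N * sm), (N * sp); split.
- by rewrite Nsm0.
- by rewrite Nsp0.
- by rewrite hE ?hN ?hsm// (le_trans (ltW jM))//= (le_trans Nsm1)// mulr_ge0 ?(ltW N0)// ltW// (peaked_j1 H).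
- by rewrite hE ?hN ?hsp// (le_trans _ Nsp0) ?(le_trans Nsp1 (ltW Mj))// pmulr_rle0// ltW// (peaked_j0 H).
- move=> xt /andP[x1 x2]; apply: le_trans (HE M N h xt M1 N0 MN hE _) final.
  by rewrite ler_norml (le_trans Nsm0 x1) (le_trans x2 Nsp1).
Qed.

(** * Location of the maximum *)

(** The lower profile at X = 0, where t1 and t2 vanish. *)
Lemma torsion_center_ge (R : realType) (a b e A : R) (t1 t2 : R -> R)
    (v : R * R -> R) (ka rho L : R) : profile a b e A t1 t2 ->
  torsion_function (strip_region a b t1 t2) v ->
  0 <= ka <= A -> 0 <= L -> 0 <= rho <= A ->
  A * e * (2 * L) ^+ 2 <= 1 -> A * e * (L + 1) ^+ 2 < 1 ->
  (forall x, a <= x <= b -> `|x| <= 2 * L ->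
    `|t1 x + t2 x - ka * e * x ^+ 2 / 2| <= rho * e) ->
  8^-1 - 3 * A * e <= v (0, 2^-1).
Proof.
move=> P tv kaA L0 /andP[rho0 rhoA] AL2 AL1 Hrho.
have z : a <= 0 <= b by rewrite !ltW ?(profile_a P) ?(profile_b P).
have := profile_t1_le P z; have := profile_t2_le P z; rewrite expr0n mulr0.
rewrite -!eq_le => /eqP z2 /eqP z1.
have z0 : `|0 : R| <= L by rewrite normr0.
have c0 : closure (strip_region a b t1 t2) (0, 2^-1).
  apply: subset_closure; split => //=.
  by rewrite -z1 -z2 subr0; apply/andP; split; lra.
have := torsion_profile_ge P tv kaA AL2 Hrho z0 rho0 AL1 c0.
rewrite -z1 -z2 expr0n /= mulr0 mul0r subrr !mulr0 !add0r.
have := ler_wpM2r (ltW (profile_e P)) rhoA.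
have : 0 <= A * e by rewrite mulr_ge0 ?ltW ?(profile_A P) ?(profile_e P).
lra.
Qed.

(** Beyond X0 the supporting lines at X0 open inwards, so the wedge bound there
    is at most (1 - c0 e X0^2) / 8 up to O(e^2); for X0 large this is below the
    value at the centre.  The bound on the ordinate comes from
    v <= y (1 - y) / 2. *)
Lemma max_location (R : realType) (a b e A : R) (t1 t2 : R -> R)
    (v : R * R -> R) (c0 X0 : R) (p : R * R) : profile a b e A t1 t2 ->
  torsion_function (strip_region a b t1 t2) v ->
  (forall x, a <= x <= b -> c0 * e * x ^+ 2 <= t1 x + t2 x) ->
  1 <= X0 -> 24 * A + 2 <= c0 * X0 ^+ 2 ->
  A * e * (X0 + 1) ^+ 2 <= 2^-1 -> (A * e * (X0 + 1) ^+ 2) ^+ 2 <= e ->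
  24 * A * e <= 1 -> 
  8^-1 - 3 * A * e <= v p -> strip_region a b t1 t2 p ->
  `|p.1| <= X0 /\ (p.2 - 2^-1) ^+ 2 <= 6 * A * e.
Proof.
move=> P tv low X1 c0X S2 SS A24 vp Omp.
have cp : closure (strip_region a b t1 t2) p by exact: subset_closure.
split; last by have := torsion_parabola_le P tv cp; lra.
have e0 := profile_e P; have A0 := profile_A P.
have AX : A * e * (X0 + 1) ^+ 2 < 1 by lra.
have X10 : 0 <= X0 + 1 by lra.
have [aX Xb] := profile_range P X10 AX.
have key (X : R) : `|X| = X0 -> 0 < X * (p.1 - X) -> False.
  move=> XE Xp.
  have X2 : X ^+ 2 = X0 ^+ 2 by rewrite -(real_normK (num_real X)) XE.
  have XX : X != 0 by apply/eqP => X00; rewrite X00 mul0r ltxx in Xp.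
  have XX0 : `|X| <= X0 by rewrite XE.
  have [xl xu] : - X0 <= X /\ X <= X0 by apply/andP; rewrite -ler_norml.
  have Xab : a <= X <= b by apply/andP; split; lra.
  have zab : a <= 0 <= b by apply/andP; split; lra.
  have [s1 s1S H1] := support_slope P (profile_convex1 P) (profile_t1_le P) XX0 AX.
  have [s2 s2S H2] := support_slope P (profile_convex2 P) (profile_t2_le P) XX0 AX.
  have g1 := profile_ge01 P Xab; have g2 := profile_ge02 P Xab.
  have gX := low _ Xab; rewrite X2 in gX.
  have sX : 0 <= (s1 + s2) * X.
    have := H1 _ zab; have := H2 _ zab; have := profile_le P zab.
    by rewrite expr0n mulr0; lra.
  have sp : 0 <= (s1 + s2) * (p.1 - X).
    have : 0 <= ((s1 + s2) * X) * (X * (p.1 - X)) by rewrite mulr_ge0// ltW.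
    have -> : ((s1 + s2) * X) * (X * (p.1 - X)) = X ^+ 2 * ((s1 + s2) * (p.1 - X)) by ring.
    have Xp2 : 0 < X ^+ 2 by rewrite X2 exprn_gt0//; lra.
    by rewrite (pmulr_rge0 _ Xp2).
  set S := A * e * (X0 + 1) ^+ 2 in S2 SS s1S s2S.
  have sS : `|s1 * s2| <= S ^+ 2 by rewrite normrM expr2; apply: ler_pM.
  have S0 : 0 <= S by apply: le_trans s1S.
  have Sq : S ^+ 2 <= 2^-1 by nra.
  move: (sS); rewrite ler_norml => /andP[sl su].
  have s1m : s1 * s2 < 1 by lra.
  have H1' x : a <= x <= b -> t1 X - s1 * X + s1 * x <= t1 x by move=> /H1; lra.
  have H2' x : a <= x <= b -> t2 X - s2 * X + s2 * x <= t2 x by move=> /H2; lra.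
  have := torsion_wedge_le P tv s1m H1' H2' cp.
  rewrite ler_pdivlMr; last lra.
  set l1 := t1 X - _ + _; set l2 := t2 X - _ + _ => up.
  have w : 1 - l1 - l2 <= 1 - c0 * e * X0 ^+ 2 by rewrite /l1 /l2; lra.
  have [pab /andP[p1 p2]] := Omp.
  have w1 : l1 <= p.2 by exact: le_trans (H1' _ pab) p1.
  have w2 : p.2 <= 1 - l2 by have := H2' _ pab; rewrite -/l2; lra.
  set m := 1 - l1 - l2 in w.
  have m0 : 0 <= m by rewrite /m; lra.
  have m1 : m <= 1.
    have : 0 <= c0 * X0 ^+ 2 * e by rewrite mulr_ge0 ?(ltW e0)//; lra.
    lra.
  (* Arithmetic-geometric mean, then m^2 <= m as 0 <= m <= 1. *)
  have prod : (p.2 - l1) * (1 - l2 - p.2) <= m / 4.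
    have : (p.2 - l1) * (1 - l2 - p.2) <= m ^+ 2 / 4.
      by rewrite /m; have := sqr_ge0 (p.2 - l1 - (1 - l2 - p.2)); lra.
    have : m ^+ 2 <= m by rewrite expr2 ler_piMr.
    lra.
  have c0e : (24 * A + 2) * e <= c0 * e * X0 ^+ 2.
    by rewrite (mulrAC c0) ler_wpM2r// ltW.
  have vlow : (8^-1 - 3 * A * e) * (2 * (1 - s1 * s2)) <= v p * (2 * (1 - s1 * s2)).
    by rewrite ler_wpM2r//; lra.
  have : 4^-1 * (1 - 24 * A * e - S ^+ 2) <= (8^-1 - 3 * A * e) * (2 * (1 - s1 * s2)).
    have : 0 <= (1 - 24 * A * e) * (S ^+ 2 - s1 * s2) by apply: mulr_ge0; lra.
    have : 0 <= 24 * A * e * S ^+ 2.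
      by rewrite mulr_ge0 ?sqr_ge0// mulr_ge0 ?(ltW e0)// mulr_ge0// ltW.
    lra.
  lra.
rewrite leNgt; apply/negP => pX.
have [p0|p0] := leP 0 p.1.
  rewrite ger0_norm// in pX; apply: (key X0); first by rewrite gtr0_norm; lra.
  by apply: mulr_gt0; lra.
rewrite ltr0_norm// in pX; apply: (key (- X0)); first by rewrite normrN gtr0_norm; lra.
by rewrite nmulr_rgt0; lra.
Qed.

(** Positivity: the cross term 2 K e |n1 n2| is absorbed by n1^2 k e / 2 and
    n2^2 (2 K^2 / k) e, and e is small. *)
Lemma quadratic_form_bounds (R : realType) (k K D e delta al be n1 n2 C : R) :
  0 < k -> 0 < K -> 0 < D -> 0 < e ->
  K * e <= 4^-1 -> 2 * K ^+ 2 * e <= k / 4 -> k * e <= 1 ->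
  D^-1 * e <= delta <= D * e ->
  k * e <= al <= K * e -> `|be| <= 2 * K * e -> n1 ^+ 2 + n2 ^+ 2 = 1 ->
  C = 2 + 2 * D / k + 2 * K * D + D ->
  C^-1 * Num.max (`|n2| ^+ 2) delta
    <= n1 ^+ 2 * al - n1 * n2 * be + n2 ^+ 2 * (1 - al)
    <= C * Num.max (`|n2| ^+ 2) delta.
Proof.
move=> k0 K0 D0 e0 Ke Kk ke /andP[d1 d2] /andP[a1 a2] be2 nn CE.
have Dk : 0 < 2 * D / k by rewrite divr_gt0// mulr_gt0.
have KD : 0 < 2 * K * D by rewrite !mulr_gt0.
have C0 : 0 < C by rewrite CE; lra.
rewrite (real_normK (num_real n2)).
have s1 := sqr_ge0 n1; have s2 := sqr_ge0 n2.
have Ke0 : 0 < K * e by rewrite mulr_gt0.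
have ke0 : 0 < k * e by rewrite mulr_gt0.
have eD : e <= D * delta by rewrite mulrC -ler_pdivrMr// mulrC.
have de0 : 0 < delta by apply: lt_le_trans d1; rewrite mulr_gt0 ?invr_gt0.
set q := n1 ^+ 2 * al - _ + _.
have cross : `|n1 * n2 * be| <= n1 ^+ 2 * (k * e) / 2 + n2 ^+ 2 / 4.
  rewrite normrM normrM; set x := `|n1|; set y := `|n2|.
  have x0 : 0 <= x by exact: normr_ge0.
  have y0 : 0 <= y by exact: normr_ge0.
  rewrite -(real_normK (num_real n1)) -(real_normK (num_real n2)) -/x -/y.
  have h1 : x * y * `|be| <= x * y * (2 * K * e) by rewrite ler_wpM2l// mulr_ge0.
  apply: le_trans h1 _.
  have h3 : 0 <= ((x * k - 2 * K * y) ^+ 2) * e by rewrite mulr_ge0 ?sqr_ge0// ltW.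
  have h4 : 2 * K ^+ 2 * e * y ^+ 2 <= k / 4 * y ^+ 2 by rewrite ler_wpM2r ?sqr_ge0.
  by rewrite -(ler_pM2l k0); lra.
have upc : `|n1 * n2 * be| <= K * e.
  rewrite normrM; have h : `|n1 * n2| <= 2^-1.
    rewrite ler_norml; apply/andP; split.
      by have := sqr_ge0 (n1 + n2); lra.
    by have := sqr_ge0 (n1 - n2); lra.
  have := ler_pM (normr_ge0 _) (normr_ge0 _) h be2; lra.
move: cross upc; rewrite !ler_norml => /andP[_ c2] /andP[u1 u2].
have a1' : n1 ^+ 2 * (k * e) <= n1 ^+ 2 * al by rewrite ler_wpM2l.
have a2' : n1 ^+ 2 * al <= K * e.
  apply: le_trans (ler_wpM2l s1 a2) _; rewrite ler_piMl ?(ltW Ke0)//; lra.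
have b1 : n2 ^+ 2 * al <= n2 ^+ 2 * 4^-1 by rewrite ler_wpM2l//; lra.
have b2 : 0 <= n2 ^+ 2 * al by rewrite mulr_ge0//; lra.
have qu : q <= n2 ^+ 2 + 2 * (K * e) by rewrite /q; lra.
have ql : n1 ^+ 2 * (k * e) / 2 + n2 ^+ 2 / 2 <= q by rewrite /q; lra.
have ql1 : k * e / 2 <= q.
  have : 0 <= n2 ^+ 2 * (1 - k * e) by rewrite mulr_ge0//; lra.
  have n1E : n1 ^+ 2 = 1 - n2 ^+ 2 by lra.
  by rewrite n1E in ql; lra.
have q0 : 0 <= q by lra.
apply/andP; split.
  rewrite ler_pdivrMl// ge_max; apply/andP; split.
    have : 2 * q <= C * q by rewrite ler_wpM2r// CE; lra.
    have : 0 <= n1 ^+ 2 * (k * e) by rewrite mulr_ge0// ltW.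
    lra.
  apply: (le_trans d2).
  have h : 2 * D / k * q <= C * q by rewrite ler_wpM2r// CE; lra.
  apply: le_trans h.
  have := ler_wpM2l (ltW Dk) ql1.
  by have -> : 2 * D / k * (k * e / 2) = D * e by field; rewrite gt_eqF.
have mn : n2 ^+ 2 <= Num.max (n2 ^+ 2) delta by rewrite le_max lexx.
have md : delta <= Num.max (n2 ^+ 2) delta by rewrite le_max lexx orbT.
set m := Num.max _ _ in mn md *.
have m0 : 0 <= m by apply: le_trans mn.
have h1 : 2 * K * D * delta <= 2 * K * D * m by rewrite ler_pM2l.
have h2 : 2 * K * e <= 2 * K * (D * delta) by rewrite ler_pM2l// mulr_gt0.
have h3 : (1 + 2 * K * D) * m <= C * m by rewrite ler_wpM2r// CE; lra.
lra.
Qed.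

Lemma convex_on_onem (R : realType) (a b : R) (f : R -> R) :
  convex_on a b (fun x => - f x) -> convex_on a b (fun x => 1 - f x).
Proof. by move=> cf x y z ax xy yz zb; have := cf _ _ _ ax xy yz zb; lra. Qed.

Lemma scaled_profile (R : realType) (j0 j1 ka A N : R) (ht f1 f2 : R -> R) :
  peaked j0 j1 ht ka -> 0 < A -> 0 < N ->
  1 <= A * j0 ^+ 2 -> 1 <= A * j1 ^+ 2 ->
  (forall s, j0 <= s <= j1 -> 1 - ht s <= A * s ^+ 2) ->
  normalised_domain (N * j0) (N * j1) f1 f2 ->
  (forall x, N * j0 <= x <= N * j1 -> height f1 f2 x = ht (N^-1 * x)) ->
  profile (N * j0) (N * j1) (N ^- 2) A f1 (fun x => 1 - f2 x).
Proof.
move=> H A0 N0 A1 A2 Aub D hE.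
have sE x : N * j0 <= x <= N * j1 -> j0 <= N^-1 * x <= j1.
  by rewrite ler_pdivlMl// ler_pdivrMl.
have tE x : N * j0 <= x <= N * j1 -> f1 x + (1 - f2 x) = 1 - ht (N^-1 * x).
  by move=> /hE <-; rewrite /height; ring.
split.
- by rewrite pmulr_rlt0// (peaked_j0 H).
- by rewrite mulr_gt0// (peaked_j1 H).
- by rewrite invr_gt0 exprn_gt0.
- exact: A0.
- exact: convex_functionP (normalised_convex D).
- apply: convex_on_onem; exact: convex_functionP (normalised_concave D).
- by move=> x /(normalised_bounds D)[].
- by move=> x /(normalised_bounds D)[_ _]; rewrite subr_ge0.
- move=> x xab; rewrite tE//; have /andP[] := peaked_range H (sE _ xab); lra.
- move=> x xab; rewrite tE//; apply: le_trans (Aub _ (sE _ xab)) _.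
  by rewrite exprMn exprVn mulrA.
- by have -> : A * N ^- 2 * (N * j0) ^+ 2 = A * j0 ^+ 2 by field; rewrite gt_eqF.
- by have -> : A * N ^- 2 * (N * j1) ^+ 2 = A * j1 ^+ 2 by field; rewrite gt_eqF.
Qed.

(** * The Hessian near the maximum *)

Lemma disc_coordinates (R : realType) (p q : R * R) (r : R) : 0 < r ->
  disc p r q -> `|q.1 - p.1| < r /\ `|q.2 - p.2| < r.
Proof.
move=> r0; rewrite /disc /= => h.
have s1 := sqr_ge0 (q.1 - p.1); have s2 := sqr_ge0 (q.2 - p.2).
have key (x : R) : x ^+ 2 < r ^+ 2 -> `|x| < r.
  rewrite -(real_normK (num_real x)) => h1; rewrite ltNge; apply/negP => rx.
  by have := normr_ge0 x; nra.
by split; apply: key; lra.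
Qed.

Lemma max_near_center (R : realType) (a b e A : R) (t1 t2 : R -> R)
    (v : R * R -> R) (ka c0 X0 L rho nu : R) (p : R * R) :
  profile a b e A t1 t2 -> torsion_function (strip_region a b t1 t2) v ->
  0 <= ka <= A ->
  (forall x, a <= x <= b -> c0 * e * x ^+ 2 <= t1 x + t2 x) ->
  (forall x, a <= x <= b -> `|x| <= 2 * L ->
    `|t1 x + t2 x - ka * e * x ^+ 2 / 2| <= rho * e) ->
  1 <= X0 -> 24 * A + 2 <= c0 * X0 ^+ 2 -> X0 <= L -> 0 <= rho <= A ->
  A * e * (2 * L) ^+ 2 <= 1 -> A * e * (L + 1) ^+ 2 <= 2^-1 ->
  (A * e * (L + 1) ^+ 2) ^+ 2 <= e -> 24 * A * e <= 1 ->
  0 <= nu -> 6 * A * e <= nu ^+ 2 ->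
  strip_region a b t1 t2 p ->
  (forall q, strip_region a b t1 t2 q -> v q <= v p) ->
  `|p.1| <= X0 /\ `|p.2 - 2^-1| <= nu.
Proof.
move=> P tv kaA low Hrho X1 c0X XL rhoA AL2 AL1 SS A24 nu0 Anu Omp pmax.
have e0 := profile_e P; have A0 := profile_A P.
have Ae : 0 < A * e by rewrite mulr_gt0.
have L0 : 0 <= L by lra.
have AL1' : A * e * (L + 1) ^+ 2 < 1 by lra.
have z : a <= 0 <= b by rewrite !ltW ?(profile_a P) ?(profile_b P).
have cen : 8^-1 - 3 * A * e <= v p.
  apply: le_trans (torsion_center_ge P tv kaA L0 rhoA AL2 AL1' Hrho) _; apply: pmax.
  have := profile_t1_le P z; have := profile_t2_le P z; rewrite expr0n mulr0.
  rewrite -!eq_le => /eqP z2 /eqP z1.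
  by split => //=; rewrite -z1 -z2 subr0; apply/andP; split; lra.
have XS : A * e * (X0 + 1) ^+ 2 <= A * e * (L + 1) ^+ 2 by rewrite ler_pM2l//; nra.
have S0 : 0 <= A * e * (X0 + 1) ^+ 2 by rewrite mulr_ge0 ?sqr_ge0// ltW.
have [p1 p2] : `|p.1| <= X0 /\ (p.2 - 2^-1) ^+ 2 <= 6 * A * e.
  apply: (max_location P tv low) => //; first lra.
  by apply: le_trans SS; rewrite !expr2; apply: ler_pM.
split=> //; have {Anu}p2 := le_trans p2 Anu.
by rewrite -(@ler_pXn2r _ 2)// ?nnegrE// (real_normK (num_real _)).
Qed.

(** The reflected expansion determines 2 v_xx + ka e / 2 on the midline up to the
    left side of the hypothesis bounded by ka e / 4, so - v_xx is at least
    ka e / 8 there; moving off the midline by 2 nu costs at most ka e / 16. *)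
Lemma hessian_near_center (R : realType) (a b e A : R) (t1 t2 : R -> R)
    (v : R * R -> R) (ka X0 L rho eps nu K : R) (q : R * R) :
  profile a b e A t1 t2 -> torsion_function (strip_region a b t1 t2) v ->
  0 < ka <= A ->
  (forall x, a <= x <= b -> `|x| <= 2 * L ->
    `|t1 x + t2 x - ka * e * x ^+ 2 / 2| <= rho * e) ->
  1 <= X0 -> X0 + 2 <= L -> 0 <= rho <= A -> 0 < eps <= 8^-1 ->
  A * e * (2 * L) ^+ 2 <= 1 -> A * e * (L + 1) ^+ 2 <= 2^-1 ->
  A * e * L ^+ 2 < eps -> 0 < nu <= 32^-1 ->
  512 * (3 * rho * e + 4 * (A * e * (L + 1) ^+ 2) ^+ 2 + 10 * A * e * eps
    + 10 * A * e / L ^+ 2 * ((X0 + 2) ^+ 2 + 1)) <= ka * e / 4 ->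
  K = 512 * (A * (L ^+ 2 + 3)) -> 512 * K * nu <= ka / 16 ->
  `|q.1| <= X0 + 1 -> `|q.2 - 2^-1| <= 2 * nu ->
  [/\ interior (strip_region a b t1 t2) q,
      ka / 16 * e <= - derive2 (1, 0) v q <= K * e,
      `|'D_(0, 1) ('D_(1, 0) v) q| <= K * e
    & `|'D_(1, 0) ('D_(0, 1) v) q| <= K * e].
Proof.
move=> P tv /andP[k0 kA] Hrho X1 XL /andP[rho0 rhoA] /andP[eps0 eps8]
  AL2 AL1 ALe /andP[nu0 nu32] + + + x1 y1.
have e0 := profile_e P; have A0 := profile_A P.
have L1 : 1 <= L by lra.
have kaA : 0 <= ka <= A by rewrite ltW.
have xL : `|q.1| <= L - 1 by lra.
have y16 : `|q.2 - 2^-1| <= 16^-1 by lra.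
have y8 : 3 / 8 <= q.2 <= 5 / 8.
  by move: y16; clear; rewrite ler_norml => /andP[? ?]; apply/andP; split; lra.
have [w1 w2 w3] := window_second_derivatives P tv kaA L1 rho0 AL2 AL1 eps0 eps8 ALe Hrho xL y8.
have near := second_derivative_near_center P tv kaA L1 rho0 AL2 AL1 eps0 eps8 ALe Hrho xL y16.
have cent := center_second_derivative P tv kaA L1 rho0 AL2 AL1 eps0 eps8 ALe Hrho xL.
rewrite -surjective_pairing in near w1 w2 w3.
have iq : interior (strip_region a b t1 t2) q.
  apply: (window_interior P kaA L1 AL1 eps0 eps8 ALe).
  move: xL y8 eps8; clear; rewrite ler_norml => /andP[? ?] /andP[? ?] ?.
  by split; apply/andP; split; lra.
have Ae : 0 <= A * e by rewrite mulr_ge0// ltW.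
have far : 10 * A * e / L ^+ 2 * ((`|q.1| + 1) ^+ 2 + 1)
    <= 10 * A * e / L ^+ 2 * ((X0 + 2) ^+ 2 + 1).
  rewrite ler_wpM2l//; first by rewrite divr_ge0 ?sqr_ge0// -mulrA mulr_ge0.
  rewrite lerD2r; move: (normr_ge0 q.1) x1 X1; clear => *; nra.
have rAe : rho * e <= A * e by rewrite ler_wpM2r// ltW.
have Lip0 : 0 <= (A * L ^+ 2 + rho + 2 * A) * e.
  have A0' := ltW A0; apply: mulr_ge0; last exact: ltW.
  by rewrite !addr_ge0// mulr_ge0// sqr_ge0.
move: near cent w1 w2 w3 far.
set B := (A * L ^+ 2 + rho + 2 * A) * e in Lip0 *.
set al := derive2 _ _ q; set al0 := derive2 _ _ _; set be1 := 'D__ _ _; set be2 := 'D__ _ _.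
set F1 := _ / _ * _; set F2 := _ / _ * _; set T := 3 * rho * e + _ + _.
move=> near cent w1 w2 w3 far tol KE lip.
have BK : 512 * B <= K * e by rewrite /B KE; move: rAe; clear => *; lra.
split => //; [|exact: le_trans w2 BK|exact: le_trans w3 BK].
have near' : 512 * (512 * B) * `|q.2 - 2^-1| <= 512 * (K * e) * (2 * nu).
  have c0 : 0 <= 512 :> R := ler0n _ 512.
  move: (BK) (mulr_ge0 c0 Lip0) (c0); clear c0 BK; move: (512 * B) (512 : R) => x c xK x0 c0.
  by apply: ler_pM => //; [exact: mulr_ge0|exact: ler_wpM2l].
have lip' := ler_wpM2r (ltW e0) lip.
move: near cent w1; rewrite !ler_norml => /andP[n1 n2] /andP[m1 m2] /andP[l1 l2].
move: far tol n1 n2 m1 m2 l1 l2 BK near' lip'; clear => *.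
apply/andP; split; lra.
Qed.

(** * Choice of the constants *)

Lemma small_scale (R : realType) (c d B e : R) : 0 < d -> 0 <= e ->
  c / d <= B -> e * B <= 1 -> c * e <= d.
Proof.
move=> d0 e0 cB eB; have := ler_wpM2l e0 cB.
by rewrite mulrA ler_pdivrMr// mulrC => /le_trans; apply; rewrite ler_piMl// ltW.
Qed.

(** The constants that do not depend on e, in their order of dependence: X0
    bounds the position of the maximum, L is the half-width of the window, rho
    the accuracy of the quadratic expansion of the height on it, eps the distance
    of the window from the sides of the strip, and nu the radius of the disc. *)
Lemma parameters_exist (R : realType) (ka c0 A w : R) :
  0 < ka <= A -> 0 < c0 -> 0 < w <= ka -> exists X0 L rho eps nu K : R,
    [/\ 1 <= X0, 24 * A + 2 <= c0 * X0 ^+ 2 & X0 + 2 <= L] /\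
    [/\ 0 < rho <= A, 0 < eps <= 8^-1, 0 < nu <= 32^-1, 0 < K
      & K = 512 * (A * (L ^+ 2 + 3))] /\
    [/\ 10 * A / L ^+ 2 * ((X0 + 2) ^+ 2 + 1) <= w,
        3 * rho <= w, 10 * A * eps <= w
      & 512 * K * nu <= ka / 16].
Proof.
move=> /andP[k0 kA] cc0 /andP[w0 wk]; have A0 : 0 < A by lra.
have [X0 [X1 c0X]] : exists X0, 1 <= X0 /\ 24 * A + 2 <= c0 * X0 ^+ 2.
  pose y := (24 * A + 2) / c0.
  have yE : 24 * A + 2 = c0 * y by rewrite [RHS]mulrC divfK// gt_eqF.
  have y0 : 0 <= y by rewrite divr_ge0 ?(ltW cc0)//; lra.
  exists (1 + y); split; first lra.
  by rewrite yE ler_pM2l//; nra.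
have [L [XL Lw]] : exists L, X0 + 2 <= L /\
    10 * A / L ^+ 2 * ((X0 + 2) ^+ 2 + 1) <= w.
  pose y := 10 * A * ((X0 + 2) ^+ 2 + 1) / w.
  have yE : 10 * A * ((X0 + 2) ^+ 2 + 1) = w * y by rewrite [RHS]mulrC divfK// gt_eqF.
  have y0 : 0 <= y.
    rewrite divr_ge0 ?(ltW w0)// mulr_ge0 ?addr_ge0 ?sqr_ge0// mulr_ge0//; exact: ltW.
  exists (X0 + 2 + y); split; first by rewrite lerDl.
  have L0 : 0 < (X0 + 2 + y) ^+ 2 by rewrite exprn_gt0//; lra.
  rewrite mulrAC ler_pdivrMr// yE ler_pM2l//; clear - X1 y0; nra.
have L1 : 1 <= L by lra.
have A10 : 0 < 10 * A by rewrite mulr_gt0.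
have [K KE] : exists K, K = 512 * (A * (L ^+ 2 + 3)) by eexists.
have K0 : 0 < K.
  have AL : 0 < A * (L ^+ 2 + 3) by rewrite mulr_gt0// addr_gt0// exprn_gt0//; lra.
  by rewrite KE; apply: mulr_gt0 AL; exact: ltr0n.
have K5 : 0 < 512 * K by apply: mulr_gt0 K0; exact: ltr0n.
exists X0, L, (w / 3), (Num.min 8^-1 (w / (10 * A))),
  (Num.min 32^-1 (ka / 16 / (512 * K))), K.
split => //; split; split => //.
- by apply/andP; split; lra.
- by rewrite lt_min invr_gt0 ltr0n ge_min lexx divr_gt0.
- by rewrite lt_min invr_gt0 ltr0n ge_min lexx !divr_gt0 ?ltr0n.
- by lra.
- by rewrite mulrC -ler_pdivlMr// ge_min lexx orbT.
- by rewrite mulrC -ler_pdivlMr// ge_min lexx orbT.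
Qed.

(** Finitely many conditions c e <= d hold together once e is below the inverse of
    1 plus the sum of the quotients c / d. *)
Lemma small_multiples (R : realType) (s : seq (R * R)) :
  all (fun cd => (0 <= cd.1) && (0 < cd.2)) s ->
  exists2 B, 1 <= B & forall e : R, 0 < e -> e * B <= 1 ->
    forall cd, cd \in s -> cd.1 * e <= cd.2.
Proof.
move=> spos; exists (1 + \sum_(cd <- s) cd.1 / cd.2).
  rewrite lerDl big_seq sumr_ge0// => cd /(allP spos)/andP[? ?].
  by rewrite divr_ge0// ltW.
move=> e e0 eB cd cds; have /andP[_ d0] := allP spos _ cds.
apply: small_scale (ltW e0) _ eB => //.
rewrite (big_rem cd)//= addrCA lerDl addr_ge0// big_seq sumr_ge0// => x /mem_rem.
by move=> /(allP spos)/andP[? ?]; rewrite divr_ge0// ltW.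
Qed.

(** The conditions on e are all of the form c e <= d; the strict one is obtained
    from half of its right-hand side. *)
Lemma small_scales_exist (R : realType) (ka A L eps nu K w : R) :
  0 < ka -> 0 < w -> 0 < A -> 1 <= L -> 0 < eps -> 0 < nu -> 0 < K ->
  exists2 B, 1 <= B & forall e : R, 0 < e -> e * B <= 1 ->
    [/\ A * e * (2 * L) ^+ 2 <= 1, A * e * (L + 1) ^+ 2 <= 2^-1,
        A * e * L ^+ 2 < eps, (A * e * (L + 1) ^+ 2) ^+ 2 <= e
      & 24 * A * e <= 1] /\
    [/\ 6 * A * e <= nu ^+ 2, 4 * (A * e * (L + 1) ^+ 2) ^+ 2 <= w * e,
        K * e <= 4^-1, 2 * K ^+ 2 * e <= ka / 16 / 4 & ka / 16 * e <= 1].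
Proof.
move=> k0 w0 A0 L1 eps0 nu0 K0.
have k16 : 0 < ka / 16 by rewrite divr_gt0.
move: (ka / 16) k16 => k k16.
have nn0 : 0 < nu ^+ 2 by rewrite exprn_gt0.
have S0 : 0 < A * (L + 1) ^+ 2 by rewrite mulr_gt0// exprn_gt0//; lra.
have L0 : 0 < L by lra.
pose s : seq (R * R) := [:: (A * (2 * L) ^+ 2, 1); (A * (L + 1) ^+ 2, 2^-1);
  (A * L ^+ 2, eps / 2); ((A * (L + 1) ^+ 2) ^+ 2, 1); (24 * A, 1); (6 * A, nu ^+ 2);
  (4 * (A * (L + 1) ^+ 2) ^+ 2, w); (K, 4^-1); (2 * K ^+ 2, k / 4); (k, 1)].
have spos : all (fun cd => (0 <= cd.1) && (0 < cd.2)) s.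
  have [A0' K0' k0'] : [/\ 0 <= A, 0 <= K & 0 <= k] by rewrite !ltW.
  rewrite /= !andbT; repeat (apply/andP; split);
    by rewrite ?invr_gt0 ?divr_gt0 ?ltr0n//; do ?[exact: sqr_ge0|apply: mulr_ge0].
have [B B1 small] := small_multiples spos.
exists B => // e e0 eB; have {}small := small _ e0 eB.
have h i : (i < size s)%N -> (nth (0, 0) s i).1 * e <= (nth (0, 0) s i).2.
  by move=> si; apply: small; exact: mem_nth.
have h0 := h 0 isT; have h1 := h 1 isT; have h2 := h 2 isT; have h3 := h 3 isT.
have h4 := h 4 isT; have h5 := h 5 isT; have h6 := h 6 isT; have h7 := h 7 isT.
have h8 := h 8 isT; have h9 := h 9 isT.
rewrite /= in h0 h1 h2 h3 h4 h5 h6 h7 h8 h9.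
have sq : (A * e * (L + 1) ^+ 2) ^+ 2 = (A * (L + 1) ^+ 2) ^+ 2 * e * e by ring.
split; split => //.
- by rewrite mulrAC.
- by rewrite mulrAC.
- by rewrite mulrAC; lra.
- by rewrite sq ler_piMl// ltW.
- by rewrite sq; have := ler_wpM2r (ltW e0) h6; clear; lra.
Qed.

Lemma peaked_of_hypotheses (R : realType) (j0 j1 : R) (ht : R -> R) :
  j0 < 0 < j1 -> j1 - j0 = 1 ->
  (forall s, j0 <= s <= j1 -> 0 <= ht s <= 1) ->
  concave_function `[j0, j1] ht ->
  (forall s, j0 < s < j1 -> derivable ht s 1 /\ derivable (derive1 ht) s 1) ->
  ht 0 = 1 -> derive1 ht 0 = 0 -> derive1n 2 ht 0 < 0 ->
  peaked j0 j1 ht (- derive1n 2 ht 0).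
Proof.
move=> /andP[h0 h1] hl hr hc hd t0 d0 dd0; split => //.
- by apply: convex_on_onem; exact: convex_functionP hc.
- by move=> s /hd[dv _]; rewrite derive1E; exact: derivableP.
- have [|_ dv] := hd 0; first by rewrite h0.
  by rewrite opprK /derive1n /= derive1E; exact: derivableP.
- by rewrite oppr_gt0.
Qed.

Lemma scaled_lower (R : realType) (j0 j1 c0 N : R) (ht f1 f2 : R -> R) : 0 < N ->
  (forall s, j0 <= s <= j1 -> c0 * s ^+ 2 <= 1 - ht s) ->
  (forall x, N * j0 <= x <= N * j1 -> height f1 f2 x = ht (N^-1 * x)) ->
  forall x, N * j0 <= x <= N * j1 -> c0 * N ^- 2 * x ^+ 2 <= f1 x + (1 - f2 x).
Proof.
move=> N0 Hc hE x xab.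
have -> : f1 x + (1 - f2 x) = 1 - ht (N^-1 * x) by rewrite -hE// /height; ring.
have -> : c0 * N ^- 2 * x ^+ 2 = c0 * (N^-1 * x) ^+ 2 by field; rewrite gt_eqF.
by apply: Hc; rewrite ler_pdivlMl// ler_pdivrMl.
Qed.

Lemma scaled_deviation (R : realType) (j0 j1 ka rho r eta N : R) (ht f1 f2 : R -> R) :
  0 < N -> 0 < r -> 0 <= rho -> r < N * eta ->
  (forall s : R, `|s| < eta ->
    `|1 - ht s - ka * s ^+ 2 / 2| <= rho / r ^+ 2 * s ^+ 2) ->
  (forall x, N * j0 <= x <= N * j1 -> height f1 f2 x = ht (N^-1 * x)) ->
  forall x, N * j0 <= x <= N * j1 -> `|x| <= r ->
    `|f1 x + (1 - f2 x) - ka * N ^- 2 * x ^+ 2 / 2| <= rho * N ^- 2.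
Proof.
move=> N0 r0 rho0 rN Heta hE x xab xr.
have -> : f1 x + (1 - f2 x) = 1 - ht (N^-1 * x) by rewrite -hE// /height; ring.
have sx : `|N^-1 * x| < eta.
  by rewrite normrM gtr0_norm ?invr_gt0// ltr_pdivrMl//; exact: le_lt_trans rN.
have -> : ka * N ^- 2 * x ^+ 2 = ka * (N^-1 * x) ^+ 2 by field; rewrite gt_eqF.
apply: le_trans (Heta _ sx) _.
have -> : rho / r ^+ 2 * (N^-1 * x) ^+ 2 = rho * N ^- 2 * (x ^+ 2 / r ^+ 2).
  by rewrite exprMn exprVn; ring.
rewrite ler_piMr//; first by rewrite mulr_ge0// invr_ge0 sqr_ge0.
rewrite ler_pdivrMr ?exprn_gt0// mul1r -(real_normK (num_real x)).
by rewrite ler_pXn2r// nnegrE// ltW.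
Qed.

Lemma tolerance_sum (R : realType) (ka A L X0 rho eps w e : R) : ka = 512 * (16 * w) -> 0 < e ->
  10 * A / L ^+ 2 * ((X0 + 2) ^+ 2 + 1) <= w ->
  3 * rho <= w -> 10 * A * eps <= w ->
  4 * (A * e * (L + 1) ^+ 2) ^+ 2 <= w * e ->
  512 * (3 * rho * e + 4 * (A * e * (L + 1) ^+ 2) ^+ 2 + 10 * A * e * eps
    + 10 * A * e / L ^+ 2 * ((X0 + 2) ^+ 2 + 1)) <= ka * e / 4.
Proof.
move=> wE e0 h1 h2 h3 h4.
have -> : ka * e / 4 = 512 * (4 * (w * e)) by rewrite wE; field.
apply: ler_wpM2l; first exact: ler0n.
have := ler_wpM2r (ltW e0) h1; have := ler_wpM2r (ltW e0) h2.
have := ler_wpM2r (ltW e0) h3; move: h4; clear => *; lra.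
Qed.

Theorem corollary1p1 (R : realType)
  (cstar c1 C1 : R) (hcstar : 0 < cstar < 2^-1) (hc1 : 0 < c1) (hC1 : 0 < C1)
  (hadm : error_admissible cstar c1 C1)
  (j0 j1 : R) (hJ0 : j0 < 0 < j1) (hJ1 : j1 - j0 = 1)
  (ht : R -> R)
  (ht_range : forall s, j0 <= s <= j1 -> 0 <= ht s <= 1)
  (ht_concave : concave_function `[j0, j1] ht)
  (ht_smooth : exists2 alpha : R, 0 < alpha < 1 & C2alpha_interior j0 j1 alpha ht)
  (ht0 : ht 0 = 1) (dht0 : derive1 ht 0 = 0) (ddht0 : derive1n 2 ht 0 < 0) :
  exists N0 c C M k K : R,
    [/\ 0 < N0, 0 < c, 0 < C & 2 < M] /\ 0 < k /\ 0 < K /\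
    forall N : R, N0 <= N ->
    forall f1 f2 : R -> R,
      normalised_domain (N * j0) (N * j1) f1 f2 ->
      (forall x, N * j0 <= x <= N * j1 -> height f1 f2 x = ht (N^-1 * x)) ->
      exists delta : R,
        [/\ C^-1 * N ^- 2 <= delta <= C * N ^- 2,
            property1 c1 C1 (N * j0) (N * j1) (height f1 f2) 0 M delta
          & forall (v : R * R -> R) (p : R * R),
              torsion_function (region (N * j0) (N * j1) f1 f2) v ->
              region (N * j0) (N * j1) f1 f2 p ->
              (forall q, region (N * j0) (N * j1) f1 f2 q -> v q <= v p) ->
              [/\ disc p c `<=` interior (region (N * j0) (N * j1) f1 f2),
                  (forall q n : R * R, disc p c q -> unit_direction n ->
                     C^-1 * Num.max (`|n.2| ^+ 2) delta <= - derive2 n v q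
                       <= C * Num.max (`|n.2| ^+ 2) delta)
                & (forall q : R * R, disc p c q ->
                     k * N ^- 2 <= - derive2 (1, 0) v q <= K * N ^- 2)]].
Proof.
have [alpha _ [hd _]] := ht_smooth.
have [ka H] : exists ka, peaked j0 j1 ht ka.
  by eexists; exact: (peaked_of_hypotheses hJ0 hJ1 ht_range ht_concave hd ht0 dht0 ddht0).
have k0 := peaked_ka H.
have [M [D [N1 [M2 D0 N10 HP]]]] := property1_peaked H hc1 hC1.
have [A [kA A1 A2 Aub]] := peaked_upper H; have [c0 cc0 Hc0] := peaked_lower H.
have A0 : 0 < A by lra.
have kA' : 0 < ka <= A by rewrite k0.
have [w w0 wE] : exists2 w, 0 < w & ka = 512 * (16 * w).
  by exists (ka / 512 / 16); [rewrite !divr_gt0 ?ltr0n|field].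
have wk : 0 < w <= ka by rewrite w0 wE; lra.
have [X0 [L [rho [eps [nu [K [[X1 c0X XL] [[rhoA eps8 nu32 K0 KE] [Lw rw ew nuK]]]]]]]]] :=
  parameters_exist kA' cc0 wk.
have L1 : 1 <= L by lra.
have L0 : 0 < 2 * L by lra.
have /andP[rho0 rA] := rhoA; have /andP[eps0 _] := eps8; have /andP[nu0 _] := nu32.
have [B B1 HB] := small_scales_exist k0 w0 A0 L1 eps0 nu0 K0.
have [eta eta0 [_ _ Heta]] := peaked_peano H (divr_gt0 rho0 (exprn_gt0 2 L0)).
set k := ka / 16 in nuK HB; have kp : 0 < k by rewrite divr_gt0.
have [C CE] : exists C, C = 2 + 2 * D / k + 2 * K * D + D by eexists.
have Dk : 0 < 2 * D / k by rewrite divr_gt0// mulr_gt0.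
have KD : 0 < 2 * K * D by rewrite !mulr_gt0.
have DC : D <= C by rewrite CE; lra.
have C0 : 0 < C by lra.
have Le : 0 < 2 * L / eta by rewrite divr_gt0.
exists (N1 + B + 2 * L / eta), nu, C, M, k, K.
split; first by split => //; lra.
split => //; split => // N NN f1 f2 Dom hE.
have [N0 NN1 BN NL] : [/\ 0 < N, N1 <= N, B <= N & 2 * L < N * eta].
  rewrite -ltr_pdivrMr//; move: NN N10 B1 Le; clear => NN N10 B1 Le; split; lra.
have [delta dlt prop] := HP N (height f1 f2) NN1 hE.
have e0 : 0 < N ^- 2 by rewrite invr_gt0 exprn_gt0.
have eB : N ^- 2 * B <= 1.
  rewrite mulrC ler_pdivrMr ?exprn_gt0// mul1r.
  by apply: (le_trans BN); rewrite expr2 ler_peMr ?(ltW N0)// (le_trans B1 BN).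
have [[q1 q2 q3 q4 q5] [q6 q7 q8 q9 q10]] := HB _ e0 eB.
exists delta; split => //.
  case/andP: dlt => d1 d2; apply/andP; split.
    by apply: le_trans d1; rewrite ler_pM2r// lef_pV2.
  by apply: le_trans d2 _; rewrite ler_pM2r.
move=> v p tv Omp pmax.
have P := scaled_profile H A0 N0 A1 A2 Aub Dom hE.
have f2E : f2 = (fun x => 1 - (1 - f2 x)) by apply/funext => x; ring.
have low := scaled_lower N0 Hc0 hE.
have dev := scaled_deviation N0 L0 (ltW rho0) NL Heta hE.
move: (N ^- 2) dlt e0 eB q1 q2 q3 q4 q5 q6 q7 q8 q9 q10 P low dev =>
  e dlt e0 eB q1 q2 q3 q4 q5 q6 q7 q8 q9 q10 P low dev.
have {tv Omp pmax}[tv Omp pmax] : [/\ torsion_function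
    (strip_region (N * j0) (N * j1) f1 (fun x => 1 - f2 x)) v,
    strip_region (N * j0) (N * j1) f1 (fun x => 1 - f2 x) p &
    forall q, strip_region (N * j0) (N * j1) f1 (fun x => 1 - f2 x) q -> v q <= v p].
  by rewrite -f2E.
rewrite [X in interior (region _ _ _ X)]f2E.
have kA0 : 0 <= ka <= A by rewrite ltW.
have rhoA' : 0 <= rho <= A by rewrite ltW.
have X0L : X0 <= L by move: XL; clear; lra.
have [p1 p2] := max_near_center P tv kA0 low dev X1 c0X X0L rhoA' q1 q2 q4 q5
  (ltW nu0) q6 Omp pmax.
have tol : 512 * (3 * rho * e + 4 * (A * e * (L + 1) ^+ 2) ^+ 2 + 10 * A * e * eps
    + 10 * A * e / L ^+ 2 * ((X0 + 2) ^+ 2 + 1)) <= ka * e / 4.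
  exact: tolerance_sum wE e0 Lw rw ew q7.
have Hess q : disc p nu q -> [/\
    interior (strip_region (N * j0) (N * j1) f1 (fun x => 1 - f2 x)) q,
    k * e <= - derive2 (1, 0) v q <= K * e,
    `|'D_(0, 1) ('D_(1, 0) v) q| <= K * e & `|'D_(1, 0) ('D_(0, 1) v) q| <= K * e].
  move=> /(disc_coordinates nu0)[d1 d2].
  apply: (hessian_near_center P tv kA' dev X1 XL rhoA' eps8 q1 q2 q3 nu32 tol KE nuK).
    have := ler_normD (q.1 - p.1) p.1; rewrite subrK.
    case/andP: nu32 => _ n32; move: d1 p1 n32; clear; lra.
  have := ler_normD (q.2 - p.2) (p.2 - 2^-1); rewrite addrA subrK.
  by move: d2 p2; clear; lra.
split.
- by move=> q /Hess[].
- move=> q n /Hess[iq a1 b1 b2] un.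
  have := derive2_quadratic_form (@open_interior _ _) (torsion_C2 tv) n iq.
  have := torsion_laplacian tv iq.
  move: a1 b1 b2; set al := derive2 (1, 0) v q; set ga := derive2 (0, 1) v q.
  move: (derive2 n v q) al ga ('D_(0, 1) _ q) ('D_(1, 0) _ q) => X al ga x y a1 b1 b2 lap ->.
  have xy : `|x + y| <= 2 * K * e by apply: le_trans (ler_normD _ _) _; move: b1 b2; clear; lra.
  have gaE : ga = -1 - al by rewrite -lap addrAC subrr add0r.
  have -> : - (n.1 ^+ 2 * al + n.1 * n.2 * (x + y) + n.2 ^+ 2 * ga) =
    n.1 ^+ 2 * - al - n.1 * n.2 * (x + y) + n.2 ^+ 2 * (1 - - al).
    by rewrite gaE; ring.
  exact: quadratic_form_bounds kp K0 D0 e0 q8 q9 q10 dlt a1 xy un CE.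
- by move=> q /Hess[].
Qed.
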